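(* Let $\mu>-1$, $\lambda>0$ and $n_\mu=\dfrac{-\mu+\sqrt{\mu^2+\lambda}}{2}$. Then, for every $x\ge 0$, $$\lim_{t\to\infty}\Big(t^{n_\mu}E_x^{\mu}\Big[\exp\Big\{-\frac\lambda2\int_0^t\frac{ds}{R_s^2}\Big\}\Big]\Big)=x^{2n_\mu}\,\frac{1}{2^{n_\mu}}\,\frac{\Gamma(\mu+n_\mu+1)}{\Gamma(\mu+2n_\mu+1)}.$$
   Context: Under $P_x^\mu$ (expectation $E_x^\mu$), $(R_t;t\ge0)$ is a Bessel process started at $x$ with index $\mu>-1$, i.e. of dimension $d_\mu=2(\mu+1)$ (its square is the squared Bessel process of dimension $d_\mu$; in particular $0$ is instantaneously reflecting when it is reached). Convention: $\exp(-\infty)=0$. *)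

(* Defs.v *)
From HB Require Import structures.
From mathcomp Require Import all_boot all_order all_algebra.
From mathcomp Require Import all_classical all_reals all_analysis.

Set Implicit Arguments.
Unset Strict Implicit.
Unset Printing Implicit Defensive.
Import Order.TTheory GRing.Theory Num.Theory.
Import numFieldNormedType.Exports.

Local Open Scope classical_set_scope.
Local Open Scope ring_scope.

(* Euler's Gamma function; meaningful for z > 0, where the integral converges. *)
Definition Gamma (R : realType) (z : R) : R :=
  \int[lebesgue_measure]_(u in `]0, +oo[) (u `^ (z - 1) * expR (- u)).

(* Modified Bessel function of the first kind I_nu(z), for nu > -1 and z > 0. *)
Definition besselI (R : realType) (nu z : R) : R :=
  limn (series (fun k : nat =>
    (z / 2) `^ (nu + k.*2%:R) / (k`!%:R * Gamma (nu + k%:R + 1)))).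

(* Transition density q_t(z, y), t > 0, z >= 0, y > 0, of the squared Bessel
   process of dimension del > 0, whose index is nu = del / 2 - 1.  For
   0 < del < 2 this is the semigroup for which 0 is instantaneously
   reflecting. *)
Definition besq_density (R : realType) (del t z y : R) : R :=
  let nu := del / 2 - 1 in
  if z == 0 then
    (2 * t) `^ (- (del / 2)) / Gamma (del / 2) * y `^ nu * expR (- (y / (2 * t)))
  else
    (2 * t)^-1 * (y / z) `^ (nu / 2) * expR (- ((z + y) / (2 * t))) *
    besselI nu (Num.sqrt (z * y) / t).

Definition besq_transition (R : realType) (del t z : R) (B : set R) : \bar R :=
  (\int[lebesgue_measure]_(y in B `&` `]0%R, +oo[) (besq_density del t z y)%:E)%E.

(* sigma(X_u ; 0 <= u <= s) *)
Definition natural_filtration (R : realType) (d : measure_display)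
    (T : measurableType d) (X : R -> T -> R) (s : R) : set (set T) :=
  <<s [set A | exists u (B : set R),
         [/\ 0 <= u <= s, measurable B & A = X u @^-1` B]] >>.

(* A time index is a real number; only the values X t with t >= 0 matter.
   The last clause is the Markov property
     P(X_t \in B | X_u, u <= s) = q_{t-s}(X_s, B)  a.s.,
   with the conditional expectation written out. *)
Definition is_squared_bessel (R : realType) (d : measure_display)
    (T : measurableType d) (P : probability T R)
    (del z : R) (X : R -> T -> R) : Prop :=
  [/\ (forall t, 0 <= t -> measurable_fun [set: T] (X t)),
      (forall t w, 0 <= t -> 0 <= X t w),
      (forall w, {within `[0, +oo[, continuous (fun t => X t w)}),
      {ae P, forall w, X 0 w = z}
    & forall (s t : R) (A : set T) (B : set R),
        0 <= s < t -> natural_filtration X s A -> measurable B ->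
        (P (A `&` (X t @^-1` B)) =
         \int[P]_(w in A) besq_transition del (t - s) (X s w) B)%E].

(* Bessel process of index mu > -1 (dimension 2 (mu + 1)) started at x >= 0:
   the nonnegative square root of a squared Bessel process. *)
Definition is_bessel (R : realType) (d : measure_display)
    (T : measurableType d) (P : probability T R)
    (mu x : R) (X : R -> T -> R) : Prop :=
  (forall t w, 0 <= t -> 0 <= X t w) /\
  is_squared_bessel P (2 * (mu + 1)) (x ^+ 2) (fun t w => X t w ^+ 2).

(* \int_0^t ds / X_s^2 along the path w, with 1 / 0 = +oo. *)
Definition inv_square_integral (R : realType) (T : Type)
    (X : R -> T -> R) (t : R) (w : T) : \bar R :=
  (\int[lebesgue_measure]_(s in `[0%R, t]) ((X s w ^+ 2)%:E)^-1)%E.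

Definition decay_exponent (R : realType) (mu lambda : R) : R :=
  (- mu + Num.sqrt (mu ^+ 2 + lambda)) / 2.

(* Main.v *)
Require Import Defs.
From HB Require Import structures.
From mathcomp Require Import all_boot all_order all_algebra.
From mathcomp Require Import all_classical all_reals all_analysis.
From mathcomp Require Import measurable_realfun ring lra.
Set Implicit Arguments.
Unset Strict Implicit.
Unset Printing Implicit Defensive.
Import Order.TTheory GRing.Theory Num.Theory.
Import numFieldNormedType.Exports.
Local Open Scope classical_set_scope.
Local Open Scope ring_scope.

(* Put [Z = X ^ 2], [b = mu + 2 n + 1] and [k = lambda / 2 = 2 n (n + mu)].  The
   exponent [n] makes [y ^ n] harmonic for the generator of [Z] killed at rate
   [k / y], and the corresponding Doob transform of the exponentials,
     h v t y = (1 + 2 v t) ^ (- b) * y ^ n * exp (- v y / (1 + 2 v t)),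
   solves the killed Kolmogorov equation.  Hence
     E [exp (- k \int_0^t ds / Z_s) * h v 0 Z_t] = h v t (x ^ 2)    for v > 0.
   No stochastic calculus is needed: writing the semigroup of [Z] as a Poisson
   mixture of Gamma laws, Kummer's contiguity relation gives the Dynkin formula
   of [h v] for the process without killing; the Markov property, the identity
   [k r_s exp (- k \int_0^s r) ds = - d exp (- k \int_0^s r)] and Fubini insert
   the killing at the truncated rate [k r = k / (Z + e)]; and [e] tends to [0].
   Integrating against [v ^ (n - 1) dv], where
   [\int_0^oo v ^ (n - 1) h v 0 y dv = Gamma n] for every [y > 0], yields
     Gamma n * E [exp (- k \int_0^t ds / Z_s)] =
       x ^ (2 n) * \int_0^oo v ^ (n - 1) (1 + 2 v t) ^ (- b) exp (- x ^ 2 v / (1 + 2 v t)) dv.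
   The last exponential lies between [exp (- x ^ 2 / (2 t))] and [1], and without
   it the integral is [(2 t) ^ (- n) Gamma n Gamma (b - n) / Gamma b]. *)

(** * Gamma integrals *)

(** The formula for [h] comes from a shift of index: conditioning by [y ^ n] turns the squared
    Bessel process of index [mu] into the one of index [mu + 2 n], of dimension [2 b], and [(1 + 2 v
    t) ^ (- b) * exp (- v y / (1 + 2 v t))] is the Laplace transform of the latter at time [t]. The
    parameter [v > 0] makes [h] bounded, which [y ^ n] alone is not; boundedness yields the finite
    quantities that may be subtracted. The obstacle is the origin. For [mu < 0] the process reaches
    [0], where [k / y] blows up, and the integral of the rate can be infinite. The truncated rate is
    bounded and continuous along paths, so its discount is differentiable in time. It leaves an
    error with factor [e / (Z + e)], which tends to [0] because [Z_s] is almost surely nonzero at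
    each fixed [s > 0]; this error is dominated by the untruncated rate times [h], integrable by the
    Dynkin formula itself. Of the two roots of [2 n (n + mu) = k] the positive one is taken, and
    [n + mu > 0] then makes the moments of order [n - 1] of the Gamma laws finite. *)

Lemma ge0_integral_dilation (R : realType) (c : R) (f : R -> \bar R) (D : set R) :
  0 < c -> measurable D -> measurable_fun D f -> (forall y, D y -> (0 <= f y)%E) ->
  (\int[lebesgue_measure]_(y in D) f y =
   c%:E * \int[lebesgue_measure]_(x in [set x | D (c * x)%R]) f (c * x)%R)%E.
Proof.
move=> c0 mD mf f0.
pose phi (x : measurableTypeR R) : measurableTypeR R := c * x.
have mphi : measurable_fun setT phi by exact: mulrl_measurable.
pose nu0 : {measure set (measurableTypeR R) -> \bar R} :=
  mscale (NngNum (ltW c0)) (pushforward lebesgue_measure phi).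
pose nu := nu0 mphi.
(* Lebesgue measure and [c] times its image under [phi] agree on half-open intervals, hence on all
   Borel sets. *)
have nuE A : measurable A -> lebesgue_measure A = nu A.
  move=> mA; apply/lebesgue_measure_unique => //= _ [[a b]] _ <-.
  rewrite /nu /mscale/= /pushforward.
  have -> : phi @^-1` `]a, b] = `](a / c), (b / c)]%classic.
    apply/seteqP; split => x /=; rewrite /phi !in_itv/= ltr_pdivrMr// ler_pdivlMr//;
    by rewrite !(mulrC c).
  rewrite !lebesgue_measure_itv/= !lte_fin ltr_pM2r ?invr_gt0//.
  case: ifPn => _; last by rewrite mule0.
  by rewrite -!EFinD -EFinM; congr (_%:E); field; rewrite gt_eqF.
transitivity (\int[nu]_(y in D) f y)%E.
  by apply: eq_measure_integral => A mA _; exact: nuE.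
rewrite ge0_integral_mscale//= ge0_integral_pushforward//.
by move=> y; rewrite inE; exact: f0.
Qed.

Lemma ge0_fubini_in (d1 d2 : measure_display) (T1 : measurableType d1)
    (T2 : measurableType d2) (R : realType)
    (m1 : {sigma_finite_measure set T1 -> \bar R})
    (m2 : {sigma_finite_measure set T2 -> \bar R})
    (D1 : set T1) (D2 : set T2) (f : T1 * T2 -> \bar R) :
  measurable D1 -> measurable D2 -> measurable_fun (D1 `*` D2) f ->
  (forall x y, D1 x -> D2 y -> 0 <= f (x, y))%E ->
  (\int[m1]_(x in D1) \int[m2]_(y in D2) f (x, y) =
   \int[m2]_(y in D2) \int[m1]_(x in D1) f (x, y))%E.
Proof.
move=> mD1 mD2 mf f0.
have mg : measurable_fun setT (f \_ (D1 `*` D2)).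
  by apply/(measurable_restrictT f) => //; exact: measurableX.
have g0 z : (0 <= (f \_ (D1 `*` D2)) z)%E.
  by rewrite patchE; case: ifPn => //; rewrite inE => -[]; case: z => x y /=; exact: f0.
have := @fubini_tonelli _ _ _ _ _ m1 m2 _ mg g0.
rewrite /fubini_F /fubini_G => E.
transitivity (\int[m1]_x \int[m2]_y (f \_ (D1 `*` D2)) (x, y))%E.
  rewrite integral_mkcond; apply: eq_integral => x _.
  rewrite patchE; case: ifPn => [|]; rewrite ?inE ?notin_setE => xD.
    rewrite integral_mkcond; apply: eq_integral => y _.
    rewrite !patchE; congr (if _ then _ else _).
    by apply/idP/idP; rewrite !inE// => -[].
  rewrite integral0_eq// => y _; rewrite patchE ifF//.
  by apply/negbTE; rewrite notin_setE => -[].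
rewrite E [RHS]integral_mkcond; apply: eq_integral => y _.
rewrite patchE; case: ifPn => [|]; rewrite ?inE ?notin_setE => yD.
  rewrite [RHS]integral_mkcond; apply: eq_integral => x _.
  rewrite !patchE; congr (if _ then _ else _).
  by apply/idP/idP; rewrite !inE// => -[].
rewrite integral0_eq// => x _; rewrite patchE ifF//.
by apply/negbTE; rewrite notin_setE => -[].
Qed.

Lemma ge0_integralZl_real (d : measure_display) (T : measurableType d)
    (R : realType) (m : {measure set T -> \bar R}) (D : set T) (k : R) (f : T -> R) :
  measurable D -> measurable_fun D f -> (forall x, D x -> 0 <= f x) -> 0 <= k ->
  (\int[m]_(x in D) (k * f x)%:E = k%:E * \int[m]_(x in D) (f x)%:E)%E.
Proof.
move=> mD mf f0 k0; rewrite -ge0_integralZl//; exact/measurable_EFinP.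
Qed.

Lemma derivable1_cvg (R : realType) (f : R -> R) (x : R) :
  derivable f x 1 -> f y @[y --> x] --> f x.
Proof. by move=> /derivable1_diffP; exact: differentiable_continuous. Qed.

Section gamma.
Variable R : realType.
Implicit Types s c : R.

Local Notation mu := (@lebesgue_measure R).

(** Extended-real valued, so that the functional equation can be used before the integral is known
    to be finite. The rate [c] is the second variable of the Fubini argument behind that
    equation. *)
Definition gamma_integral s c : \bar R :=
  (\int[mu]_(u in `]0%R, +oo[) (u `^ (s - 1) * expR (- (c * u)))%:E)%E.

Lemma measurable_powR_expR s c (D : set R) :
  measurable_fun D (fun u : R => u `^ s * expR (- (c * u))).
Proof.
apply: (@measurable_funTS _ _ _ _ D); apply: measurable_funM.
  exact: measurable_powR.
by apply: measurableT_comp => //; apply: measurableT_comp.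
Qed.

Lemma powR_expR_ge0 s c u : 0 <= u `^ s * expR (- (c * u)) :> R.
Proof. by rewrite mulr_ge0 ?powR_ge0 ?expR_ge0. Qed.

Lemma gamma_integral_ge0 s c : (0 <= gamma_integral s c)%E.
Proof. by apply: integral_ge0 => u _; rewrite lee_fin powR_expR_ge0. Qed.

Lemma gamma_integral_scale s c : 0 < c ->
  gamma_integral s 1 = ((c `^ s)%:E * gamma_integral s c)%E.
Proof.
move=> c0; pose f u := (u `^ (s - 1) * expR (- (1 * u)))%:E.
transitivity (c%:E * \int[mu]_(x in [set x | `]0%R, +oo[%classic (c * x)%R]) f (c * x)%R)%E.
  apply: (@ge0_integral_dilation R c f) => //.
  - by apply/measurable_EFinP; exact: measurable_powR_expR.
  - by move=> y _; rewrite lee_fin powR_expR_ge0.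
rewrite /gamma_integral.
have -> : [set x : R | `]0, +oo[%classic (c * x)] = `]0, +oo[%classic.
  by apply/seteqP; split => x /=; rewrite !in_itv/= !andbT pmulr_rgt0.
have -> : c `^ s = c * c `^ (s - 1).
  by rewrite -[X in X * _]powRr1 ?ltW// -powRD ?(gt_eqF c0) ?implybT// addrC subrK.
rewrite EFinM -muleA; congr (_ * _)%E.
rewrite -ge0_integralZl//; first last.
- by rewrite lee_fin powR_ge0.
- by move=> u _; rewrite lee_fin powR_expR_ge0.
- by apply/measurable_EFinP; exact: measurable_powR_expR.
apply: eq_integral => u; rewrite inE/= in_itv/= andbT => u0.
by rewrite -EFinM /f mul1r powRM ?ltW// mulrA.
Qed.

Lemma integral_expRN a c : 0 < c ->
  (\int[mu]_(x in `[a, +oo[) (expR (- (x * c)))%:E = (expR (- (a * c)) / c)%:E)%E.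
Proof.
move=> c0.
rewrite (@ge0_continuous_FTC2y R _ (fun x => - (expR (- (x * c)) / c)) a 0).
- by rewrite sub0e -EFinN opprK.
- by move=> x _; exact: expR_ge0.
- by apply: continuous_subspaceT => x; apply: derivable1_cvg; exact: ex_derive.
- rewrite -[X in _ --> X]oppr0; apply: cvgN.
  rewrite -(mul0r c^-1); apply: cvgMr_tmp.
  have h : (x * c : R) @[x --> +oo] --> +oo by exact: gt0_cvgMly.
  exact: (cvg_comp _ _ h (@cvgr_expR R)).
- by move=> x _; exact: ex_derive.
- apply: cvg_at_right_filter.
  have F1 : derivable (fun x : R => - (expR (- (x * c)) / c)) a 1 by exact: ex_derive.
  exact: (derivable1_cvg F1).
- move=> x _; rewrite derive1E derive_val /GRing.scale/=.
  by field; rewrite gt_eqF.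
Qed.

Lemma cvgr_lny : ln x @[x --> +oo] --> (+oo : set_system R).
Proof.
apply/cvgryPge => A; near=> x.
have x0 : 0 < x by [].
by rewrite -ler_expR lnK ?posrE//; near: x; exact: nbhs_pinfty_ge.
Unshelve. all: by end_near. Qed.

Lemma integral_powRN s : 0 < s ->
  (\int[mu]_(x in `[1%R, +oo[) (x `^ (- (s + 1)))%:E = (s^-1)%:E)%E.
Proof.
move=> s0.
rewrite (@ge0_continuous_FTC2y R _ (fun x => - (x `^ (- s) / s)) 1 0).
- by rewrite powR1 sub0e -EFinN opprK mul1r.
- by move=> x _; exact: powR_ge0.
- apply: derivable_within_continuous => x; rewrite in_itv/= andbT => x1.
  by apply: derivable_powR; rewrite in_itv/= andbT (lt_le_trans _ x1).
- rewrite -[X in _ --> X]oppr0; apply: cvgN.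
  rewrite -(mul0r s^-1); apply: cvgMr_tmp.
  apply: (@cvg_trans _ (expR (- (s * ln x)) @[x --> +oo])).
    apply: near_eq_cvg; near=> x.
    by rewrite /powR gt_eqF// mulNr.
  have h : (s * ln x : R) @[x --> +oo] --> +oo.
    by apply: gt0_cvgMry => //; exact: cvgr_lny.
  exact: (cvg_comp _ _ h (@cvgr_expR R)).
- move=> x x1.
  have x0 : 0 < x by rewrite (lt_trans _ x1).
  have dx := is_derive1_powR (- s) x0.
  exact: ex_derive.
- apply: cvg_at_right_filter.
  have d1 := is_derive1_powR (- s) (@ltr01 R).
  have F1 : derivable (fun x : R => - (x `^ (- s) / s)) 1 1 by exact: ex_derive.
  exact: (derivable1_cvg F1).
- move=> x; rewrite in_itv/= andbT => x1.
  have x0 : 0 < x by rewrite (lt_trans _ x1).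
  have dx := is_derive1_powR (- s) x0.
  rewrite derive1E derive_val /GRing.scale/= (opprD s 1).
  by field; rewrite gt_eqF.
Unshelve. all: by end_near. Qed.

(** In place of an integration by parts, [u ^ s * exp (- c u)] is integrated over [c >= 1] and
    [u > 0] in both orders. Integrating in [u] first gives [gamma_integral (s + 1) 1] times
    [c ^ (- (s + 1))], whose integral in [c] is [1 / s]; integrating in [c] first leaves
    [u ^ (s - 1) * exp (- u)]. Nonnegativity suffices for the exchange. *)
Lemma gamma_integralS s : 0 < s ->
  gamma_integral (s + 1) 1 = (s%:E * gamma_integral s 1)%E.
Proof.
move=> s0.
have ge1 c : `[1%R, +oo[%classic c -> 0 < c :> R.
  by rewrite /= in_itv/= andbT; exact: lt_le_trans.
pose f (z : R * R) := (z.2 `^ s * expR (- (z.1 * z.2)))%:E.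
have : (\int[mu]_(c in `[1%R, +oo[) \int[mu]_(u in `]0%R, +oo[) f (c, u) =
        \int[mu]_(u in `]0%R, +oo[) \int[mu]_(c in `[1%R, +oo[) f (c, u))%E.
  apply: ge0_fubini_in => //; last by move=> c u _ _; rewrite lee_fin powR_expR_ge0.
  apply/measurable_EFinP; apply: measurable_funTS; apply: measurable_funM.
    by apply: (measurableT_comp (measurable_powR s)).
  apply: measurableT_comp => //; apply: measurableT_comp => //.
  exact: measurable_funM.
have -> : (\int[mu]_(c in `[1%R, +oo[) \int[mu]_(u in `]0%R, +oo[) f (c, u) =
    (s^-1)%:E * gamma_integral (s + 1) 1)%E.
  rewrite -integral_powRN// muleC -ge0_integralZl//; last 3 first.
  - by apply/measurable_EFinP; exact: measurable_funTS (measurable_powR _).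
  - by move=> c _; rewrite lee_fin powR_ge0.
  - exact: gamma_integral_ge0.
  apply: eq_integral => c; rewrite inE => /ge1 c0.
  rewrite (gamma_integral_scale _ c0) muleAC -EFinM.
  rewrite -powRD ?(gt_eqF c0) ?implybT// subrr powRr0 mul1e.
  by rewrite /gamma_integral addrK.
have -> : (\int[mu]_(u in `]0%R, +oo[) \int[mu]_(c in `[1%R, +oo[) f (c, u) =
    gamma_integral s 1)%E.
  apply: eq_integral => u; rewrite inE/= in_itv/= andbT => u0.
  rewrite /f/= ge0_integralZl_real ?powR_ge0//; last first.
    apply: measurable_funTS; apply: measurableT_comp => //.
    by apply: measurableT_comp => //; exact: mulrr_measurable.
  rewrite integral_expRN// mul1r -EFinM; congr _%:E.
  rewrite powRB ?(gt_eqF u0) ?implybT// powRr1 ?ltW//; field.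
  by rewrite gt_eqF.
by move=> <-; rewrite muleA -EFinM divff ?gt_eqF// mul1e.
Qed.

(** For [u > 1] the power is compared with a term of the exponential series, for [u <= 1] with [1].
    The rate [1 / 2] leaves a spare factor [exp (- u / 2)] when the bound is used against
    [exp (- u)]. *)
Lemma powR_le_expR s : 0 <= s -> exists2 C, 0 < C &
  forall u, 0 < u -> u `^ s <= C * expR (u / 2).
Proof.
pose N := Num.bound s; pose A := 2 ^+ N.+1 * N.+1`!%:R : R.
have A0 : 0 < A by rewrite mulr_gt0 ?exprn_gt0// ltr0n fact_gt0.
move=> s0; exists (1 + A) => [|u u0]; first by rewrite addr_gt0.
  have [u1|u1] := leP u 1.
    rewrite (@le_trans _ _ 1)//.
      rewrite [X in _ <= X](_ : 1 = 1 `^ s :> R); last by rewrite powR1.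
      by rewrite ge0_ler_powR // nnegrE ltW.
    rewrite -[X in X <= _]mulr1 ler_pM//; first by rewrite lerDl ltW.
    by rewrite -expR0 ler_expR divr_ge0// ltW.
  have sN : s <= N.+1%:R.
    rewrite (@le_trans _ _ N%:R) ?ler_nat//.
    by rewrite ltW// /N archi_boundP.
  have uN : u `^ s <= u ^+ N.+1.
    by rewrite -(powR_mulrn _ (ltW u0)) ler_powR// ltW.
  apply: (le_trans uN); apply: (@le_trans _ _ (A * expR (u / 2))); last first.
    by rewrite ler_wpM2r ?expR_ge0// lerDr.
  have u2 : 0 <= u / 2 by rewrite divr_ge0// ltW.
  have := @expR_ge1Dxn _ _ N u2; rewrite expr_div_n => h.
  rewrite -ler_pdivrMl// (le_trans _ h)// ler_wpDl//.
  by rewrite /A invfM [leLHS]mulrC [X in X <= _]mulrA.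
Qed.

(** Finiteness is shown for [s + 1], where the integrand has no singularity at [0], and comes back
    to [s] through the functional equation. *)
Lemma gamma_integral_lty s : 0 < s -> (gamma_integral s 1 < +oo)%E.
Proof.
move=> s0; rewrite -(@lte_pmul2l _ s%:E)// -gamma_integralS// mulry gtr0_sg// mul1e.
have [C C0 leC] := powR_le_expR (ltW s0).
rewrite /gamma_integral addrK.
apply: (@le_lt_trans _ _ (\int[mu]_(u in `]0%R, +oo[) (C * expR (- (u * 2^-1)))%:E)%E).
  apply: ge0_le_integral => //.
  - by move=> u _; rewrite lee_fin powR_expR_ge0.
  - by apply/measurable_EFinP; exact: measurable_powR_expR.
  - apply/measurable_EFinP; apply: measurable_funTS; apply: measurable_funM => //.
    by apply: measurableT_comp => //; apply: measurableT_comp => //; exact: mulrr_measurable.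
  - move=> u; rewrite /= in_itv/= andbT => u0; rewrite lee_fin mul1r.
    have -> : - (u * 2^-1) = u / 2 - u by field.
    by rewrite expRD mulrA ler_wpM2r ?expR_ge0// leC.
have C0' := ltW C0.
have mE D : measurable_fun D (fun u : R => expR (- (u * 2^-1))).
  apply: measurable_funTS; apply: measurableT_comp => //.
  by apply: measurableT_comp => //; exact: mulrr_measurable.
rewrite ge0_integralZl_real//; last exact: mE.
rewrite integral_itv_obnd_cbnd; last exact/measurable_EFinP.
by rewrite integral_expRN ?invr_gt0// -EFinM ltry.
Qed.

Lemma gamma_integralE s c : 0 < s -> 0 < c ->
  gamma_integral s c = (Gamma s * c `^ (- s))%:E.
Proof.
move=> s0 c0.
have GE : gamma_integral s 1 = (Gamma s)%:E.
  rewrite /Gamma /Rintegral.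
  have -> : (\int[mu]_(u in `]0%R, +oo[) (u `^ (s - 1) * expR (- u))%:E)%E =
      gamma_integral s 1 by apply: eq_integral => u _; rewrite mul1r.
  by rewrite fineK// ge0_fin_numE ?gamma_integral_ge0 ?gamma_integral_lty.
have cs0 : 0 < c `^ s by rewrite powR_gt0.
rewrite EFinM -GE (gamma_integral_scale _ c0) muleC muleA -EFinM powRN mulVf ?gt_eqF//.
by rewrite mul1e.
Qed.

Lemma GammaS s : 0 < s -> Gamma (s + 1) = s * Gamma s.
Proof.
move=> s0; have := gamma_integralS s0.
rewrite !gamma_integralE//; last by rewrite addr_gt0.
by move=> /(congr1 fine)/=; rewrite !powR1 !mulr1.
Qed.

Lemma Gamma_gt0 s : 0 < s -> 0 < Gamma s.
Proof.
(* For [r >= 1] the integrand is at least [exp (- 2)] on [[1, 2]]; smaller arguments follow by the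
   functional equation. *)
suff Gamma1 (r : R) : 1 <= r -> 0 < Gamma r.
  by move=> s0; rewrite -(pmulr_rgt0 _ s0)// -GammaS// Gamma1// lerDr ltW.
move=> r1; have r0 : 0 < r by rewrite (lt_le_trans _ r1).
have := gamma_integralE r0 (@ltr01 R); rewrite powR1 mulr1 => GE.
rewrite -lte_fin -GE.
apply: (@lt_le_trans _ _ (\int[mu]_(u in `[1%R, 2%R]) (expR (- 2))%:E)%E).
  rewrite integral_cst//= lebesgue_measure_itv/= lte_fin ltr1n -EFinD -EFinM lte_fin.
  by rewrite mulr_gt0 ?expR_gt0//; lra.
apply: (@le_trans _ _ (\int[mu]_(u in `[1%R, 2%R]) (u `^ (r - 1) * expR (- (1 * u)))%:E)%E).
  apply: ge0_le_integral => //.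
  - by apply/measurable_EFinP; exact: measurable_powR_expR.
  - move=> u; rewrite /= in_itv/= => /andP[u1 u2]; rewrite lee_fin -[X in X <= _]mul1r.
    apply: ler_pM => //.
      by rewrite -[leLHS](powRr0 u) ler_powR// subr_ge0.
    by rewrite ler_expR mul1r lerN2.
apply: ge0_subset_integral => //.
- by apply/measurable_EFinP; exact: measurable_powR_expR.
- by move=> u _; rewrite lee_fin powR_expR_ge0.
- by move=> u; rewrite /= !in_itv/= andbT => /andP[u1 _]; rewrite (lt_le_trans _ u1).
Qed.

End gamma.

(** * Equality of weighted image measures, from sets to nonnegative functions *)

Section integral_transfer.
Local Open Scope ereal_scope.
Import HBNNSimple.

(** Multiplication by [+oo] is not continuous at [0], but a nondecreasing sequence of nonnegative
    terms is either identically [0] or eventually positive, and its product with [+oo] is then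
    eventually constant. *)
Lemma cvge_ndMr (R : realType) (u : (\bar R)^nat) (l h : \bar R) :
  (forall n, 0 <= u n) -> nondecreasing_seq u -> u @ \oo --> l -> 0 <= h ->
  (fun n => u n * h) @ \oo --> l * h.
Proof.
move=> u0 ndu ul h0; case: h h0 => [r r0||//]; first exact: cvgeZr.
move=> _; have lE : l = ereal_sup (range u).
  by apply: cvg_unique ul (ereal_nondecreasing_cvgn ndu).
have ul' n : u n <= l by rewrite lE; apply: ereal_sup_ubound; exists n.
have l0 : 0 <= l by exact: le_trans (u0 0%N) (ul' 0%N).
have [le0|lgt0] := leP l 0.
  have -> : l = 0 by apply/eqP; rewrite eq_le le0.
  rewrite mul0e; apply: cvg_near_cst; apply: nearW => n.
  have -> : u n = 0 by apply/eqP; rewrite eq_le u0 (le_trans (ul' n)).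
  by rewrite mul0e.
rewrite gt0_muley//; apply: cvg_near_cst.
move: (lgt0); rewrite lE => /ereal_sup_gt[_ [m _ <-] um].
exists m => // n /= mn; rewrite gt0_muley//; exact: lt_le_trans um (ndu _ _ mn).
Qed.

Context (d1 d2 d' : measure_display) (T1 : measurableType d1)
  (T2 : measurableType d2) (T' : measurableType d') (R : realType).

Lemma integral_comp_sfunM d (T : measurableType d) (m : {measure set T -> \bar R})
    (phi : T -> T') (h : T -> \bar R) (g : {nnsfun T' >-> R}) :
  measurable_fun setT phi -> measurable_fun setT h -> (forall x, 0 <= h x) ->
  \int[m]_x ((g (phi x))%:E * h x) =
  \sum_(y \in range g) y%:E * \int[m]_x ((\1_(g @^-1` [set y]) (phi x))%:E * h x).
Proof.
move=> mphi mh h0.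
have mI y : measurable_fun setT (fun x => (\1_(g @^-1` [set y]) (phi x) : R)%:E * h x).
  apply: emeasurable_funM => //; apply/measurable_EFinP.
  by apply: measurableT_comp => //; exact: measurable_indic.
have I0 y x : 0 <= (\1_(g @^-1` [set y]) (phi x) : R)%:E * h x.
  by rewrite mule_ge0// lee_fin.
(* [Num.max 0 y] makes the summand nonnegative for every real [y]; on the range of [g] it equals
   [y]. *)
transitivity (\int[m]_x \sum_(y \in range g)
    (Num.max 0 y)%:E * ((\1_(g @^-1` [set y]) (phi x))%:E * h x)).
  apply: eq_integral => x _; rewrite fimfunE fsbig_finite//= -sumEFin.
  rewrite ge0_sume_distrl; last first.
    by move=> y _; rewrite nnfun_muleindic_ge0.
  rewrite fsbig_finite//=; apply: eq_big_seq => y.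
  rewrite in_fset_set// inE => -[z _ <-].
  by rewrite EFinM muleA max_r// fun_ge0.
rewrite ge0_integral_fsum//; last 2 first.
  by move=> y; apply: measurable_funeM.
  by move=> y x _; rewrite mule_ge0// lee_fin le_max lexx.
apply: eq_fsbigr => y; rewrite inE => -[z _ <-].
rewrite max_r ?fun_ge0// ge0_integralZl//.
by rewrite lee_fin fun_ge0.
Qed.

Lemma integral_comp_limM d (T : measurableType d) (m : {measure set T -> \bar R})
    (phi : T -> T') (h : T -> \bar R) (f : T' -> \bar R) (mf : measurable_fun setT f) :
  measurable_fun setT phi -> measurable_fun setT h -> (forall x, 0 <= h x) ->
  (forall y, 0 <= f y) ->
  \int[m]_x (f (phi x) * h x) =
  limn (fun n => \int[m]_x ((nnsfun_approx measurableT mf n (phi x))%:E * h x)).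
Proof.
move=> mphi mh h0 f0.
rewrite -monotone_convergence//; last 3 first.
- move=> n; apply: emeasurable_funM => //; apply/measurable_EFinP.
  exact: measurableT_comp.
- by move=> n x _; rewrite mule_ge0// lee_fin.
- move=> x _ a b ab; apply: lee_wpmul2r => //.
  by rewrite lee_fin; exact/lefP/nd_nnsfun_approx.
apply: eq_integral => x _; apply/esym/cvg_lim => //.
apply: cvge_ndMr => //.
- by move=> n; rewrite lee_fin.
- by move=> a b ab; rewrite lee_fin; exact/lefP/nd_nnsfun_approx.
- by apply: cvg_nnsfun_approx.
Qed.

(** The two sides may live on different spaces, and the weights may be infinite. It serves to
    compare the law of [Z t] on an event with a Lebesgue density, and to compare two weights on the
    sigma-algebra of the past. *)
Lemma integral_transfer (m1 : {measure set T1 -> \bar R}) (m2 : {measure set T2 -> \bar R})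
    (phi1 : T1 -> T') (phi2 : T2 -> T') (h1 : T1 -> \bar R) (h2 : T2 -> \bar R)
    (f : T' -> \bar R) :
  measurable_fun setT phi1 -> measurable_fun setT phi2 ->
  measurable_fun setT h1 -> measurable_fun setT h2 ->
  (forall x, 0 <= h1 x) -> (forall x, 0 <= h2 x) ->
  (forall B, measurable B -> \int[m1]_x ((\1_B (phi1 x))%:E * h1 x) =
                             \int[m2]_x ((\1_B (phi2 x))%:E * h2 x)) ->
  measurable_fun setT f -> (forall y, 0 <= f y) ->
  \int[m1]_x (f (phi1 x) * h1 x) = \int[m2]_x (f (phi2 x) * h2 x).
Proof.
move=> mphi1 mphi2 mh1 mh2 h10 h20 E mf f0.
rewrite !(integral_comp_limM _ mf)//; congr (limn _); apply/funext => n.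
rewrite !integral_comp_sfunM//; apply: eq_fsbigr => y _; congr (_ * _).
exact: E.
Qed.

End integral_transfer.

(** * The squared Bessel semigroup as a Poisson mixture of Gamma laws *)

Lemma nneseries_EFin (R : realType) (u : R ^nat) (l : R) :
  series u @ \oo --> l -> (\sum_(k <oo) (u k)%:E = l%:E)%E.
Proof.
move=> ul; apply/cvg_lim => //.
apply: (@cvg_trans _ ((EFin \o series u) @ \oo)).
  by apply: near_eq_cvg; apply: nearW => n /=; rewrite /series/= sumEFin.
by apply: cvg_EFin; [exact: nearW|exact: ul].
Qed.

Section mixture.
Variable R : realType.
Implicit Types a t z y : R.

Local Notation mu := (@lebesgue_measure R).

Definition poisson_weight z (k : nat) : R := expR (- z) * (z ^+ k / k`!%:R).

(** The Gamma law of shape [a] and scale [t]. *)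
Definition gamma_density a t y : R :=
  t `^ (- a) / Gamma a * (y `^ (a - 1) * expR (- (t^-1 * y))).

Lemma poisson_weight_ge0 z k : 0 <= z -> 0 <= poisson_weight z k.
Proof. by move=> z0; rewrite mulr_ge0 ?expR_ge0// divr_ge0// exprn_ge0. Qed.

Lemma gamma_density_ge0 a t y : 0 < a -> 0 <= gamma_density a t y.
Proof.
by move=> a0; rewrite mulr_ge0 ?powR_expR_ge0// divr_ge0 ?powR_ge0// ltW// Gamma_gt0.
Qed.

Lemma measurable_gamma_density a t D : measurable_fun D (gamma_density a t).
Proof. by apply: measurable_funM => //; exact: measurable_powR_expR. Qed.

(** From [k = 1] on the factor [a + k] of the functional equation is at least [1], so [Gamma] is
    nondecreasing along [a + 1, a + 2, ...]; only [Gamma a] has to be considered apart. *)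
Lemma Gamma_lbound a : 0 < a -> exists2 m, 0 < m & forall k : nat, m <= Gamma (a + k%:R).
Proof.
move=> a0; exists (Num.min (Gamma a) (Gamma (a + 1))).
  by rewrite lt_min !Gamma_gt0// addr_gt0.
case=> [|k]; first by rewrite addr0 ge_min lexx.
elim: k => [|k ih]; first by rewrite ge_min lexx orbT.
have k0 : 0 < a + k.+1%:R by rewrite addr_gt0.
apply: (le_trans ih); rewrite -[in leRHS]natr1 addrA GammaS//.
rewrite ler_peMl ?(ltW (Gamma_gt0 k0))// -natr1.
by have := ler0n R k; lra.
Qed.

Lemma is_cvg_series_le_exp (u : R ^nat) (C x : R) :
  (forall k, 0 <= u k <= C * exp_coeff x k) -> cvgn (series u).
Proof.
move=> uC; apply: (@series_le_cvg _ u (fun k => C * exp_coeff x k)).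
- by move=> k; have /andP[] := uC k.
- by move=> k; have /andP[] := uC k; exact: le_trans.
- by move=> k; have /andP[] := uC k.
- apply: is_cvg_seriesZ; exact: is_cvg_series_exp_coeff.
Qed.

(** [besselI] is a [limn], which carries information only once the series converges; it is dominated
    by the exponential series at [(z / 2) ^ 2]. *)
Lemma cvg_besselI nu z : -1 < nu -> 0 < z ->
  series (fun k => (z / 2) `^ (nu + k.*2%:R) / (k`!%:R * Gamma (nu + k%:R + 1))) @ \oo
    --> besselI nu z.
Proof.
move=> nu1 z0; rewrite /besselI.
have a0 : 0 < nu + 1 by rewrite -ltrBlDr sub0r.
have [m m0 mG] := Gamma_lbound a0.
have z2 : 0 < z / 2 by rewrite divr_gt0.
have G0 k : 0 < Gamma (nu + k%:R + 1).
  by rewrite addrAC (lt_le_trans m0).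
have kf k : 0 < k`!%:R :> R by rewrite ltr0n fact_gt0.
apply: (@is_cvg_series_le_exp _ ((z / 2) `^ nu / m) ((z / 2) ^+ 2)) => k.
apply/andP; split.
  by rewrite divr_ge0 ?powR_ge0// mulr_ge0 ?ltW.
rewrite powRD ?(gt_eqF z2) ?implybT// (powR_mulrn _ (ltW z2)) -muln2 mulnC exprM.
rewrite /exp_coeff/= invfM -!mulrA ler_wpM2l ?powR_ge0//.
rewrite [leLHS]mulrA [leRHS]mulrC ler_wpM2l//.
  by rewrite divr_ge0 ?exprn_ge0 ?ltW.
by rewrite lef_pV2 ?posrE// addrAC.
Qed.

(* The squared Bessel law is a Poisson mixture of Gamma laws. *)
Lemma besq_density_mixture del t z y : 0 < del -> 0 < t -> 0 <= z -> 0 < y ->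
  series (fun k => poisson_weight (z / (2 * t)) k * gamma_density (del / 2 + k%:R) (2 * t) y)
    @ \oo --> besq_density del t z y.
Proof.
move=> del0 t0 z0 y0; rewrite /besq_density.
have t2 : 0 < 2 * t by rewrite mulr_gt0.
case: (eqVneq z 0) => [->|zn0].
  rewrite mul0r.
  (* At [z = 0] the Poisson law sits on [k = 0] (with [0 ^ 0 = 1]), so the partial sums are constant
     from the first nonempty one on. *)
  apply: cvg_near_cst; exists 1%N => // -[//|n] _ /=.
  rewrite /series/= big_nat_recl// big1 => [|k _]; last first.
    by rewrite /poisson_weight expr0n/= mul0r mulr0 mul0r.
  rewrite /poisson_weight /gamma_density oppr0 expR0 expr0 fact0 divr1 !mul1r !addr0.
  by rewrite !mulrA [_^-1 * y]mulrC.
have zp : 0 < z by rewrite lt_neqAle eq_sym zn0.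
set nu := del / 2 - 1; set u := Num.sqrt (z * y) / t.
have u0 : 0 < u by rewrite divr_gt0// sqrtr_gt0 mulr_gt0.
have nu1 : -1 < nu by rewrite /nu ltrBrDr addNr divr_gt0.
set c := _ * expR _.
have := cvgMl_tmp (a := c) (cvg_besselI nu1 u0).
move=> h; apply: cvg_trans (h _); apply: near_eq_cvg; apply: nearW => n.
rewrite /series/= big_distrr/=; apply: eq_bigr => k _.
rewrite /c /poisson_weight /gamma_density.
have -> : nu + k%:R + 1 = del / 2 + k%:R by rewrite /nu; ring.
have Gn0 : Gamma (del / 2 + k%:R) != 0.
  have a0 : 0 < del / 2 by rewrite divr_gt0.
  by rewrite gt_eqF// Gamma_gt0//; have := ler0n R k; lra.
have kn0 : k`!%:R != 0 :> R by rewrite pnatr_eq0 -lt0n fact_gt0.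
pose A := expR (- (z / (2 * t))) * (z / (2 * t)) ^+ k * (2 * t) `^ (- (del / 2 + k%:R)) *
  y `^ (del / 2 + k%:R - 1) * expR (- ((2 * t)^-1 * y)).
pose B := (2 * t)^-1 * (y / z) `^ (nu / 2) * expR (- ((z + y) / (2 * t))) *
  (u / 2) `^ (nu + k.*2%:R).
suff E : A = B.
  transitivity (B / (k`!%:R * Gamma (del / 2 + k%:R))).
    by rewrite /B; field; rewrite ?Gn0 ?kn0 ?(gt_eqF t0).
  by rewrite -E /A; field; rewrite ?Gn0 ?kn0 ?(gt_eqF t0).
rewrite /A /B.
have -> : u / 2 = Num.sqrt (z * y) / (2 * t) by rewrite /u; field; rewrite gt_eqF.
move: (2 * t) t2 => p p0; rewrite [p^-1 * y]mulrC.
(* Writing [p], [z] and [y] as exponentials turns the remaining identity between powers into one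
   between exponents. *)
have [lp pE] := expR_total p0; have [lz zE] := expR_total zp.
have [ly yE] := expR_total y0.
have -> : (Num.sqrt (z * y) / p) `^ (nu + k.*2%:R) =
    expR (((lz + ly) / 2 - lp) * (nu + k.*2%:R)).
  rewrite expRM; congr (_ `^ _).
  by rewrite -powR12_sqrt ?mulr_ge0 ?ltW// -zE -yE -pE -expRD -expRM -expRN -expRD.
have -> : (y / z) `^ (nu / 2) = expR ((ly - lz) * (nu / 2)).
  by rewrite expRM -yE -zE expRB.
have -> : (z / p) ^+ k = expR (k%:R * (lz - lp)) by rewrite -zE -pE -expRB -expRM_natl.
have -> : expR (- ((z + y) / p)) = expR (- (z / p)) * expR (- (y / p)).
  by rewrite -expRD -opprD -mulrDl.
rewrite -yE -pE -!expRM -[(expR lp)^-1 in RHS]expRN.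
transitivity (expR (- (z / expR lp)) * expR (- (expR ly / expR lp)) *
  expR (k%:R * (lz - lp) + lp * - (del / 2 + k%:R) + ly * (del / 2 + k%:R - 1))).
  by rewrite !expRD; ring.
transitivity (expR (- (z / expR lp)) * expR (- (expR ly / expR lp)) *
  expR (- lp + (ly - lz) * (nu / 2) + ((lz + ly) / 2 - lp) * (nu + k.*2%:R))); last first.
  by rewrite !expRD -!expRN; ring.
by congr (_ * expR _); rewrite /nu -muln2 natrM; field.
Qed.

End mixture.

Lemma nneseriesMr (R : realType) (u : (\bar R)^nat) (h : \bar R) :
  (forall k, 0 <= u k)%E -> (0 <= h)%E ->
  (\sum_(k <oo) (u k * h) = (\sum_(k <oo) u k) * h)%E.
Proof.
move=> u0 h0; apply/cvg_lim => //.
have -> : (fun n => \sum_(0 <= k < n) (u k * h))%E = (fun n => (\sum_(0 <= k < n) u k) * h)%E.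
  by apply/funext => n; rewrite ge0_sume_distrl.
apply: cvge_ndMr => //.
- by move=> n; exact: sume_ge0.
- by move=> a b ab; apply: ereal_nondecreasing_series.
- by apply: is_cvg_nneseries => n _ _; exact: u0.
Qed.

(** * The Markov property for functions and for weights measurable in the past *)

Section transition.
Variable R : realType.
Implicit Types del t z : R.

Local Notation mu := (@lebesgue_measure R).

(** The semigroup as a mixture rather than through [besq_density]: on powers times exponentials each
    Gamma component has a closed form. *)
Definition besq_op del t z (f : R -> \bar R) : \bar R :=
  (\sum_(k <oo) (poisson_weight (z / (2 * t)) k)%:E *
    \int[mu]_(y in `]0%R, +oo[) (f y * (gamma_density (del / 2 + k%:R) (2 * t) y)%:E))%E.

Lemma half_natr_gt0 del (k : nat) : 0 < del -> 0 < del / 2 + k%:R.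
Proof. by move=> del0; have := ler0n R k; have := divr_gt0 del0 (@ltr0n R 2); lra. Qed.

Lemma besq_transitionE del t z (B : set R) : 0 < del -> 0 < t -> 0 <= z -> measurable B ->
  besq_transition del t z B = besq_op del t z (fun y => (\1_B y)%:E).
Proof.
move=> del0 t0 z0 mB; rewrite /besq_transition /besq_op.
pose g k y := gamma_density (del / 2 + k%:R) (2 * t) y.
have w0 k : 0 <= poisson_weight (z / (2 * t)) k.
  by rewrite poisson_weight_ge0// divr_ge0// mulr_ge0// ltW.
have g0 k y : 0 <= g k y by rewrite gamma_density_ge0// half_natr_gt0.
have mg k D : measurable_fun D (g k) by exact: measurable_gamma_density.
transitivity (\int[mu]_(y in B `&` `]0%R, +oo[)
    \sum_(k <oo) (poisson_weight (z / (2 * t)) k)%:E * (g k y)%:E)%E.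
  apply: eq_integral => y; rewrite inE => -[_]; rewrite /= in_itv/= andbT => y0.
  by rewrite -(nneseries_EFin (besq_density_mixture del0 t0 z0 y0)).
rewrite integral_nneseries; last 3 first.
- exact: measurableI.
- by move=> k; apply: measurable_funeM; apply/measurable_EFinP; exact: mg.
- by move=> k y _; rewrite mule_ge0// lee_fin.
apply: eq_eseriesr => k _.
have mBI : measurable (B `&` `]0%R, +oo[) by exact: measurableI.
have w0E : (0 <= (poisson_weight (z / (2 * t)) k)%:E)%E by rewrite lee_fin.
rewrite ge0_integralZl//; last 2 first.
- by apply/measurable_EFinP; exact: mg.
- by move=> y _; rewrite lee_fin.
congr (_ * _)%E; rewrite integral_mkcondl; apply: eq_integral => y _.
by rewrite epatch_indic /= muleC.
Qed.

Context (d : measure_display) (T : measurableType d) (P : probability T R).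
Variables (Z : R -> T -> R) (del z0 : R).
Hypothesis del0 : 0 < del.
Hypothesis HZ : is_squared_bessel P del z0 Z.

(** The generators of [natural_filtration], named so that the sigma-algebra they generate can serve
    as a measurable type on [T]. *)
Definition past_events s : set (set T) :=
  [set A | exists u (B : set R), [/\ 0 <= u <= s, measurable B & A = Z u @^-1` B]].

Notation past s := (g_sigma_algebraType (past_events s)).

Let mZ t : 0 <= t -> measurable_fun [set: T] (Z t). Proof. by case: HZ => + _ _ _ _; apply. Qed.

Let Z_ge0 t w : 0 <= t -> 0 <= Z t w. Proof. by case: HZ => _ + _ _ _; apply. Qed.

Lemma past_measurable s (A : set T) : natural_filtration Z s A -> measurable A.
Proof.
apply: smallest_sub; first exact: sigma_algebra_measurable.
move=> _ [u [B [/andP[u0 _] mB ->]]].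
by rewrite -[_ @^-1` _]setTI; exact: mZ.
Qed.

Lemma past_measurable_fun s (d' : measure_display) (T' : measurableType d') (f : T -> T') :
  measurable_fun [set: past s] (f : past s -> T') -> measurable_fun [set: T] f.
Proof.
move=> mf _ Y mY; apply: (@past_measurable s).
exact: (mf measurableT Y mY).
Qed.

Lemma measurable_past s u : 0 <= u <= s -> measurable_fun [set: past s] (Z u : past s -> R).
Proof.
move=> us _ Y mY; rewrite setTI; apply: sub_sigma_algebra.
by exists u, Y.
Qed.

Lemma measurable_besq_op s t f : 0 <= s < t ->
  (forall y, 0 <= f y)%E -> measurable_fun setT f ->
  measurable_fun [set: T] (fun w => besq_op del (t - s) (Z s w) f).
Proof.
move=> /andP[s0 st] f0 mf; rewrite /besq_op.
apply: (@ge0_emeasurable_sum _ _ _ setT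
  (fun k w => (poisson_weight (Z s w / (2 * (t - s))) k)%:E *
    \int[mu]_(y in `]0%R, +oo[) (f y * (gamma_density (del / 2 + k%:R) (2 * (t - s)) y)%:E))%E
  xpredT).
  move=> k w _ _; rewrite mule_ge0//.
    rewrite lee_fin poisson_weight_ge0// divr_ge0 ?Z_ge0// mulr_ge0// subr_ge0 ltW//.
  apply: integral_ge0 => y _; rewrite mule_ge0// lee_fin gamma_density_ge0//.
  exact: half_natr_gt0.
move=> k _; apply: emeasurable_funM => //; apply/measurable_EFinP.
apply: measurable_funM.
  do 2 (apply: measurableT_comp => //); apply: measurable_funM => //; exact: mZ.
apply: measurable_funM => //; apply: measurable_funX; apply: measurable_funM => //; exact: mZ.
Qed.

Section markov.
Variables (s t : R).
Hypothesis st : 0 <= s < t.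

Let s0 : 0 <= s. Proof. by case/andP: st. Qed.
Let t0 : 0 <= t. Proof. by case/andP: st => ? /ltW; exact: le_trans. Qed.
Let ts0 : 0 < t - s. Proof. by case/andP: st => _; rewrite subr_gt0. Qed.

Let w k x : R := poisson_weight (Z s x / (2 * (t - s))) k.
Let g k (y : R) : R := gamma_density (del / 2 + k%:R) (2 * (t - s)) y.

Let w_ge0 k x : 0 <= w k x.
Proof. by rewrite poisson_weight_ge0// divr_ge0 ?Z_ge0// mulr_ge0// ltW. Qed.

Let g_ge0 k y : 0 <= g k y.
Proof. by rewrite gamma_density_ge0// half_natr_gt0. Qed.

Let mw k D : measurable_fun D (w k).
Proof.
apply: measurable_funTS; apply: measurable_funM.
  do 2 (apply: measurableT_comp => //); apply: measurable_funM => //; exact: mZ.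
apply: measurable_funM => //; apply: measurable_funX; apply: measurable_funM => //; exact: mZ.
Qed.

Let mg k D : measurable_fun D (g k). Proof. exact: measurable_gamma_density. Qed.

Let wA (A : set T) k := (\int[P]_(x in A) (w k x)%:E)%E.

Let wA_ge0 A k : (0 <= wA A k)%E.
Proof. by apply: integral_ge0 => x _; rewrite lee_fin. Qed.

(** For [A] in the past of [s], this is the Lebesgue density of the law of [Z t] restricted to [A]:
    the Poisson weights at [Z s] are averaged over [A] first. *)
Let h (A : set T) (y : R) : \bar R :=
  ((fun y => \sum_(k <oo) (wA A k * (g k y)%:E))%E \_ `]0, +oo[) y.

Let h_ge0 A y : (0 <= h A y)%E.
Proof.
rewrite /h patchE; case: ifPn => // _; apply: nneseries_ge0 => k _ _.
by rewrite mule_ge0// lee_fin.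
Qed.

Let measurable_h A : measurable_fun setT (h A).
Proof.
apply/(measurable_restrictT (fun y => \sum_(k <oo) (wA A k * (g k y)%:E))%E) => //.
apply: (@ge0_emeasurable_sum _ (measurableTypeR R) R `]0, +oo[
  (fun k y => wA A k * (g k y)%:E)%E xpredT).
  by move=> k y _ _; rewrite mule_ge0// lee_fin.
by move=> k _; apply: measurable_funeM; apply/measurable_EFinP; exact: mg.
Qed.

Let besq_op_wA A (f : R -> \bar R) : measurable A -> (forall y, 0 <= f y)%E ->
  measurable_fun setT f ->
  (\int[P]_(x in A) besq_op del (t - s) (Z s x) f = \int[mu]_y (f y * h A y))%E.
Proof.
move=> mA f0 mf; pose J k := (\int[mu]_(y in `]0%R, +oo[) (f y * (g k y)%:E))%E.
have J0 k : (0 <= J k)%E.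
  by apply: integral_ge0 => y _; rewrite mule_ge0// lee_fin.
have mfg k : measurable_fun (`]0, +oo[ : set R) (fun y => f y * (g k y)%:E)%E.
  apply: emeasurable_funM; first exact: measurable_funTS.
  by apply/measurable_EFinP; exact: mg.
transitivity (\sum_(k <oo) (wA A k * J k))%E.
  rewrite /besq_op integral_nneseries//; last 2 first.
  - move=> k; apply: emeasurable_funM => //; apply/measurable_EFinP; exact: mw.
  - by move=> k x _; apply: mule_ge0; [rewrite lee_fin; exact: w_ge0|exact: J0].
  apply: eq_eseriesr => k _; rewrite ge0_integralZr//; last 3 first.
  - by apply/measurable_EFinP; exact: mw.
  - by move=> x _; rewrite lee_fin; exact: w_ge0.
  - exact: J0.
transitivity (\int[mu]_(y in `]0%R, +oo[) (\sum_(k <oo) (wA A k * (f y * (g k y)%:E))))%E.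
  rewrite integral_nneseries//; last 2 first.
  - by move=> k; apply: emeasurable_funM => //; exact: mfg.
  - by move=> k y _; rewrite !mule_ge0// lee_fin.
  apply: eq_eseriesr => k _; rewrite ge0_integralZl//.
  - exact: mfg.
  - by move=> y _; rewrite mule_ge0// lee_fin g_ge0.
rewrite integral_mkcond; apply: eq_integral => y _.
rewrite /h !patchE; case: ifPn => _; last by rewrite mule0.
rewrite muleC -nneseriesMr//; last by move=> k; rewrite mule_ge0// lee_fin.
by apply: eq_eseriesr => k _; rewrite muleA muleAC -muleA.
Qed.

(** Both sides are integrals of [f] against [h A]: the right one by exchanging sums and integrals,
    the left one because the Markov property identifies the two measures on Borel sets. *)
Lemma markov_event A (f : R -> \bar R) : natural_filtration Z s A ->
  (forall y, 0 <= f y)%E -> measurable_fun setT f ->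
  (\int[P]_(x in A) f (Z t x) = \int[P]_(x in A) besq_op del (t - s) (Z s x) f)%E.
Proof.
move=> FA f0 mf; have mA := past_measurable FA.
have mI (F : T -> \bar R) : (\int[P]_(x in A) F x = \int[P]_x (F x * (\1_A x)%:E))%E.
  by rewrite integral_mkcond epatch_indic.
rewrite besq_op_wA// mI.
have mu1 : measurable_fun [set: T] (fun x => (\1_A x : R)%:E).
  by apply/measurable_EFinP; exact: measurable_indic.
have mZt := mZ t0.
apply: (@integral_transfer _ _ _ T (measurableTypeR R) R R P mu (Z t) id) => //.
- exact: measurable_h.
move=> B mB; rewrite -mI -besq_op_wA//; last first.
- by apply/measurable_EFinP; exact: measurable_indic.
have mZB : measurable (Z t @^-1` B) by rewrite -[_ @^-1` _]setTI; exact: mZ.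
transitivity (P (A `&` Z t @^-1` B)).
  rewrite setIC -(integral_indic P)//.
case: HZ => _ _ _ _ /(_ _ _ A B st FA mB) ->.
by apply: eq_integral => x _; rewrite besq_transitionE ?Z_ge0.
Qed.

(** Passes from past events to weights [Q]: the common target space is [T] with the sigma-algebra
    [past s], and both maps into it are the identity. *)
Lemma markov_past (Q : T -> \bar R) (f : R -> \bar R) :
  measurable_fun [set: past s] (Q : past s -> \bar R) -> (forall x, 0 <= Q x)%E ->
  measurable_fun setT f -> (forall y, 0 <= f y)%E ->
  (\int[P]_x (Q x * f (Z t x)) = \int[P]_x (Q x * besq_op del (t - s) (Z s x) f))%E.
Proof.
move=> mQ Q0 mf f0.
have id_meas : measurable_fun [set: T] (id : T -> past s).
  by move=> _ Y mY; rewrite setTI; exact: (@past_measurable s).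
apply: (@integral_transfer _ _ _ T T (past s) R P P id id _ _ Q) => //.
- exact: (measurableT_comp mf (mZ t0)).
- exact: measurable_besq_op.
- move=> x; rewrite /besq_op; apply: nneseries_ge0 => k _ _.
  rewrite mule_ge0 ?lee_fin ?w_ge0//; apply: integral_ge0 => y _.
  by rewrite mule_ge0// lee_fin g_ge0.
move=> B mB.
have mI (F : T -> \bar R) : (\int[P]_x ((\1_B x)%:E * F x) = \int[P]_(x in B) F x)%E.
  by rewrite [RHS]integral_mkcond epatch_indic; apply: eq_integral => x _; rewrite muleC.
by rewrite !mI; exact: markov_event.
Qed.

End markov.

End transition.

Lemma cvg_succ (R : realType) (u : R ^nat) (l : R) :
  u @ \oo --> l -> (fun n => u n.+1) @ \oo --> l.
Proof. by rewrite -cvg_shiftS. Qed.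

(** * Kummer's confluent series and its contiguity relation *)

Section confluent.
Variable R : realType.
Implicit Types a m x : R.

(** The resulting sum is [Gamma (a + m) / Gamma a] times Kummer's function [1F1 (a + m; a; x)]. The
    quotient of Gamma values is the moment of order [m] of the Gamma law of shape [a + k] and scale
    [1]. *)
Definition confluent_coef a m (k : nat) : R := Gamma (a + m + k%:R) / Gamma (a + k%:R) / k`!%:R.

Definition confluent a m x : R := limn (pseries (confluent_coef a m) x).

Lemma addr_natr_gt0 a (k : nat) : 0 < a -> 0 < a + k%:R.
Proof. by move=> a0; have := ler0n R k; lra. Qed.

Lemma confluent_coef_ge0 a m k : 0 < a -> 0 < a + m -> 0 <= confluent_coef a m k.
Proof.
by move=> a0 am0; rewrite !divr_ge0// ltW// Gamma_gt0// addr_natr_gt0.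
Qed.

(** Once the factorial is removed, the ratio of consecutive coefficients is [1 + m / (a + k)], at
    most [1 + |m| / a] whatever the sign of [m]. The series is thus dominated by an exponential
    one. *)
Lemma confluent_coef_bound a m k : 0 < a -> 0 < a + m ->
  confluent_coef a m k * k`!%:R <= Gamma (a + m) / Gamma a * (1 + `|m| / a) ^+ k.
Proof.
move=> a0 am0; elim: k => [|k ih].
  by rewrite /confluent_coef !addr0 expr0 fact0 divr1 !mulr1.
have fk j : j`!%:R != 0 :> R by rewrite pnatr_eq0 -lt0n fact_gt0.
have ak := addr_natr_gt0 k a0; have amk := addr_natr_gt0 k am0.
have G1 := Gamma_gt0 ak; have G2 := Gamma_gt0 amk.
have -> : confluent_coef a m k.+1 * k.+1`!%:R =
    (confluent_coef a m k * k`!%:R) * (1 + m / (a + k%:R)).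
  rewrite /confluent_coef -natr1 !addrA !GammaS//.
  rewrite !divfK//; move: (Gamma _) (Gamma _) G1 G2 => A B A0 B0.
  by field; rewrite !gt_eqF.
rewrite exprSr mulrA; apply: ler_pM => //.
- by rewrite mulr_ge0 ?confluent_coef_ge0.
- rewrite -(@pmulr_rge0 _ (a + k%:R))//.
  suff -> : (a + k%:R) * (1 + m / (a + k%:R)) = a + m + k%:R by exact: ltW.
  by field; rewrite gt_eqF.
rewrite lerD2l (le_trans (ler_norm _))// normrM normfV (gtr0_norm ak).
by rewrite ler_wpM2l// lef_pV2 ?posrE// lerDl.
Qed.

Lemma is_cvg_confluent a m x : 0 < a -> 0 < a + m -> cvgn (pseries (confluent_coef a m) x).
Proof.
move=> a0 am0; apply: normed_cvg.
apply: (@is_cvg_series_le_exp _ _ (Gamma (a + m) / Gamma a) ((1 + `|m| / a) * `|x|)) => k.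
rewrite normr_ge0/= normrM ger0_norm ?confluent_coef_ge0// normrX /exp_coeff/=.
have k0 : 0 < k`!%:R :> R by rewrite ltr0n fact_gt0.
have := confluent_coef_bound k a0 am0; rewrite -ler_pdivlMr// => h.
rewrite exprMn [_ ^+ k * _ / _]mulrAC mulrA [_ * (_ / _)]mulrA.
by rewrite ler_wpM2r// exprn_ge0.
Qed.

Lemma pseries_diffs_confluent a m : pseries_diffs (confluent_coef a m) = confluent_coef (a + 1) m.
Proof.
apply/funext => k; rewrite /pseries_diffs /confluent_coef factS natrM.
have -> : a + 1 + m + k%:R = a + m + k.+1%:R by rewrite -natr1; ring.
have -> : a + 1 + k%:R = a + k.+1%:R by rewrite -natr1; ring.
by rewrite invfM mulrCA mulVKf// pnatr_eq0.
Qed.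

Lemma is_derive_confluent a m x : 0 < a -> 0 < a + m ->
  is_derive x (1 : R) (confluent a m) (confluent (a + 1) m x).
Proof.
move=> a0 am0; rewrite /confluent -pseries_diffs_confluent.
have x1 : `|x| < Num.norm (Num.norm x + 1).
  by rewrite [ltRHS]ger0_norm ?addr_ge0// ltrDl.
apply: pseries_snd_diffs x1; rewrite ?pseries_diffs_confluent;
  by apply: is_cvg_confluent; lra.
Qed.

Lemma confluent_coef_contiguous0 a m : 0 < a + m - 1 ->
  m * confluent_coef a m 0 = m * (m + a - 1) * confluent_coef a (m - 1) 0.
Proof.
move=> am0.
have -> : confluent_coef a m 0 = (a + m - 1) * confluent_coef a (m - 1) 0; last by ring.
rewrite /confluent_coef (addr0 a) (addr0 (a + m)) (addr0 (a + (m - 1))) mulrA mulrA.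
by have := GammaS am0; rewrite subrK addrA => ->.
Qed.

Lemma confluent_coef_contiguousS a m n : 0 < a -> 0 < a + m ->
  confluent_coef a m n + m * confluent_coef a m n.+1 - n.+1%:R * confluent_coef a m n.+1 =
  m * (m + a - 1) * confluent_coef a (m - 1) n.+1.
Proof.
move=> a0 am0; have fn : n`!%:R != 0 :> R by rewrite pnatr_eq0 -lt0n fact_gt0.
have an := addr_natr_gt0 n a0; have Gn := Gamma_gt0 an.
have amn := addr_natr_gt0 n am0.
have n1 : n%:R + 1 != 0 :> R by rewrite natr1 pnatr_eq0.
rewrite /confluent_coef factS natrM.
have -> : a + (m - 1) + n.+1%:R = a + m + n%:R by rewrite -natr1; ring.
rewrite -natr1 !addrA !GammaS//.
move: (Gamma (a + m + n%:R)) (Gamma (a + n%:R)) (n`!%:R) Gn fn => A B F B0 F0.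
by field; rewrite F0 n1 !gt_eqF.
Qed.

(** With the ranges [n], [n.+1] and [n.+1] every sum on the left, once multiplied by its factor, has
    degree at most [n] in [x]. The coefficient relations therefore give an exact identity, with no
    remainder to estimate. *)
Lemma contiguous_partial_sums (c e : R ^nat) m K x n :
  m * c 0 = K * e 0 ->
  (forall k, c k + m * c k.+1 - k.+1%:R * c k.+1 = K * e k.+1) ->
  x * (\sum_(0 <= k < n) c k * x ^+ k) + m * (\sum_(0 <= k < n.+1) c k * x ^+ k) -
  x * (\sum_(0 <= k < n.+1) k%:R * c k * x ^+ k.-1) =
  K * (\sum_(0 <= k < n.+1) e k * x ^+ k).
Proof.
move=> E0 ES; elim: n => [|n ih].
  by rewrite big_geq// !big_nat1 expr0 !mulr1 !mul0r !mulr0 add0r subr0.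
rewrite [in RHS]big_nat_recr//= mulrDr -ih mulrA -ES.
rewrite [in LHS]big_nat_recr//= [in X in m * X]big_nat_recr//=.
rewrite [in X in _ - x * X]big_nat_recr//=.
move: (\sum_(0 <= k < n) _) (\sum_(0 <= k < n.+1) _) (\sum_(0 <= k < n.+1) _) => A B C.
by rewrite exprS; ring.
Qed.

(* Kummer's contiguity relation between the derivative and the index shift. *)
Lemma confluent_contiguous a m x : 0 < a -> 0 < a + m - 1 ->
  x * confluent a m x + m * confluent a m x - x * confluent (a + 1) m x =
  m * (m + a - 1) * confluent a (m - 1) x.
Proof.
move=> a0 am0; set c := confluent_coef a m.
have cc : pseries c x @ \oo --> confluent a m x by apply: is_cvg_confluent; lra.
have cd : series (fun i => i%:R * c i * x ^+ i.-1) @ \oo --> confluent (a + 1) m x.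
  rewrite /confluent -pseries_diffs_confluent; apply: pseries_diffs_equiv.
  by rewrite pseries_diffs_confluent; apply: is_cvg_confluent; lra.
have ce : pseries (confluent_coef a (m - 1)) x @ \oo --> confluent a (m - 1) x.
  by apply: is_cvg_confluent; lra.
pose d i := i%:R * c i * x ^+ i.-1.
pose lhs n := x * pseries c x n + m * pseries c x n.+1 - x * series d n.+1.
have cl : lhs @ \oo --> x * confluent a m x + m * confluent a m x - x * confluent (a + 1) m x.
  apply: cvgB; first apply: cvgD.
  - exact: (cvgMl_tmp (a := x) cc).
  - exact: (cvgMl_tmp (a := m) (cvg_succ cc)).
  - exact: (cvgMl_tmp (a := x) (cvg_succ cd)).
have cr : (fun n => m * (m + a - 1) * pseries (confluent_coef a (m - 1)) x n.+1) @ \oo -->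
    m * (m + a - 1) * confluent a (m - 1) x.
  exact: (cvgMl_tmp (a := m * (m + a - 1)) (cvg_succ ce)).
suff E : lhs = (fun n => m * (m + a - 1) * pseries (confluent_coef a (m - 1)) x n.+1).
  by rewrite E in cl; exact: (cvg_unique _ cl cr).
apply/funext => n; apply: contiguous_partial_sums.
  exact: confluent_coef_contiguous0.
by move=> k; apply: confluent_coef_contiguousS => //; lra.
Qed.

Lemma integral_gamma_density a m t b : 0 < a -> 0 < a + m -> 0 < t -> 0 <= b ->
  (\int[@lebesgue_measure R]_(y in `]0%R, +oo[)
     ((y `^ m * expR (- (b * y)))%:E * (gamma_density a t y)%:E) =
   (Gamma (a + m) / Gamma a * t `^ m * (1 + b * t) `^ (- (a + m)))%:E)%E.
Proof.
move=> a0 am0 t0 b0.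
have c0 : 0 < b + t^-1 by rewrite ltr_wpDl// invr_gt0.
have bt : 0 < 1 + b * t by rewrite ltr_pwDl// mulr_ge0// ltW.
transitivity (\int[@lebesgue_measure R]_(y in `]0%R, +oo[)
    (t `^ (- a) / Gamma a * (y `^ (a + m - 1) * expR (- ((b + t^-1) * y))))%:E)%E.
  apply: eq_integral => y; rewrite inE/= in_itv/= andbT => y0.
  rewrite -EFinM /gamma_density; congr _%:E.
  have -> : a + m - 1 = m + (a - 1) by ring.
  rewrite [y `^ (m + _)]powRD ?(gt_eqF y0) ?implybT// mulrDl opprD expRD.
  by ring.
have Ga := Gamma_gt0 a0.
rewrite ge0_integralZl_real//; last 3 first.
- exact: measurable_powR_expR.
- by move=> y _; exact: powR_expR_ge0.
- by rewrite divr_ge0 ?powR_ge0// ltW.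
rewrite -/(gamma_integral (a + m) (b + t^-1)) gamma_integralE// -EFinM; congr _%:E.
have -> : b + t^-1 = (1 + b * t) * t^-1 by field; rewrite gt_eqF.
rewrite powRM ?invr_ge0 ?(ltW bt) ?(ltW t0)//.
have -> : t^-1 `^ (- (a + m)) = t `^ a * t `^ m.
  rewrite -(powR_inv1 (ltW t0)) -powRrM mulN1r opprK powRD// (gt_eqF t0) implybT//.
have ta : 0 < t `^ a by rewrite powR_gt0.
rewrite [t `^ (- a)]powRN; field; rewrite ?gt_eqF//.
Qed.

(** The [k]-th component contributes [(1 + 2 b t) ^ (- k)], which joins the Poisson parameter
    [z / (2 t)] in the argument of the series. *)
Lemma besq_op_powR_expR del t z m b : 0 < del -> 0 < del / 2 + m -> 0 < t -> 0 <= z -> 0 <= b ->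
  besq_op del t z (fun y => (y `^ m * expR (- (b * y)))%:E) =
  (expR (- (z / (2 * t))) * (2 * t) `^ m * (1 + b * (2 * t)) `^ (- (del / 2 + m)) *
   confluent (del / 2) m (z / (2 * t * (1 + b * (2 * t)))))%:E.
Proof.
move=> del0 dm0 t0 z0 b0; have a0 : 0 < del / 2 by rewrite divr_gt0.
have t2 : 0 < 2 * t by rewrite mulr_gt0.
rewrite /besq_op; move: (del / 2) (2 * t) t2 a0 dm0 => a p p0 a0 am0.
have bp : 0 < 1 + b * p by rewrite ltr_pwDl// mulr_ge0// ltW.
set x := z / (p * _).
pose C := expR (- (z / p)) * p `^ m * (1 + b * p) `^ (- (a + m)).
have cc : series (fun k => C * (confluent_coef a m k * x ^+ k)) @ \oo --> C * confluent a m x.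
  have -> : series (fun k => C * (confluent_coef a m k * x ^+ k)) =
      (fun n => C * pseries (confluent_coef a m) x n).
    by apply/funext => n; rewrite /series/= /pseries /series/= big_distrr.
  by apply: cvgMl_tmp; exact: is_cvg_confluent.
rewrite -(nneseries_EFin cc); apply: eq_eseriesr => k _.
have ak := addr_natr_gt0 k a0; have amk := addr_natr_gt0 k am0.
rewrite integral_gamma_density//; last by rewrite addrAC.
rewrite -EFinM; congr _%:E; rewrite /C /confluent_coef /poisson_weight [a + k%:R + m]addrAC.
have -> : (1 + b * p) `^ (- (a + m + k%:R)) = (1 + b * p) `^ (- (a + m)) / (1 + b * p) ^+ k.
  by rewrite opprD powRD ?(gt_eqF bp) ?implybT// powR_invn// ltW.
have -> : x ^+ k = (z / p) ^+ k / (1 + b * p) ^+ k by rewrite /x invfM mulrA expr_div_n.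
by ring.
Qed.

End confluent.

(** * Harmonic exponentials and their Dynkin formula *)

Section harmonic.
Variable R : realType.
Variables (del n v : R).
Hypotheses (del0 : 0 < del) (n0 : 0 < n) (n1 : 0 < n + del / 2 - 1) (v0 : 0 <= v).
Implicit Types t s z tau y : R.

Local Notation mu := (@lebesgue_measure R).
Local Notation a := (del / 2).

(* Doob transform of exponentials: [y ^ n] is harmonic for the process killed at
   rate [2 n (n + del / 2 - 1) / y]. *)
Definition hexp tau y : R :=
  (1 + 2 * v * tau) `^ (- (a + 2 * n)) * (y `^ n * expR (- (v / (1 + 2 * v * tau) * y))).

(** For [y > 0] this is [k / y] times [hexp tau y], with [k = 2 n (n + del / 2 - 1)]; it is also the
    generator applied to [hexp] minus the derivative of [hexp] in [tau]. Written with [y ^ (n - 1)]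
    it remains a power times an exponential. *)
Definition hexp_rate tau y : R :=
  2 * n * (n + a - 1) * ((1 + 2 * v * tau) `^ (- (a + 2 * n)) *
    (y `^ (n - 1) * expR (- (v / (1 + 2 * v * tau) * y)))).

Lemma hexp_ge0 tau y : 0 <= hexp tau y.
Proof. by rewrite mulr_ge0 ?powR_ge0// powR_expR_ge0. Qed.

Lemma hexp_rate_coef_ge0 : 0 <= 2 * n * (n + a - 1).
Proof. by have n0' := ltW n0; have n1' := ltW n1; rewrite !mulr_ge0. Qed.

Lemma hexp_rate_ge0 tau y : 0 <= hexp_rate tau y.
Proof. by rewrite mulr_ge0 ?hexp_rate_coef_ge0// mulr_ge0 ?powR_ge0// powR_expR_ge0. Qed.

Lemma measurable_hexp tau D : measurable_fun D (hexp tau).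
Proof. by apply: measurable_funM => //; exact: measurable_powR_expR. Qed.

Lemma measurable_hexp_rate tau D : measurable_fun D (hexp_rate tau).
Proof. by do 2 apply: measurable_funM => //; exact: measurable_powR_expR. Qed.

Lemma besq_opZl t z k (f : R -> R) : 0 < t -> 0 <= z -> 0 <= k ->
  measurable_fun setT f -> (forall y, 0 <= f y) ->
  besq_op del t z (fun y => (k * f y)%:E) = (k%:E * besq_op del t z (EFin \o f))%E.
Proof.
move=> t0 z0 k0 mf f0; rewrite /besq_op.
have g0 j y : 0 <= gamma_density (a + j%:R) (2 * t) y.
  by rewrite gamma_density_ge0// half_natr_gt0.
have w0 j : 0 <= poisson_weight (z / (2 * t)) j.
  by rewrite poisson_weight_ge0// divr_ge0// mulr_ge0// ltW.
rewrite -nneseriesZl; last first.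
  move=> j _; rewrite mule_ge0 ?lee_fin//; apply: integral_ge0 => y _.
  by rewrite -EFinM lee_fin mulr_ge0.
apply: eq_eseriesr => j _; rewrite muleCA; congr (_ * _)%E.
rewrite -ge0_integralZl//; last 2 first.
- apply/measurable_EFinP; apply: measurable_funM; first exact: measurable_funTS.
  exact: measurable_gamma_density.
- by move=> y _; rewrite -EFinM lee_fin mulr_ge0.
by apply: eq_integral => y _; rewrite /= EFinM muleA.
Qed.

(** The expectation of [hexp (tau - s)] at time [s] for the process started at [z], in a closed form
    that can be differentiated in [s]; [hexp_rate_flow] plays the same part for [hexp_rate]. *)
Definition hexp_flow tau z s : R :=
  (1 + 2 * v * tau) `^ (- (a + n)) * (expR (- (z / (2 * s))) *
   ((2 * s) `^ n * (1 + 2 * v * (tau - s)) `^ (- n)) *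
   confluent a n (z / (2 * s) - z * v / (1 + 2 * v * tau))).

Definition hexp_rate_flow tau z s : R :=
  2 * n * (n + a - 1) * (1 + 2 * v * tau) `^ (- (a + n - 1)) * (expR (- (z / (2 * s))) *
   ((2 * s) `^ (n - 1) * (1 + 2 * v * (tau - s)) `^ (- n - 1)) *
   confluent a (n - 1) (z / (2 * s) - z * v / (1 + 2 * v * tau))).

(** The semigroup adds [2 v s] to [1 + 2 v (tau - s)], and the sum [1 + 2 v tau] no longer depends
    on [s]. The exponent [m] is [n] for [hexp] and [n - 1] for its rate. *)
Lemma besq_op_hexp_aux m tau z s : 0 < a + m -> 0 < s <= tau -> 0 <= z ->
  (((1 + 2 * v * (tau - s)) `^ (- (a + 2 * n)))%:E *
    besq_op del s z (fun y => (y `^ m * expR (- (v / (1 + 2 * v * (tau - s)) * y)))%:E))%E =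
  ((1 + 2 * v * tau) `^ (- (a + m)) * (expR (- (z / (2 * s))) *
   ((2 * s) `^ m * (1 + 2 * v * (tau - s)) `^ (m - 2 * n)) *
   confluent a m (z / (2 * s) - z * v / (1 + 2 * v * tau))))%:E :> \bar R.
Proof.
move=> am0 /andP[s0 st] z0.
have g1 : 0 < 1 + 2 * v * (tau - s) by rewrite ltr_pwDl// !mulr_ge0// subr_ge0.
have c1 : 0 < 1 + 2 * v * tau by rewrite ltr_pwDl// !mulr_ge0// (le_trans (ltW s0)).
rewrite besq_op_powR_expR//; last by rewrite divr_ge0// ltW.
have -> : 1 + v / (1 + 2 * v * (tau - s)) * (2 * s) =
    (1 + 2 * v * tau) / (1 + 2 * v * (tau - s)) by field; rewrite gt_eqF.
have -> : z / (2 * s * ((1 + 2 * v * tau) / (1 + 2 * v * (tau - s)))) =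
    z / (2 * s) - z * v / (1 + 2 * v * tau).
  by field; rewrite !gt_eqF.
move: (1 + 2 * v * tau) (1 + 2 * v * (tau - s)) c1 g1 => c g c0 g0.
rewrite -EFinM; congr _%:E.
have -> : (c / g) `^ (- (a + m)) = c `^ (- (a + m)) * g `^ (a + m).
  rewrite powRM ?invr_ge0 ?ltW//; congr (_ * _).
  by rewrite -(powR_inv1 (ltW g0)) -powRrM mulN1r opprK.
have -> : g `^ (m - 2 * n) = g `^ (- (a + 2 * n)) * g `^ (a + m).
  by rewrite -powRD ?(gt_eqF g0) ?implybT//; congr (_ `^ _); ring.
ring.
Qed.

Lemma besq_op_hexp tau z s : 0 < s <= tau -> 0 <= z ->
  besq_op del s z (EFin \o hexp (tau - s)) = (hexp_flow tau z s)%:E.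
Proof.
move=> st z0; have a0 : 0 < a by rewrite divr_gt0.
rewrite besq_opZl ?powR_ge0//; last 3 first.
- by case/andP: st.
- exact: measurable_powR_expR.
- by move=> y; exact: powR_expR_ge0.
rewrite besq_op_hexp_aux// ?addr_gt0//.
by rewrite (_ : n - 2 * n = - n)//; ring.
Qed.

Lemma besq_op_hexp_rate tau z s : 0 < s <= tau -> 0 <= z ->
  besq_op del s z (EFin \o hexp_rate (tau - s)) = (hexp_rate_flow tau z s)%:E.
Proof.
move=> st z0; have a0 : 0 < a by rewrite divr_gt0.
have s0 : 0 < s by case/andP: st.
rewrite besq_opZl//; last 3 first.
- exact: hexp_rate_coef_ge0.
- by apply: measurable_funM => //; exact: measurable_powR_expR.
- by move=> y; rewrite mulr_ge0 ?powR_ge0// powR_expR_ge0.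
rewrite besq_opZl ?powR_ge0//; last 2 first.
- exact: measurable_powR_expR.
- by move=> y; exact: powR_expR_ge0.
have am0 : 0 < a + (n - 1) by move: n1; rewrite addrA [n + a]addrC.
rewrite besq_op_hexp_aux// -EFinM; congr _%:E; rewrite /hexp_rate_flow.
rewrite (_ : n - 1 - 2 * n = - n - 1); last by ring.
by rewrite (_ : a + (n - 1) = a + n - 1) ?mulrA// addrA.
Qed.

Lemma is_derive_pow_affine (p q r s : R) : 0 < p + q * s ->
  is_derive s (1 : R) (fun s => (p + q * s) `^ r) (r * (p + q * s) `^ (r - 1) * q).
Proof.
move=> h; have d1 : is_derive s (1 : R) (fun s => p + q * s) q.
  by apply: is_derive_eq; rewrite /GRing.scale/=; ring.
exact: (@is_derive1_comp R (fun x => x `^ r) (fun s => p + q * s) s _ _ (is_derive1_powR r h) d1).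
Qed.

Lemma is_derive_inv2 z s : 0 < s ->
  is_derive s (1 : R) (fun s => z / (2 * s)) (- (z / (2 * s ^+ 2))).
Proof.
move=> s0; have s2 : 2 * s != 0 by rewrite gt_eqF// mulr_gt0.
have d1 : is_derive s (1 : R) (fun s => 2 * s) 2.
  by apply: is_derive_eq; rewrite /GRing.scale/=; ring.
have d2 := is_deriveV s2 d1.
apply: is_derive_eq; rewrite /GRing.scale/=.
by field; rewrite gt_eqF.
Qed.

Lemma powR_mulB1 (x r : R) : 0 < x -> x `^ r = x * x `^ (r - 1).
Proof.
move=> x0; have -> : x `^ r = x `^ (1 + (r - 1)) by congr (_ `^ _); ring.
by rewrite [x `^ (1 + _)]powRD ?(gt_eqF x0) ?implybT// powRr1// ltW.
Qed.

(** Common to both flows: [m = q = n], [r = - n] gives the derivative of [hexp_flow], and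
    [m = q = n - 1], [r = - n - 1] the regularity of [hexp_rate_flow]. One power of each base is
    factored out so that the bracket is polynomial in the bases. *)
Lemma is_derive_flow m tau z s (C r q : R) : 0 < a + m -> 0 < s <= tau ->
  is_derive s (1 : R) (fun s => C * (expR (- (z / (2 * s))) *
   ((2 * s) `^ q * (1 + 2 * v * (tau - s)) `^ r) *
   confluent a m (z / (2 * s) - z * v / (1 + 2 * v * tau))))
   (C * expR (- (z / (2 * s))) * (2 * s) `^ (q - 1) * (1 + 2 * v * (tau - s)) `^ (r - 1) *
    ((z / (2 * s ^+ 2) * (2 * s) * (1 + 2 * v * (tau - s)) +
      2 * q * (1 + 2 * v * (tau - s)) - 2 * v * r * (2 * s)) *
        confluent a m (z / (2 * s) - z * v / (1 + 2 * v * tau)) -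
     z / (2 * s ^+ 2) * (2 * s) * (1 + 2 * v * (tau - s)) *
        confluent (a + 1) m (z / (2 * s) - z * v / (1 + 2 * v * tau)))).
Proof.
move=> am0 /andP[s0 st]; have a0 : 0 < a by rewrite divr_gt0.
have g1 : 0 < 1 + 2 * v * (tau - s) by rewrite ltr_pwDl// !mulr_ge0// subr_ge0.
have s2 : 0 < 2 * s by rewrite mulr_gt0.
have dz := is_derive_inv2 z s0.
have de : is_derive s (1 : R) (fun s => expR (- (z / (2 * s))))
    (expR (- (z / (2 * s))) * (z / (2 * s ^+ 2))).
  have dN : is_derive s (1 : R) (fun s => - (z / (2 * s))) (z / (2 * s ^+ 2)).
    by apply: is_derive_eq; rewrite opprK.
  exact: (@is_derive1_comp R expR (fun s => - (z / (2 * s))) s _ _ (is_derive_expR _) dN).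
have dp : is_derive s (1 : R) (fun s => (2 * s) `^ q) (q * (2 * s) `^ (q - 1) * 2).
  have h : 0 < 0 + 2 * s by rewrite add0r.
  have := is_derive_pow_affine q h; rewrite add0r.
  by under eq_fun do rewrite add0r.
have dg : is_derive s (1 : R) (fun s => (1 + 2 * v * (tau - s)) `^ r)
    (r * (1 + 2 * v * (tau - s)) `^ (r - 1) * - (2 * v)).
  have gE t : 1 + 2 * v * (tau - t) = (1 + 2 * v * tau) + - (2 * v) * t by ring.
  under eq_fun do rewrite gE.
  by rewrite gE; apply: is_derive_pow_affine; rewrite -gE.
have dS : is_derive s (1 : R) (fun s => confluent a m (z / (2 * s) - z * v / (1 + 2 * v * tau)))
    (confluent (a + 1) m (z / (2 * s) - z * v / (1 + 2 * v * tau)) * - (z / (2 * s ^+ 2))).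
  have dw : is_derive s (1 : R) (fun s => z / (2 * s) - z * v / (1 + 2 * v * tau))
      (- (z / (2 * s ^+ 2))).
    by apply: is_derive_eq; rewrite subr0.
  exact: (@is_derive1_comp R (confluent a m) (fun s => z / (2 * s) - z * v / (1 + 2 * v * tau))
    s _ _ (is_derive_confluent _ a0 am0) dw).
apply: is_derive_eq; rewrite /GRing.scale/=.
rewrite [(2 * s) `^ q](powR_mulB1 _ s2) [(1 + 2 * v * (tau - s)) `^ r](powR_mulB1 _ g1).
move: (confluent a m _) (confluent (a + 1) m _) (expR _) (_ `^ (q - 1)) (_ `^ (r - 1)).
move: (z / (2 * s ^+ 2)) (1 + 2 * v * (tau - s)) => D g S S' E P G.
by ring.
Qed.

(** With [x = z / (2 s) - z v / (1 + 2 v tau)], the bracket of [is_derive_flow] is [2 (1 + 2 v tau)]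
    times the left side of [confluent_contiguous] for [m = n]; the right side carries the index
    [n - 1] of the rate. *)
Lemma is_derive_hexp_flow tau z s : 0 < s <= tau ->
  is_derive s (1 : R) (hexp_flow tau z) (hexp_rate_flow tau z s).
Proof.
move=> st; have /andP[s0 stau] := st; have a0 : 0 < a by rewrite divr_gt0.
have c1 : 0 < 1 + 2 * v * tau by rewrite ltr_pwDl// !mulr_ge0// (le_trans (ltW s0)).
have := @is_derive_flow n tau z s ((1 + 2 * v * tau) `^ (- (a + n))) (- n) n (addr_gt0 a0 n0) st.
move=> h; apply: (is_derive_eq h); rewrite /hexp_rate_flow.
have an1 : 0 < a + n - 1 by move: n1; rewrite [n + a]addrC.
have := confluent_contiguous (z / (2 * s) - z * v / (1 + 2 * v * tau)) a0 an1.
have -> : 2 * n * (n + a - 1) * (1 + 2 * v * tau) `^ (- (a + n - 1)) =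
    2 * (1 + 2 * v * tau) * (1 + 2 * v * tau) `^ (- (a + n)) * (n * (n + a - 1)).
  have -> : (1 + 2 * v * tau) `^ (- (a + n - 1)) =
      (1 + 2 * v * tau) * (1 + 2 * v * tau) `^ (- (a + n)).
    by rewrite (powR_mulB1 _ c1); congr (_ * _ `^ _); ring.
  by ring.
set E := expR _; set P := _ `^ (n - 1); set G := _ `^ (- n - 1); set C := _ `^ (- (a + n)).
set S := confluent a n _; set S' := confluent (a + 1) n _; set S'' := confluent a (n - 1) _.
move=> K.
transitivity (2 * (1 + 2 * v * tau) * C * (E * (P * G)) * (n * (n + a - 1) * S'')); last by ring.
rewrite -K {K}; move: E P G C S S' S'' => E P G C S S' _.
by field; rewrite !gt_eqF.
Qed.

(** The lower limit stays at [r + eps] because the flow contains [z / (2 s)], singular at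
    [s = 0]. *)
Lemma hexp_flow_FTC (H r z eps : R) : 0 < eps < H - r ->
  (\int[mu]_(s in `[(r + eps)%R, H]) (hexp_rate_flow (H - r) z (s - r))%:E =
   (hexp_flow (H - r) z (H - r))%:E - (hexp_flow (H - r) z eps)%:E)%E.
Proof.
set tau := H - r; move=> /andP[e0 et]; have a0 : 0 < a by rewrite divr_gt0.
have an1 : 0 < a + (n - 1) by move: n1; rewrite addrA [n + a]addrC.
have bnd s : r + eps <= s <= H -> 0 < s - r <= tau.
  move=> /andP[es sH]; rewrite /tau lerB// andbT subr_gt0.
  by rewrite (lt_le_trans _ es)// ltrDl.
have dr s : is_derive s (1 : R) (fun s => s - r) 1.
  by apply: is_derive_eq; rewrite subr0.
have D s : r + eps <= s <= H ->
    is_derive s (1 : R) (fun s => hexp_flow tau z (s - r)) (hexp_rate_flow tau z (s - r)).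
  move=> /bnd sb; have h := @is_derive1_comp R (hexp_flow tau z) (fun s => s - r) s _ _
    (is_derive_hexp_flow z sb) (dr s).
  by apply: (is_derive_eq h); rewrite mulr1.
have C s : r + eps <= s <= H -> derivable (fun s => hexp_rate_flow tau z (s - r)) s 1.
  move=> /bnd sb.
  have h := @is_derive_flow (n - 1) tau z (s - r)
    (2 * n * (n + a - 1) * (1 + 2 * v * tau) `^ (- (a + n - 1))) (- n - 1) (n - 1) an1 sb.
  have h' := @is_derive1_comp R (hexp_rate_flow tau z) (fun s => s - r) s _ _ h (dr s).
  exact: (@ex_derive _ _ _ _ _ _ _ h').
have Dc s : r + eps <= s <= H ->
    hexp_flow tau z (x - r) @[x --> s] --> hexp_flow tau z (s - r).
  move=> /D h; apply: (@derivable1_cvg R (fun s => hexp_flow tau z (s - r))).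
  exact: (@ex_derive _ _ _ _ _ _ _ h).
have reH : r + eps < H by rewrite -ltrBrDl.
rewrite (continuous_FTC2 reH (F := fun s => hexp_flow tau z (s - r))); first by rewrite addrAC subrr add0r.
- by apply: derivable_within_continuous => s; rewrite in_itv/=; exact: C.
- split.
  + move=> s; rewrite in_itv/= => /andP[es st].
    by have h := D s (introT andP (conj (ltW es) (ltW st))); exact: (@ex_derive _ _ _ _ _ _ _ h).
  + by apply: cvg_at_right_filter; apply: Dc; rewrite lexx ltW.
  + by apply: cvg_at_left_filter; apply: Dc; rewrite lexx ltW.
- move=> s; rewrite in_itv/= => /andP[es st]; rewrite derive1E.
  by have h := D s (introT andP (conj (ltW es) (ltW st))); exact: (@derive_val _ _ _ _ _ _ _ h).
Qed.

Lemma besq_op_dynkin (H r z eps : R) : 0 < eps < H - r -> 0 <= z ->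
  (besq_op del (H - r)%R z (EFin \o hexp 0) = besq_op del eps z (EFin \o hexp (H - r - eps)%R) +
   \int[mu]_(s in `[(r + eps)%R, H]) (hexp_rate_flow (H - r) z (s - r))%:E)%E.
Proof.
move=> et z0; have /andP[e0 et'] := et.
have et1 : 0 < eps <= H - r by rewrite e0 ltW.
have tt : 0 < H - r <= H - r by rewrite lexx (lt_trans e0).
rewrite hexp_flow_FTC// (besq_op_hexp et1 z0).
have := besq_op_hexp tt z0; rewrite subrr => ->.
by rewrite -EFinB -EFinD; congr _%:E; rewrite [RHS]addrC subrK.
Qed.

End harmonic.

(** * Joint measurability in time and path *)

Lemma measurable_fun_integral_in (d1 d2 : measure_display) (T1 : measurableType d1)
    (T2 : measurableType d2) (R : realType) (m2 : {sigma_finite_measure set T2 -> \bar R})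
    (D1 : set T1) (D2 : set T2) (f : T1 -> T2 -> \bar R) :
  measurable D1 -> measurable D2 ->
  measurable_fun (D1 `*` D2) (fun p => f p.1 p.2) ->
  (forall x y, D1 x -> D2 y -> (0 <= f x y)%E) ->
  measurable_fun D1 (fun x => \int[m2]_(y in D2) f x y)%E.
Proof.
move=> mD1 mD2 mf f0; pose g := (fun p => f p.1 p.2) \_ (D1 `*` D2).
have mg : measurable_fun setT g.
  by apply/(measurable_restrictT (fun p => f p.1 p.2)) => //; exact: measurableX.
have g0 z : (0 <= g z)%E.
  by rewrite /g patchE; case: ifPn => //; rewrite inE => -[]; exact: f0.
have := measurable_fun_fubini_tonelli_F (m2 := m2) g mg g0.
move=> /(@measurable_funTS _ _ _ _ D1); apply: eq_measurable_fun => x; rewrite inE => D1x.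
rewrite /fubini_F [RHS]integral_mkcond; apply: eq_integral => y _.
rewrite /g !patchE; congr (if _ then _ else _).
by apply/idP/idP; rewrite !inE//= => -[].
Qed.

Section joint_measurability.
Context (d : measure_display) (T : measurableType d) (R : realType).
Variables (Y : R -> T -> R) (r : R).
Hypothesis mY : forall s, 0 <= s <= r -> measurable_fun [set: T] (Y s).
Hypothesis cY : forall w : T, {within `[0, +oo[, continuous (fun s => Y s w)}.

Let grid N (s : R) : R := (Num.truncn (s * N.+1%:R))%:R / N.+1%:R.

Let grid_le N s : 0 <= s -> 0 <= grid N s <= s.
Proof.
move=> s0; rewrite divr_ge0//= ler_pdivrMr//.
by have := truncn_itv (mulr_ge0 s0 (ler0n R N.+1)) => /andP[].
Qed.

Let cvg_grid s : 0 <= s -> grid N s @[N --> \oo] --> s.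
Proof.
move=> s0; apply: (@squeeze_cvgr _ _ _ _ (fun N => s - N.+1%:R^-1) (fun=> s)).
- apply: nearW => N; have /andP[_ ->] := grid_le N s0; rewrite andbT.
  rewrite lerBlDr -[X in _ + X]mul1r -mulrDl.
  have /andP[_ /ltW] := truncn_itv (mulr_ge0 s0 (ler0n R N.+1)).
  by rewrite natr1 ler_pdivlMr.
- rewrite -[X in _ --> X]subr0; apply: cvgB; first exact: cvg_cst.
  exact: cvg_harmonic.
- exact: cvg_cst.
Qed.

(** Times are rounded down to multiples of [1 / (N + 1)], and continuity of the paths gives the
    limit. Rounding down only uses times up to [r], so that the result also applies to the
    sigma-algebra of the past at [r]. *)
Lemma measurable_continuous_process :
  measurable_fun (`[0, r] `*` [set: T]) (fun p : R * T => Y p.1 p.2).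
Proof.
apply: (@measurable_fun_cvg _ _ _ _ (fun N p => Y (grid N p.1) p.2)); last first.
  move=> [s w]/= [+ _]; rewrite /= in_itv/= => /andP[s0 sr].
  move: (@cY w) => /subspace_continuousP/(_ s).
  rewrite /= in_itv/= s0 => /(_ isT) h.
  apply: cvg_comp h => P wP.
  have wP' : nbhs s [set x | `[0, +oo[%classic x -> P x] by exact: wP.
  have [M _ MP] := cvg_grid s0 wP'; exists M => // N /= MN; apply: (MP N MN).
  by have /andP[] := grid_le N s0; rewrite /= in_itv/= andbT.
move=> N _ B mB.
pose I k := `[0, r]%classic `&` `[k%:R / N.+1%:R, k.+1%:R / N.+1%:R[ : set R.
have -> : `[0, r] `*` [set: T] `&` (fun p : R * T => Y (grid N p.1) p.2) @^-1` B =
    \bigcup_k (I k `*` Y (k%:R / N.+1%:R) @^-1` B).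
  apply/seteqP; split => [[s w] [[/= srI _] BY]|[s w] [k _ [[/= srI]]]].
    exists (Num.truncn (s * N.+1%:R)) => //; split => //; split => //=.
    move: srI; rewrite /= !in_itv/= => /andP[s0 _].
    rewrite ler_pdivrMr// ltr_pdivlMr//.
    exact: truncn_itv (mulr_ge0 s0 (ler0n R N.+1)).
  rewrite in_itv/= ler_pdivrMr// ltr_pdivlMr// => /truncn_def ks BY.
  by split => //=; rewrite /grid ks.
apply: bigcup_measurable => k _.
have [kr|kr] := leP (k%:R / N.+1%:R) r.
  apply: measurableX; first exact: measurableI.
  rewrite -[_ @^-1` _]setTI; apply: mY => //.
  by rewrite kr divr_ge0.
rewrite (_ : I k = set0) ?set0X//.
rewrite -subset0 => s [] /=; rewrite !in_itv/= => /andP[_ sr] /andP[ks _].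
by have := lt_le_trans kr (le_trans ks sr); rewrite ltxx.
Qed.

End joint_measurability.

Lemma measurable_invr (R : realType) (D : set R) : measurable_fun D (@GRing.inv R).
Proof.
apply: measurable_funTS.
(* The formula goes through [powR], measurable on the whole line, and both sides vanish at [0]. *)
have -> : @GRing.inv R = (fun x => x * (`|x| `^ (-1)) ^+ 2).
  apply/funext => x; rewrite powR_inv1// exprVn real_normK ?num_real//.
  have [->|x0] := eqVneq x 0; first by rewrite invr0 mul0r.
  by rewrite expr2 invfM mulrA mulfV// mul1r.
apply: measurable_funM => //; apply: measurable_funX.
exact: (measurableT_comp (measurable_powR _) (@normr_measurable R setT)).
Qed.

Lemma measurable_fun_invr (d : measure_display) (T : measurableType d) (R : realType)
    (D : set T) (f : T -> R) : measurable_fun D f -> measurable_fun D (fun x => (f x)^-1).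
Proof. by move=> mf; exact: (measurableT_comp (@measurable_invr R setT) mf). Qed.

Lemma measurable_fun_powR (d : measure_display) (T : measurableType d) (R : realType)
    (D : set T) (f : T -> R) (p : R) :
  measurable_fun D f -> measurable_fun D (fun x => f x `^ p).
Proof. by move=> mf; apply: (measurableT_comp (measurable_powR p) mf). Qed.

Lemma measurable_fun_expR (d : measure_display) (T : measurableType d) (R : realType)
    (D : set T) (f : T -> R) : measurable_fun D f -> measurable_fun D (fun x => expR (f x)).
Proof. by move=> mf; apply: (measurableT_comp _ mf). Qed.

(* Continuity of powers with a positive exponent, including at [0]. *)
Lemma cvg_powR_ge0 (R : realType) (u : R ^nat) (l p : R) : 0 < p ->
  (forall k, 0 <= u k) -> u @ \oo --> l -> (fun k => u k `^ p) @ \oo --> l `^ p.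
Proof.
move=> p0 u0 ul.
have l0 : 0 <= l.
  rewrite -(cvg_lim _ ul)//; apply: limr_ge; last exact: nearW.
  by apply/cvg_ex; exists l.
have [lE|ln0] := eqVneq l 0; last first.
  apply: (@cvg_comp _ _ _ _ (fun x : R => x `^ p) _ _ _ ul).
  apply: (@derivable1_cvg R (fun x => x `^ p)); apply: derivable_powR.
  by rewrite in_itv/= andbT lt_neqAle eq_sym ln0.
rewrite lE powR0 ?gt_eqF//; apply/cvgrPdist_lt => e e0.
have d0 : 0 < e `^ p^-1 by rewrite powR_gt0.
move: ul; rewrite lE => /cvgrPdist_lt/(_ _ d0); apply: filterS => k.
rewrite !sub0r !normrN !ger0_norm ?powR_ge0// => uk.
rewrite (_ : e = (e `^ p^-1) `^ p); last by rewrite -powRrM mulVf ?gt_eqF// powRr1// ltW.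
by apply: gt0_ltr_powR => //; rewrite nnegrE// ltW.
Qed.

Section hexp_regularity.
Variable R : realType.
Variables (del n v : R).
Hypotheses (del0 : 0 < del) (n0 : 0 < n) (n1 : 0 < n + del / 2 - 1) (v0 : 0 < v).
Implicit Types t s z tau y : R.

Section measurability.
Context (d : measure_display) (T : measurableType d) (D : set T) (f g : T -> R).
Hypotheses (mf : measurable_fun D f) (mg : measurable_fun D g).

Let mden : measurable_fun D (fun x => 1 + 2 * v * f x).
Proof. by apply: measurable_funD => //; apply: measurable_funM. Qed.

Let mexp : measurable_fun D (fun x => expR (- (v / (1 + 2 * v * f x) * g x))).
Proof.
apply: measurable_fun_expR; apply: measurable_funN; apply: measurable_funM => //.
by apply: measurable_funM => //; exact: measurable_fun_invr.
Qed.

Lemma measurable_fun_hexp : measurable_fun D (fun x => hexp del n v (f x) (g x)).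
Proof.
apply: measurable_funM; first exact: measurable_fun_powR.
by apply: measurable_funM => //; exact: measurable_fun_powR.
Qed.

Lemma measurable_fun_hexp_rate : measurable_fun D (fun x => hexp_rate del n v (f x) (g x)).
Proof.
apply: measurable_funM => //; apply: measurable_funM; first exact: measurable_fun_powR.
by apply: measurable_funM => //; exact: measurable_fun_powR.
Qed.

Lemma measurable_fun_hexp_rate_flow tau :
  measurable_fun D (fun x => hexp_rate_flow del n v tau (g x) (f x)).
Proof.
have mw : measurable_fun D (fun x => g x / (2 * f x)).
  by apply: measurable_funM => //; apply: measurable_fun_invr; exact: measurable_funM.
have cS : continuous (confluent (del / 2) (n - 1)).
  move=> x; apply: derivable1_cvg.
  have a0 : 0 < del / 2 by rewrite divr_gt0.
  have an1 : 0 < del / 2 + (n - 1) by move: n1; rewrite addrA [n + _]addrC.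
  exact: (@ex_derive _ _ _ _ _ _ _ (is_derive_confluent x a0 an1)).
apply: measurable_funM => //; apply: measurable_funM; last first.
  have marg : measurable_fun D (fun x => g x / (2 * f x) - g x * v / (1 + 2 * v * tau)).
    by apply: measurable_funB => //; apply: measurable_funM => //; exact: measurable_funM.
  exact: (measurableT_comp (continuous_measurable_fun cS) marg).
apply: measurable_funM; first by apply: measurable_fun_expR; exact: measurable_funN.
apply: measurable_funM; apply: measurable_fun_powR; first exact: measurable_funM.
apply: measurable_funD => //; apply: measurable_funM => //.
exact: measurable_funB.
Qed.

End measurability.

(** The slowest exponential rate for [tau <= H] is [b = v / (1 + 2 v H)], and [y ^ n] is absorbed by
    [powR_le_expR] at [2 b y]. This is where [v > 0] matters: at [v = 0] the function is [y ^ n]. *)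
Lemma hexp_bounded H : 0 <= H -> exists2 C, 0 < C &
  forall tau y, 0 <= tau <= H -> 0 <= y -> hexp del n v tau y <= C.
Proof.
move=> H0; have [C C0 CE] := powR_le_expR (ltW n0).
pose b := v / (1 + 2 * v * H).
have v0' := ltW v0.
have den t : 0 <= t -> 1 <= 1 + 2 * v * t.
  by move=> t0; rewrite lerDl !mulr_ge0.
have b0 : 0 < b by rewrite divr_gt0// (lt_le_trans _ (den _ H0)).
exists (C * (2 * b) `^ (- n)) => [|tau y /andP[t0 tH] y0].
  by rewrite mulr_gt0// powR_gt0// mulr_gt0.
rewrite /hexp; set c := 1 + 2 * v * tau; have c1 : 1 <= c by exact: den.
have c0 : 0 < c by rewrite (lt_le_trans _ c1).
have [->|yn0] := eqVneq y 0.
  by rewrite powR0 ?(gt_eqF n0)// mul0r mulr0 mulr_ge0 ?powR_ge0// ltW.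
have yp : 0 < y by rewrite lt_neqAle eq_sym yn0.
have cb : c `^ (- (del / 2 + 2 * n)) <= 1.
  rewrite -[leRHS](powRr0 c) ler_powR// oppr_le0 addr_ge0//.
    by rewrite divr_ge0// ltW.
  by rewrite mulr_ge0// ltW.
rewrite -[leRHS]mul1r; apply: ler_pM => //; first exact: powR_ge0.
  exact: powR_expR_ge0.
have b20 : 0 < 2 * b by rewrite mulr_gt0.
have by0 : 0 < 2 * b * y by rewrite mulr_gt0.
have := CE _ by0; rewrite (powRM _ (ltW b20) y0).
have -> : 2 * b * y / 2 = b * y by field.
have bn : 0 < (2 * b) `^ n by rewrite powR_gt0.
rewrite -ler_pdivlMl// => h.
have e0 : expR (- (v / c * y)) <= expR (- (b * y)).
  rewrite ler_expR lerN2 ler_wpM2r// /b ler_wpM2l//.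
  by rewrite lef_pV2 ?posrE// ?(lt_le_trans _ (den _ H0))// lerD2l ler_wpM2l// mulr_ge0.
apply: (@le_trans _ _ (((2 * b) `^ n)^-1 * (C * expR (b * y)) * expR (- (b * y)))).
  by apply: ler_pM => //; rewrite ?powR_ge0// expR_ge0.
by rewrite powRN -!mulrA expRxMexpNx_1 mulr1 mulrC.
Qed.

Lemma cvg_hexp (u w : R ^nat) tau y : (forall k, 0 <= u k) -> 0 <= tau ->
  u @ \oo --> tau -> (forall k, 0 <= w k) -> w @ \oo --> y ->
  (fun k => hexp del n v (u k) (w k)) @ \oo --> hexp del n v tau y.
Proof.
move=> u0 t0 ut w0 wy; rewrite /hexp.
have c0 : 0 < 1 + 2 * v * tau by rewrite ltr_pwDl// !mulr_ge0// ltW.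
have cden : (fun k => 1 + 2 * v * u k) @ \oo --> 1 + 2 * v * tau.
  by apply: cvgD; [exact: cvg_cst|exact: cvgMl_tmp].
apply: cvgM.
  apply: (@cvg_comp _ _ _ _ (fun x : R => x `^ _) _ _ _ cden).
  apply: (@derivable1_cvg R (fun x => x `^ _)).
  by apply: derivable_powR; rewrite in_itv/= andbT.
apply: cvgM; first exact: cvg_powR_ge0.
apply: (@cvg_comp _ _ _ _ expR _ _ _ _ (@continuous_expR R _)).
apply: cvgN; apply: cvgM => //; apply: cvgMl_tmp; apply: cvgV => //.
by rewrite gt_eqF.
Qed.

End hexp_regularity.

Lemma besq_op_ge0 (R : realType) (del t z : R) (f : R -> \bar R) :
  0 < del -> 0 < t -> 0 <= z -> (forall y, 0 <= f y)%E -> (0 <= besq_op del t z f)%E.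
Proof.
move=> del0 t0 z0 f0; apply: nneseries_ge0 => k _ _.
rewrite mule_ge0 ?lee_fin ?poisson_weight_ge0//.
  by rewrite divr_ge0// mulr_ge0// ltW.
by apply: integral_ge0 => y _; rewrite mule_ge0// lee_fin// gamma_density_ge0// half_natr_gt0.
Qed.

(** * The Dynkin formula with a weight measurable in the past *)

Section dynkin.
Variable R : realType.
Context (d : measure_display) (T : measurableType d) (P : probability T R).
Variables (Z : R -> T -> R) (del z0 n v : R).
Hypotheses (del0 : 0 < del) (n0 : 0 < n) (n1 : 0 < n + del / 2 - 1) (v0 : 0 < v).
Hypothesis HZ : is_squared_bessel P del z0 Z.

Local Notation mu := (@lebesgue_measure R).
Local Notation past s := (g_sigma_algebraType (past_events Z s)).
Local Notation hexp := (hexp del n v).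
Local Notation hexp_rate := (hexp_rate del n v).

Let mZ t : 0 <= t -> measurable_fun [set: T] (Z t). Proof. by case: HZ => + _ _ _ _; apply. Qed.
Let Z_ge0 t w : 0 <= t -> 0 <= Z t w. Proof. by case: HZ => _ + _ _ _; apply. Qed.
Let cZ w : {within `[0, +oo[, continuous (fun t => Z t w)}. Proof. by case: HZ. Qed.

Let hexp0 tau y : 0 <= hexp tau y. Proof. exact: hexp_ge0. Qed.
Let rate0 tau y : 0 <= hexp_rate tau y. Proof. exact: hexp_rate_ge0. Qed.

Lemma markov_hexp r t tau (Q : T -> R) : 0 <= r < t ->
  measurable_fun [set: past r] (Q : past r -> R) -> (forall w, 0 <= Q w) ->
  (\int[P]_w ((Q w)%:E * (hexp tau (Z t w))%:E) =
   \int[P]_w ((Q w)%:E * besq_op del (t - r) (Z r w) (EFin \o hexp tau)))%E.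
Proof.
move=> rt mQ Q0; apply: (@markov_past _ _ _ _ _ _ _ del0 HZ _ _ rt (EFin \o Q) (EFin \o hexp tau)).
- exact/measurable_EFinP.
- by move=> w; rewrite lee_fin.
- by apply/measurable_EFinP; exact: measurable_hexp.
- by move=> y; rewrite lee_fin.
Qed.

Lemma markov_hexp_rate r t tau (Q : T -> R) : 0 <= r < t ->
  measurable_fun [set: past r] (Q : past r -> R) -> (forall w, 0 <= Q w) ->
  (\int[P]_w ((Q w)%:E * (hexp_rate tau (Z t w))%:E) =
   \int[P]_w ((Q w)%:E * besq_op del (t - r) (Z r w) (EFin \o hexp_rate tau)))%E.
Proof.
move=> rt mQ Q0; apply: (@markov_past _ _ _ _ _ _ _ del0 HZ _ _ rt (EFin \o Q) (EFin \o hexp_rate tau)).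
- exact/measurable_EFinP.
- by move=> w; rewrite lee_fin.
- by apply/measurable_EFinP; exact: measurable_hexp_rate.
- by move=> y; rewrite lee_fin.
Qed.

(** The Markov property at [r] reduces the claim to the semigroup started from [Z r], where
    [besq_op_dynkin] applies; Fubini, and the Markov property between [r] and each [s], turn the
    result back into expectations of the process. *)
Lemma hexp_dynkin_eps H r eps (Q : T -> R) : 0 <= r -> 0 < eps < H - r ->
  measurable_fun [set: past r] (Q : past r -> R) -> (forall w, 0 <= Q w) ->
  (\int[P]_w ((Q w)%:E * (hexp 0 (Z H w))%:E) =
   \int[P]_w ((Q w)%:E * (hexp (H - r - eps) (Z (r + eps)%R w))%:E) +
   \int[mu]_(s in `[(r + eps)%R, H]) \int[P]_w ((Q w)%:E * (hexp_rate (H - s) (Z s w))%:E))%E.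
Proof.
move=> r0 eH mQ Q0; have /andP[e0 eH'] := eH.
have rH : 0 <= r < H by rewrite r0/= -subr_gt0 (lt_trans e0).
have re : 0 <= r < r + eps by rewrite r0/= ltrDl.
have mQT : measurable_fun [set: T] Q by exact: (past_measurable_fun HZ mQ).
(* The closed form is taken as integrand because its joint measurability in path and time is
   explicit. *)
pose F (w : T) s := hexp_rate_flow del n v (H - r) (Z r w) (s - r).
have FE w s : r + eps <= s <= H ->
    (F w s)%:E = besq_op del (s - r) (Z r w) (EFin \o hexp_rate (H - s)).
  move=> /andP[es sH].
  have sr : 0 < s - r <= H - r by rewrite lerB// andbT subr_gt0 (lt_le_trans _ es)// ltrDl.
  rewrite /F -(besq_op_hexp_rate del0 n0 n1 (ltW v0) sr (Z_ge0 w r0)).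
  by rewrite opprB addrA subrK.
have F0 w s : r + eps <= s <= H -> 0 <= F w s.
  move=> h; rewrite -lee_fin FE//; apply: besq_op_ge0 => //; last by move=> y; rewrite lee_fin.
  - by case/andP: h => es _; rewrite subr_gt0 (lt_le_trans _ es)// ltrDl.
  - exact: Z_ge0.
have mF : measurable_fun [set: T * R] (fun p => F p.1 p.2).
  apply: measurable_fun_hexp_rate_flow => //.
    by apply: measurable_funB => //; exact: measurable_snd.
  exact: (measurableT_comp (mZ r0) measurable_fst).
have mFs w : measurable_fun [set: R] (F w).
  exact: (measurableT_comp mF (pair1_measurable w)).
have er : r + eps - r = eps by rewrite addrAC subrr add0r.
pose B w := besq_op del eps (Z r w) (EFin \o hexp (H - r - eps)).
have B0 w : (0 <= B w)%E.
  by apply: besq_op_ge0 => //; [exact: Z_ge0|move=> y; rewrite lee_fin].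
have mB : measurable_fun [set: T] B.
  have := @measurable_besq_op _ _ _ _ _ _ _ del0 HZ r (r + eps) (EFin \o hexp (H - r - eps)) re.
  rewrite er; apply; first by move=> y; rewrite lee_fin.
  by apply/measurable_EFinP; exact: measurable_hexp.
have I0 w : (0 <= \int[mu]_(s in `[(r + eps)%R, H]) (F w s)%:E)%E.
  by apply: integral_ge0 => s; rewrite /= in_itv/= lee_fin; exact: F0.
have QF0 w s : r + eps <= s <= H -> (0 <= (Q w)%:E * (F w s)%:E)%E.
  by move=> h; rewrite -EFinM lee_fin mulr_ge0// F0.
have mQF : measurable_fun [set: T * R] (fun p => (Q p.1)%:E * (F p.1 p.2)%:E)%E.
  apply: emeasurable_funM; apply/measurable_EFinP => //.
  exact: (measurableT_comp mQT measurable_fst).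
have mQE : measurable_fun [set: T] (fun w => (Q w)%:E) by exact/measurable_EFinP.
have QIE w : ((Q w)%:E * \int[mu]_(s in `[(r + eps)%R, H]) (F w s)%:E =
    \int[mu]_(s in `[(r + eps)%R, H]) ((Q w)%:E * (F w s)%:E))%E.
  rewrite ge0_integralZl//.
  - by apply/measurable_EFinP; apply: measurable_funTS; exact: mFs.
  - by move=> s; rewrite /= in_itv/= lee_fin; exact: F0.
  - by rewrite lee_fin.
rewrite (@markov_hexp r H 0 Q rH mQ Q0).
transitivity (\int[P]_w ((Q w)%:E * B w + (Q w)%:E * \int[mu]_(s in `[(r + eps)%R, H]) (F w s)%:E))%E.
  apply: eq_integral => w _.
  by rewrite (besq_op_dynkin del0 n0 n1 (ltW v0) eH (Z_ge0 w r0)) (ge0_muleDr _ (B0 w) (I0 w)).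
rewrite ge0_integralD//; last 4 first.
- by move=> w _; apply: mule_ge0; rewrite ?lee_fin.
- exact: emeasurable_funM.
- by move=> w _; apply: mule_ge0; rewrite ?lee_fin.
- apply: emeasurable_funM => //; apply: measurable_fun_integral_in => //.
    by apply: measurable_funTS; exact/measurable_EFinP.
  by move=> w s _; rewrite /= in_itv/= lee_fin; exact: F0.
congr (_ + _)%E.
  by have := @markov_hexp r (r + eps) (H - r - eps) Q re mQ Q0; rewrite er => ->.
under eq_integral do rewrite QIE.
transitivity (\int[mu]_(s in `[(r + eps)%R, H]) \int[P]_w ((Q w)%:E * (F w s)%:E))%E.
  apply: (@ge0_fubini_in _ _ _ _ _ P mu setT `[(r + eps), H]%classic
    (fun p => (Q p.1)%:E * (F p.1 p.2)%:E)%E) => //.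
  - exact: measurable_funTS.
  - by move=> w s _; rewrite /= in_itv/=; exact: QF0.
apply: eq_integral => s; rewrite inE/= in_itv/= => /andP[es sH].
have rs : 0 <= r < s by rewrite r0 (lt_le_trans _ es)// ltrDl.
rewrite (@markov_hexp_rate r s (H - s) Q rs mQ Q0); apply: eq_integral => w _.
by rewrite FE// es.
Qed.

Lemma measurable_process (H : R) :
  measurable_fun (`[0, H] `*` [set: T]) (fun p : R * T => Z p.1 p.2).
Proof. by apply: measurable_continuous_process => // s /andP[s0 _]; exact: mZ. Qed.

Lemma measurable_process_rate (H : R) (Q : T -> R) : measurable_fun setT Q ->
  measurable_fun (`[0, H] `*` [set: T])
    (fun p : R * T => (Q p.2)%:E * (hexp_rate (H - p.1) (Z p.1 p.2))%:E)%E.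
Proof.
move=> mQ; apply: emeasurable_funM; apply/measurable_EFinP.
  by apply: measurable_funTS; exact: (measurableT_comp mQ measurable_snd).
apply: measurable_fun_hexp_rate; last exact: measurable_process.
by apply: measurable_funTS; apply: measurable_funB => //; exact: measurable_fst.
Qed.

Lemma cvg_within_ge0 (f : R -> R) (u : R ^nat) (s : R) : {within `[0, +oo[, continuous f} ->
  (forall k, 0 <= u k) -> 0 <= s -> u @ \oo --> s -> f (u k) @[k --> \oo] --> f s.
Proof.
move=> /subspace_continuousP/(_ s); rewrite /= in_itv/= andbT => h u0 s0 us.
apply: cvg_comp (h s0) => A wA.
have wA' : nbhs s [set x | `[0, +oo[%classic x -> A x] by exact: wA.
have [M _ MA] := us _ wA'; exists M => // k /= Mk; apply: (MA k Mk).
by rewrite /= in_itv/= andbT.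
Qed.

(** As [eps] tends to [0], the first term converges by path continuity and the bounds on [Q] and
    [hexp], the time integral by monotone convergence, the rate being nonnegative. *)
Lemma hexp_dynkin (H r C : R) (Q : T -> R) : 0 <= r < H ->
  measurable_fun [set: past r] (Q : past r -> R) -> (forall w, 0 <= Q w <= C) ->
  (\int[P]_w ((Q w)%:E * (hexp 0 (Z H w))%:E) =
   \int[P]_w ((Q w)%:E * (hexp (H - r) (Z r w))%:E) +
   \int[mu]_(s in `[r, H]) \int[P]_w ((Q w)%:E * (hexp_rate (H - s) (Z s w))%:E))%E.
Proof.
move=> /andP[r0 rH] mQ QC.
have Q0 w : 0 <= Q w by case/andP: (QC w).
have C0 : 0 <= C.
  by have /andP[h1 h2] := QC point; exact: le_trans h2.
have mQT : measurable_fun [set: T] Q by exact: (past_measurable_fun HZ mQ).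
have Hr0 : 0 < H - r by rewrite subr_gt0.
have H0 : 0 <= H by rewrite (le_trans r0)// ltW.
(* The shift by two keeps [eps k] strictly below [H - r] already at [k = 0]. *)
pose eps k : R := (H - r) / k.+2%:R.
have eps0 k : 0 < eps k < H - r.
  rewrite divr_gt0//= ltr_pdivrMr// ltr_pMr// ltr1n//.
have eps_cvg : eps @ \oo --> 0.
  rewrite -[X in _ --> X](mulr0 (H - r)); apply: cvgMl_tmp.
  exact: (cvg_succ (@cvg_harmonic R)).
pose I s := (\int[P]_w ((Q w)%:E * (hexp_rate (H - s) (Z s w))%:E))%E.
have I0 s : (0 <= I s)%E.
  by apply: integral_ge0 => w _; rewrite -EFinM lee_fin mulr_ge0.
have mI : measurable_fun `[0, H] I.
  apply: measurable_fun_integral_in => //; first exact: measurable_process_rate.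
  by move=> s w _ _; rewrite -EFinM lee_fin mulr_ge0.
have [B B0 hB] := hexp_bounded del0 n0 v0 H0.
have cvg1 : (\int[P]_w ((Q w)%:E * (hexp (H - r - eps k) (Z (r + eps k)%R w))%:E))%E @[k --> \oo]
    --> (\int[P]_w ((Q w)%:E * (hexp (H - r) (Z r w))%:E))%E.
  have rek k : 0 <= r + eps k by rewrite addr_ge0// ltW//; case/andP: (eps0 k).
  have Hrek k : 0 <= H - r - eps k by rewrite subr_ge0 ltW//; case/andP: (eps0 k).
  have := @dominated_convergence _ T R P setT measurableT
    (fun k w => ((Q w)%:E * (hexp (H - r - eps k) (Z (r + eps k)%R w))%:E)%E)
    (fun w => ((Q w)%:E * (hexp (H - r) (Z r w))%:E)%E) (cst (C * B)%:E).
  case => //.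
  - move=> k; apply: emeasurable_funM; apply/measurable_EFinP => //.
    exact: (measurableT_comp (@measurable_hexp R del n v _ setT) (mZ (rek k))).
  - apply: emeasurable_funM; apply/measurable_EFinP => //.
    exact: (measurableT_comp (@measurable_hexp R del n v _ setT) (mZ r0)).
  - apply: aeW => w _; apply: cvgeZl => //; apply: cvg_EFin; first exact: nearW.
    apply: cvg_hexp => //.
    + exact: ltW.
    + rewrite -[X in _ --> X]subr0; apply: cvgB => //; exact: cvg_cst.
    + by move=> k; exact: Z_ge0.
    + apply: (@cvg_within_ge0 (fun s => Z s w) (fun k => r + eps k)) => //.
      by rewrite -[X in _ --> X]addr0; apply: cvgD => //; exact: cvg_cst.
  - exact: finite_measure_integrable_cst.
  - apply: aeW => w k _; rewrite -EFinM abse_EFin lee_fin.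
    rewrite ger0_norm; last exact: mulr_ge0.
    apply: ler_pM => //; first by case/andP: (QC w).
    apply: hB; last exact: Z_ge0.
    by rewrite Hrek/= lerBlDr lerBlDr -addrA lerDl addr_ge0// ltW//; case/andP: (eps0 k).
have cvg2 : (\int[mu]_(s in `[(r + eps k)%R, H]) I s)%E @[k --> \oo] --> (\int[mu]_(s in `[r, H]) I s)%E.
  rewrite -integral_itv_obnd_cbnd; last first.
    apply: measurable_funS mI => // s; rewrite /= !in_itv/= => /andP[rs ->].
    by rewrite andbT (le_trans r0)// ltW.
  have -> : `]r, H]%classic = \bigcup_k `[r + eps k, H]%classic.
    apply/seteqP; split => s /=; rewrite in_itv/=.
      move=> /andP[rs sH]; have sr : 0 < s - r by rewrite subr_gt0.
      have [j _ hj] := (cvgrPdist_lt _ _).1 eps_cvg _ sr.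
      have /= := hj j (leqnn j); rewrite sub0r normrN gtr0_norm; last by case/andP: (eps0 j).
      by move=> h; exists j => //=; rewrite in_itv/= sH andbT -lerBrDl ltW.
    move=> [j _]; rewrite /= !in_itv/= => /andP[rs ->]; rewrite andbT (lt_le_trans _ rs)//.
    by rewrite ltrDl; case/andP: (eps0 j).
  apply: ge0_nondecreasing_set_cvg_integral => //.
  - move=> i j ij; apply/subsetPset => s; rewrite /= !in_itv/= => /andP[rs ->].
    rewrite andbT (le_trans _ rs)// lerD2l ler_pM2l// lef_pV2 ?posrE//.
    by rewrite ler_nat !ltnS.
  - move=> j; apply: measurable_funS mI => // s; rewrite /= !in_itv/= => /andP[rs ->].
    by rewrite andbT (le_trans _ rs)// addr_ge0// ltW//; case/andP: (eps0 j).
have E j : (\int[P]_w ((Q w)%:E * (hexp (H - r - eps j) (Z (r + eps j)%R w))%:E) +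
   \int[mu]_(s in `[(r + eps j)%R, H]) I s =
   \int[P]_w ((Q w)%:E * (hexp 0 (Z H w))%:E))%E by apply/esym; exact: hexp_dynkin_eps.
have c : (\int[P]_w ((Q w)%:E * (hexp (H - r - eps k) (Z (r + eps k)%R w))%:E) +
   \int[mu]_(s in `[(r + eps k)%R, H]) I s)%E @[k --> \oo] -->
   (\int[P]_w ((Q w)%:E * (hexp (H - r) (Z r w))%:E) + \int[mu]_(s in `[r, H]) I s)%E.
  apply: cvgeD cvg1 cvg2; apply: ge0_adde_def; rewrite inE; apply: integral_ge0 => // w _.
  by rewrite -EFinM lee_fin mulr_ge0.
have cE := cvg_lim (@ereal_hausdorff R) c.
refine (etrans _ (cE _)); apply/esym/cvg_lim => //.
by apply: cvg_near_cst; apply: nearW => j; exact: E.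
Qed.

End dynkin.

(** * Killing at a truncated rate *)

Section discount.
Variable R : realType.
Variable g : R -> R.
Hypothesis cg : {within `[0, +oo[, continuous g}.

Local Notation mu := (@lebesgue_measure R).

Definition discount (s : R) : R := expR (- (\int[mu]_(u in `[0, s]) g u)).

Let A (s : R) : R := \int[mu]_(u in `[0, s]) g u.

Let cgs (s : R) : {within `[0, s], continuous g}.
Proof.
by apply: continuous_subspaceW cg => x; rewrite /= !in_itv/= andbT => /andP[].
Qed.

Lemma within_integrable s : mu.-integrable `[0, s] (EFin \o g).
Proof. by apply: continuous_compact_integrable => //; exact: segment_compact. Qed.

Let A_deriv (s : R) : 0 < s -> is_derive s (1 : R) A (g s).
Proof.
move=> s0; have s1 : s < s + 1 by rewrite ltrDl.
have gs : {for s, continuous g}.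
  have [h _] := (continuous_within_itvcyP _ _).1 cg.
  by apply: h; rewrite in_itv/= andbT.
have [h1 h2] := @continuous_FTC1_closed R g 0 s (s + 1) s1 (within_integrable _) s0 gs.
by apply: (DeriveDef h1); rewrite -derive1E; exact: h2.
Qed.

Let A_cont s : 0 < s -> {within `[0, s], continuous A}.
Proof. by move=> s0; apply: parameterized_integral_continuous; rewrite ?ltW//; exact: within_integrable. Qed.

Lemma discount_continuous : {within `[0, +oo[, continuous discount}.
Proof.
apply/continuous_within_itvcyP; split.
  move=> s; rewrite in_itv/= andbT => s0; apply: continuous_comp; last exact: continuous_expR.
  apply: cvgN; have h := A_deriv s0; apply: derivable1_cvg.
  exact: (@ex_derive _ _ _ _ _ _ _ h).
have [_ h _] := (continuous_within_itvP _ ltr01).1 (A_cont ltr01).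
apply: (@cvg_comp _ _ _ _ expR _ _ _ _ (@continuous_expR R _)).
exact: cvgN h.
Qed.

Lemma discount0 : discount 0 = 1.
Proof. by rewrite /discount set_itv1 Rintegral_set1 oppr0 expR0. Qed.

(** [- discount] is an antiderivative of [g * discount] for positive times, and its continuity at
    [0] closes the interval. The loss [1 - discount] is thereby spread over the killing times. *)
Lemma discount_FTC s : 0 <= s ->
  (\int[mu]_(r in `[0%R, s]) (g r * discount r)%:E = (1 - discount s)%:E)%E.
Proof.
rewrite le_eqVlt => /predU1P[<-|s0]; first by rewrite set_itv1 integral_set1 discount0 subrr.
have dE (r : R) : 0 < r -> is_derive r (1 : R) (fun r => - discount r) (g r * discount r).
  move=> r0; have h := A_deriv r0.
  have hN : is_derive r (1 : R) (fun r => - A r) (- g r) by exact: is_deriveN.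
  have he := @is_derive1_comp R expR (fun r => - A r) r _ _ (is_derive_expR _) hN.
  have hd : is_derive r (1 : R) discount (expR (- A r) * - g r) by exact: he.
  by apply: is_derive_eq; rewrite mulrN opprK mulrC.
have cD := discount_continuous.
have cDs : {within `[0, s], continuous discount}.
  by apply: continuous_subspaceW cD => x; rewrite /= !in_itv/= andbT => /andP[].
have [_ c1 c2] := (continuous_within_itvP _ s0).1 cDs.
rewrite (continuous_FTC2 s0 (F := fun r => - discount r)).
- by rewrite -EFinB discount0 opprK addrC.
- by move=> x; apply: cvgM; [exact: cgs|exact: cDs].
- split.
  + move=> x; rewrite in_itv/= => /andP[x0 _].
    exact: (@ex_derive _ _ _ _ _ _ _ (dE _ x0)).
  + exact: (cvgN c1).
  + exact: (cvgN c2).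
- move=> x; rewrite in_itv/= => /andP[x0 _]; rewrite derive1E.
  exact: (@derive_val _ _ _ _ _ _ _ (dE _ x0)).
Qed.

End discount.

Lemma measurable_fun_swap_in (d1 d2 d' : measure_display) (T1 : measurableType d1)
    (T2 : measurableType d2) (T' : measurableType d') (D1 : set T1) (D2 : set T2)
    (f : T1 * T2 -> T') : measurable D1 -> measurable D2 ->
  measurable_fun (D1 `*` D2) f -> measurable_fun (D2 `*` D1) (f \o (fun p => (p.2, p.1))).
Proof.
move=> mD1 mD2 mf; apply: (measurable_comp _ _ mf); first exact: measurableX.
  by move=> _ [[y x]/= [D2y D1x] <-].
by apply: measurable_funTS; exact: measurable_swap.
Qed.

Lemma ge0_integralD_in (d : measure_display) (T : measurableType d)
    (R : realType) (m : {measure set T -> \bar R}) (D : set T) (f g h : T -> \bar R) :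
  measurable D -> measurable_fun D f -> measurable_fun D g ->
  (forall x, D x -> 0 <= f x)%E -> (forall x, D x -> 0 <= g x)%E ->
  (forall x, D x -> f x + g x = h x)%E ->
  (\int[m]_(x in D) f x + \int[m]_(x in D) g x = \int[m]_(x in D) h x)%E.
Proof.
move=> mD mf mg f0 g0 fgh; rewrite -ge0_integralD//.
by apply: eq_integral => x; rewrite inE; exact: fgh.
Qed.

Section triangle.
Variables (R : realType) (H : R) (K : R -> R -> \bar R).
Hypothesis mK : measurable_fun ((`[0, H] : set R) `*` (`[0, H] : set R)) (fun p => K p.1 p.2).
Hypothesis K0 : forall r s, 0 <= r <= H -> 0 <= s <= H -> (0 <= K r s)%E.

Local Notation mu := (@lebesgue_measure R).

Let K' (r s : R) : \bar R := ((\1_[set q : R * R | q.1 <= q.2] (r, s) : R)%:E * K r s)%E.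

Let K'E r s : K' r s = (if r <= s then K r s else 0%E).
Proof.
rewrite /K' indicE/=; case: ifPn => rs; first by rewrite mem_set//= mul1e.
by rewrite memNset/= ?mul0e//; exact/negP.
Qed.

Let mK' : measurable_fun ((`[0, H] : set R) `*` (`[0, H] : set R)) (fun p => K' p.1 p.2).
Proof.
apply: emeasurable_funM => //; apply/measurable_EFinP.
rewrite (_ : (fun p : R * R => _) = \1_[set q : R * R | q.1 <= q.2]); last first.
  by apply/funext => -[].
apply: measurable_indic; rewrite -[X in measurable X]setTI.
exact: (measurable_fun_ler measurable_fst measurable_snd measurableT (Y := [set true])).
Qed.

Let K'0 r s : 0 <= r <= H -> 0 <= s <= H -> (0 <= K' r s)%E.
Proof. by move=> rH sH; rewrite K'E; case: ifPn => // _; exact: K0. Qed.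

Let upper r : 0 <= r <= H ->
  (\int[mu]_(s in `[r, H]) K r s = \int[mu]_(s in `[0%R, H]) K' r s)%E.
Proof.
move=> /andP[r0 rH].
have -> : `[r, H]%classic = `[0, H]%classic `&` `[r, H]%classic :> set R.
  apply/seteqP; split => s /=; rewrite !in_itv/=; last by case.
  by move=> /andP[rs sH]; rewrite rs sH (le_trans r0 rs).
rewrite integral_mkcondr; apply: eq_integral => s; rewrite inE/= in_itv/= => /andP[s0 sH].
rewrite K'E patchE; case: ifPn => [rs|]; last first.
  by rewrite notin_setE /= in_itv/= sH andbT => /negP/negbTE ->.
by move: rs; rewrite inE/= in_itv/= => /andP[-> _].
Qed.

Lemma measurable_fun_triangle :
  measurable_fun (`[0, H] : set R) (fun r => \int[mu]_(s in `[r, H]) K r s)%E.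
Proof.
apply: (@eq_measurable_fun _ _ _ _ _ (fun r => \int[mu]_(s in `[0%R, H]) K' r s)%E).
  by move=> r; rewrite inE/= in_itv/= => rH; rewrite upper.
by apply: (@measurable_fun_integral_in _ _ R (measurableTypeR R) R mu `[0, H] `[0, H] K').
Qed.

(** Both iterated integrals extend to the square by the indicator of [r <= s] built into [K'], where
    the nonnegative exchange applies. *)
Lemma fubini_triangle :
  (\int[mu]_(s in `[0%R, H]) \int[mu]_(r in `[0%R, s]) K r s =
   \int[mu]_(r in `[0%R, H]) \int[mu]_(s in `[r, H]) K r s)%E.
Proof.
transitivity (\int[mu]_(s in `[0%R, H]) \int[mu]_(r in `[0%R, H]) K' r s)%E.
  apply: eq_integral => s; rewrite inE/= in_itv/= => /andP[s0 sH].
  have -> : `[0, s]%classic = `[0, H]%classic `&` `[0, s]%classic :> set R.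
    apply/seteqP; split => r /=; rewrite !in_itv/=; last by case.
    by move=> /andP[-> rs]; rewrite (le_trans rs).
  rewrite integral_mkcondr; apply: eq_integral => r; rewrite inE/= in_itv/= => /andP[r0 rH].
  rewrite K'E patchE; case: ifPn; rewrite ?inE ?notin_setE /= in_itv/= r0/=.
    by move=> ->.
  by move=> /negP/negbTE ->.
transitivity (\int[mu]_(r in `[0%R, H]) \int[mu]_(s in `[0%R, H]) K' r s)%E.
  by apply/esym; apply: (@ge0_fubini_in _ _ _ _ _ mu mu `[0, H]%classic `[0, H]%classic
    (fun p => K' p.1 p.2)) => //.
by apply: eq_integral => r; rewrite inE/= in_itv/= => rH; rewrite upper.
Qed.

End triangle.

Section discounted.
Variable R : realType.
Context (d : measure_display) (T : measurableType d) (P : probability T R).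
Variables (Z : R -> T -> R) (del z0 n v e H : R).
Hypotheses (del0 : 0 < del) (n0 : 0 < n) (n1 : 0 < n + del / 2 - 1) (v0 : 0 < v).
Hypotheses (e0 : 0 < e) (H0 : 0 < H).
Hypothesis HZ : is_squared_bessel P del z0 Z.

Local Notation mu := (@lebesgue_measure R).
Local Notation past s := (g_sigma_algebraType (past_events Z s)).
Local Notation hexp := (hexp del n v).
Local Notation hexp_rate := (hexp_rate del n v).
Local Notation k := (2 * n * (n + del / 2 - 1)).

Let mZ t : 0 <= t -> measurable_fun [set: T] (Z t). Proof. by case: HZ => + _ _ _ _; apply. Qed.
Let Z_ge0 t w : 0 <= t -> 0 <= Z t w. Proof. by case: HZ => _ + _ _ _; apply. Qed.
Let cZ w : {within `[0, +oo[, continuous (fun t => Z t w)}. Proof. by case: HZ. Qed.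

Let k0 : 0 <= k. Proof. exact: hexp_rate_coef_ge0. Qed.

(* The killing rate [k / y], truncated near the origin. *)
Definition soft_rate (y : R) : R := k / (y + e).

Let soft_rate_bound y : 0 <= y -> 0 <= soft_rate y <= k / e.
Proof.
move=> y0; have ye : 0 < y + e by rewrite ltr_wpDl.
apply/andP; split; first exact: divr_ge0 k0 (ltW ye).
apply: ler_wpM2l; first exact: k0.
by rewrite lef_pV2 ?posrE// lerDr.
Qed.

Let measurable_soft_rate : measurable_fun setT soft_rate.
Proof. by apply: measurable_funM => //; apply: measurable_fun_invr; exact: measurable_funD. Qed.

Let soft_path w : {within `[0, +oo[, continuous (fun s => soft_rate (Z s w))}.
Proof.
apply/subspace_continuousP => s; rewrite /= in_itv/= andbT => s0.
have ye : 0 < Z s w + e by rewrite ltr_wpDl// Z_ge0.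
have h : Z t w @[t --> within `[0, +oo[ (nbhs s)] --> Z s w.
  by move/subspace_continuousP : (@cZ w) => /(_ s); rewrite /= in_itv/= andbT; apply.
apply: (@cvg_comp _ _ _ (fun t => Z t w) soft_rate _ _ _ h).
apply: cvgMl_tmp; apply: cvgV; first by rewrite gt_eqF.
by apply: cvgD; [exact: cvg_id|exact: cvg_cst].
Qed.

Definition soft_discount (s : R) (w : T) : R := discount (fun s => soft_rate (Z s w)) s.

(** Given the path, the density of the killing time at [s]. *)
Definition soft_kill (s : R) (w : T) : R := soft_rate (Z s w) * soft_discount s w.

Lemma soft_discount_gt0 s w : 0 < soft_discount s w. Proof. exact: expR_gt0. Qed.

Lemma soft_discount_le1 s w : 0 <= s -> soft_discount s w <= 1.
Proof.
move=> s0; rewrite /soft_discount /discount expR_le1 oppr_le0.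
apply: Rintegral_ge0 => u; rewrite /= in_itv/= => /andP[u0 _].
by have /andP[] := soft_rate_bound (Z_ge0 w u0).
Qed.

Lemma soft_kill_bound s w : 0 <= s -> 0 <= soft_kill s w <= k / e.
Proof.
move=> s0; have /andP[r0 r1] := soft_rate_bound (Z_ge0 w s0).
have d0 := ltW (soft_discount_gt0 s w).
rewrite mulr_ge0//= -[leRHS]mulr1.
by apply: ler_pM => //; exact: soft_discount_le1.
Qed.

(** Needed for [soft_kill r] to be a weight in the Dynkin formula. The integral up to [s] only sees
    the path up to [s], so joint measurability is applied with [past s] as the sample space. *)
Lemma past_measurable_soft_discount s : 0 <= s ->
  measurable_fun [set: past s] (soft_discount s : past s -> R).
Proof.
move=> s0; apply: measurable_fun_expR; apply: measurable_funN.
have mI : measurable_fun [set: past s]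
    (fun w : past s => \int[mu]_(u in `[0%R, s]) (soft_rate (Z u w))%:E)%E.
  apply: (@measurable_fun_integral_in _ _ (past s) (measurableTypeR R) R mu setT `[0, s]
    (fun w u => (soft_rate (Z u w))%:E)) => //; last first.
    move=> w u _; rewrite /= in_itv/= lee_fin => /andP[u0 _].
    by have /andP[] := soft_rate_bound (Z_ge0 w u0).
  apply/measurable_EFinP; apply: (measurableT_comp measurable_soft_rate).
  apply: (@measurable_fun_swap_in _ _ _ R (past s) R `[0, s] setT (fun p => Z p.1 p.2)) => //.
  apply: (@measurable_continuous_process _ (past s)) => //.
  by move=> u us; exact: measurable_past.
exact: (measurableT_comp (fine_measurable measurableT) mI).
Qed.

Lemma past_measurable_soft_kill s : 0 <= s ->
  measurable_fun [set: past s] (soft_kill s : past s -> R).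
Proof.
move=> s0; apply: measurable_funM; last exact: past_measurable_soft_discount.
apply: (measurableT_comp measurable_soft_rate).
by apply: measurable_past; rewrite s0 lexx.
Qed.

Lemma measurable_soft_discount (s : R) :
  measurable_fun (`[0, s] `*` [set: T]) (fun p : R * T => soft_discount p.1 p.2).
Proof.
apply: measurable_continuous_process.
  move=> u /andP[u0 _]; apply: (past_measurable_fun HZ).
  exact: past_measurable_soft_discount.
by move=> w; exact: discount_continuous.
Qed.

Lemma measurable_soft_kill (s : R) :
  measurable_fun (`[0, s] `*` [set: T]) (fun p : R * T => soft_kill p.1 p.2).
Proof.
apply: measurable_funM; last exact: measurable_soft_discount.
by apply: (measurableT_comp measurable_soft_rate); exact: (measurable_process HZ).
Qed.

Lemma soft_discount_FTC s w : 0 <= s ->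
  (\int[mu]_(r in `[0%R, s]) (soft_kill r w)%:E = (1 - soft_discount s w)%:E)%E.
Proof. by move=> s0; exact: (@discount_FTC _ _ (@soft_path w)). Qed.

Lemma integral_soft_kill s (h : T -> R) : 0 <= s ->
  measurable_fun [set: T] h -> (forall w, 0 <= h w) ->
  (\int[mu]_(r in `[0%R, s]) \int[P]_w (soft_kill r w * h w)%:E =
   \int[P]_w ((1 - soft_discount s w) * h w)%:E)%E.
Proof.
move=> s0 mh h0.
have mqh : measurable_fun (`[0, s] `*` [set: T]) (fun p : R * T => soft_kill p.1 p.2 * h p.2).
  apply: measurable_funM; first exact: measurable_soft_kill.
  by apply: measurable_funTS; exact: (measurableT_comp mh measurable_snd).
have qh0 r w : 0 <= r -> 0 <= soft_kill r w * h w.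
  by move=> r0; rewrite mulr_ge0//; case/andP: (soft_kill_bound w r0).
have -> : (\int[mu]_(r in `[0%R, s]) \int[P]_w (soft_kill r w * h w)%:E =
    \int[P]_w \int[mu]_(r in `[0%R, s]) (soft_kill r w * h w)%:E)%E.
  apply: (@ge0_fubini_in _ _ _ _ _ mu P `[0, s]%classic setT
    (fun p => (soft_kill p.1 p.2 * h p.2)%:E)) => //.
    exact/measurable_EFinP.
  by move=> r w; rewrite /= in_itv/= => /andP[r0 _] _; rewrite lee_fin qh0.
apply: eq_integral => w _; under eq_integral do rewrite mulrC.
rewrite ge0_integralZl_real//.
- by rewrite soft_discount_FTC// -EFinM mulrC.
- apply: (measurable_comp _ _ (@measurable_soft_kill s) (g := fun r => (r, w))).
  + exact: measurableX.
  + by move=> _ [r rs <-].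
  + by apply: measurable_funTS; exact: pair2_measurable.
- by move=> r; rewrite /= in_itv/= => /andP[r0 _]; case/andP: (soft_kill_bound w r0).
Qed.

Let U s w := hexp_rate (H - s) (Z s w).
Let D s w := hexp (H - s) (Z s w).

Let U0 s w : 0 <= U s w. Proof. exact: hexp_rate_ge0. Qed.
Let D0 s w : 0 <= D s w. Proof. exact: hexp_ge0. Qed.

Let mU : measurable_fun (`[0, H] `*` [set: T]) (fun p : R * T => U p.1 p.2).
Proof.
apply: measurable_fun_hexp_rate; last exact: (measurable_process HZ).
by apply: measurable_funTS; apply: measurable_funB => //; exact: measurable_fst.
Qed.

Let mD : measurable_fun (`[0, H] `*` [set: T]) (fun p : R * T => D p.1 p.2).
Proof.
apply: measurable_fun_hexp; last exact: (measurable_process HZ).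
by apply: measurable_funTS; apply: measurable_funB => //; exact: measurable_fst.
Qed.

Let mDs s : 0 <= s -> measurable_fun [set: T] (D s).
Proof. by move=> s0; exact: (measurableT_comp (@measurable_hexp R del n v _ setT) (mZ s0)). Qed.

Let mUs s : 0 <= s -> measurable_fun [set: T] (U s).
Proof. by move=> s0; exact: (measurableT_comp (@measurable_hexp_rate R del n v _ setT) (mZ s0)). Qed.

Let mint (f : R -> T -> R) : measurable_fun (`[0, H] `*` [set: T]) (fun p : R * T => f p.1 p.2) ->
  (forall s w, 0 <= s <= H -> 0 <= f s w) ->
  measurable_fun (`[0, H] : set R) (fun s => \int[P]_w (f s w)%:E)%E.
Proof.
move=> mf f0; apply: (@measurable_fun_integral_in _ _ R T R P `[0, H] setT
  (fun s w => (f s w)%:E)) => //; first exact/measurable_EFinP.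
by move=> s w; rewrite /= in_itv/= => sH _; rewrite lee_fin f0.
Qed.

(** For [y = Z s w > 0], [y * U = k * D] gives [(y + e) * U = k * D + e * U]. At [y = 0] the
    identity survives because [D] vanishes and [e / (y + e)] is [1]. *)
Let soft_rate_split s w : 0 <= s ->
  U s w = soft_rate (Z s w) * D s w + e / (Z s w + e) * U s w.
Proof.
move=> s0; have y0 := Z_ge0 w s0; rewrite /U /D /soft_rate.
move: (Z s w) (H - s) y0 => y t y0; rewrite /hexp_rate /hexp.
have ye : 0 < y + e by rewrite ltr_wpDl.
have [->|yn0] := eqVneq y 0.
  rewrite [0 `^ n]powR0 ?(gt_eqF n0)// mul0r !mulr0 !add0r divff ?(gt_eqF e0)//.
  by rewrite [RHS]mul1r.
have yp : 0 < y by rewrite lt_neqAle eq_sym yn0.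
rewrite (powR_mulB1 n yp); field.
by rewrite gt_eqF.
Qed.

Let K r s := (\int[P]_w (soft_kill r w * U s w)%:E)%E.

Let kill0 r w : 0 <= r -> 0 <= soft_kill r w.
Proof. by move=> r0; case/andP: (soft_kill_bound w r0). Qed.

Let K0 r s : 0 <= r <= H -> 0 <= s <= H -> (0 <= K r s)%E.
Proof.
by move=> /andP[r0 _] _; apply: integral_ge0 => w _; rewrite lee_fin mulr_ge0 ?kill0.
Qed.

Let mK : measurable_fun ((`[0, H] : set R) `*` (`[0, H] : set R)) (fun p => K p.1 p.2).
Proof.
have mHH : measurable ((`[0, H] : set R) `*` (`[0, H] : set R)) by exact: measurableX.
have mHT : measurable ((`[0, H] : set R) `*` [set: T]) by exact: measurableX.
apply: (@measurable_fun_integral_in _ _ (R * R)%type T R P _ setT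
  (fun p w => (soft_kill p.1 w * U p.2 w)%:E)) => //.
  apply/measurable_EFinP; apply: measurable_funM.
    apply: (measurable_comp mHT _ (@measurable_soft_kill H) (g := fun p => (p.1.1, p.2))).
      by move=> _ [[[r s] w] /= [[rH sH] _] <-].
    apply: measurable_funTS; apply/measurable_fun_pairP; split => /=.
      exact: (measurableT_comp measurable_fst measurable_fst).
    exact: measurable_snd.
  apply: (measurable_comp mHT _ mU (g := fun p => (p.1.2, p.2))).
    by move=> _ [[[r s] w] /= [[rH sH] _] <-].
  apply: measurable_funTS; apply/measurable_fun_pairP; split => /=.
    exact: (measurableT_comp measurable_snd measurable_fst).
  exact: measurable_snd.
move=> [r s] w /= [rH sH] _; rewrite lee_fin mulr_ge0 ?kill0//.
by move: rH; rewrite /= in_itv/= => /andP[].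
Qed.

(** The expectation [L] without killing is computed twice. Splitting [1] into the discount and the
    integral of [soft_kill], with Dynkin from each killing time [r], gives [A + (X + TT)]; Dynkin
    from time [0], with the rate split by [soft_rate_split], gives [B + (X + Y + TT)]. The common
    part cancels and leaves [A = B + Y]. *)
Lemma discounted_hexp :
  (\int[P]_w (soft_discount H w * hexp 0 (Z H w))%:E =
   \int[P]_w (hexp H (Z 0 w))%:E +
   \int[mu]_(s in `[0%R, H]) \int[P]_w
     (soft_discount s w * (e / (Z s w + e) * hexp_rate (H - s) (Z s w)))%:E)%E.
Proof.
have H0' := ltW H0.
have mds s : 0 <= s -> measurable_fun [set: T] (soft_discount s).
  by move=> s0; apply: (past_measurable_fun HZ); exact: past_measurable_soft_discount.
have mqs s : 0 <= s -> measurable_fun [set: T] (soft_kill s).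
  by move=> s0; apply: (past_measurable_fun HZ); exact: past_measurable_soft_kill.
have d0 s w := ltW (soft_discount_gt0 s w).
have d1 s w : 0 <= s -> 0 <= 1 - soft_discount s w.
  by move=> s0; rewrite subr_ge0 soft_discount_le1.
have mDH : measurable_fun [set: T] (fun w => hexp 0 (Z H w)).
  exact: (measurableT_comp (@measurable_hexp R del n v _ setT) (mZ H0')).
have DH0 w : 0 <= hexp 0 (Z H w) by exact: hexp_ge0.
have Ze s w : 0 <= s -> 0 <= e / (Z s w + e).
  by move=> s0; rewrite divr_ge0 ?addr_ge0 ?Z_ge0// ltW.
pose L := (\int[P]_w (hexp 0 (Z H w))%:E)%E.
pose X := (\int[mu]_(r in `[0%R, H]) \int[P]_w (soft_kill r w * D r w)%:E)%E.
pose Y := (\int[mu]_(s in `[0%R, H]) \int[P]_w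
  (soft_discount s w * (e / (Z s w + e) * U s w))%:E)%E.
pose TT := (\int[mu]_(r in `[0%R, H]) \int[mu]_(s in `[r, H]) K r s)%E.
pose A := (\int[P]_w (soft_discount H w * hexp 0 (Z H w))%:E)%E.
pose B := (\int[P]_w (D 0 w)%:E)%E.
have X0 : (0 <= X)%E.
  apply: integral_ge0 => r; rewrite /= in_itv/= => /andP[r0 _]; apply: integral_ge0 => w _.
  by rewrite lee_fin mulr_ge0 ?kill0.
have Y0 : (0 <= Y)%E.
  apply: integral_ge0 => r; rewrite /= in_itv/= => /andP[r0 _]; apply: integral_ge0 => w _.
  by rewrite lee_fin mulr_ge0// mulr_ge0// Ze.
have TT0 : (0 <= TT)%E.
  apply: integral_ge0 => r; rewrite /= in_itv/= => /andP[r0 rH]; apply: integral_ge0 => s.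
  rewrite /= in_itv/= => /andP[rs sH]; apply: K0; first by rewrite r0.
  by rewrite sH (le_trans r0).
have A0 : (0 <= A)%E by apply: integral_ge0 => w _; rewrite lee_fin mulr_ge0.
have LA : L = (A + (X + TT))%E.
  have -> : (X + TT = \int[mu]_(r in `[0%R, H]) \int[P]_w (soft_kill r w * hexp 0 (Z H w))%:E)%E.
    apply: ge0_integralD_in.
    - exact: measurable_itv.
    - apply: mint; last by move=> r w /andP[r0 _]; rewrite mulr_ge0 ?kill0.
      by apply: measurable_funM => //; exact: measurable_soft_kill.
    - exact: measurable_fun_triangle.
    - move=> r; rewrite /= in_itv/= => /andP[r0 _]; apply: integral_ge0 => w _.
      by rewrite lee_fin mulr_ge0 ?kill0.
    - move=> r; rewrite /= in_itv/= => /andP[r0 rH]; apply: integral_ge0 => s.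
      rewrite /= in_itv/= => /andP[rs sH]; apply: K0; first by rewrite r0.
      by rewrite sH (le_trans r0).
    move=> r; rewrite /= in_itv/= => /andP[r0 rH].
    have [rH'|Hr] := ltP r H.
      have h := @hexp_dynkin _ _ _ _ _ _ _ _ _ del0 n0 n1 v0 HZ H r (k / e) (soft_kill r)
        (introT andP (conj r0 rH')) (past_measurable_soft_kill r0) (fun w => soft_kill_bound w r0).
      by under [RHS]eq_integral do rewrite EFinM; rewrite h.
    (* [hexp_dynkin] requires [r < H]; at [r = H] the time integral runs over a single point. *)
    have -> : r = H by apply/le_anti; rewrite rH.
    by rewrite set_itv1 integral_set1 adde0 /D subrr.
  rewrite integral_soft_kill//.
  apply/esym; apply: ge0_integralD_in => //.
  - by apply/measurable_EFinP; apply: measurable_funM => //; exact: mds.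
  - apply/measurable_EFinP; apply: measurable_funM => //.
    by apply: measurable_funB => //; exact: mds.
  - by move=> w _; rewrite lee_fin mulr_ge0.
  - by move=> w _; rewrite lee_fin mulr_ge0 ?d1.
  - by move=> w _; rewrite -EFinD; congr _%:E; ring.
(* Exchanging the order collects the killing times [r <= s], of total mass [1 - soft_discount s]. *)
have TTE : TT = (\int[mu]_(s in `[0%R, H]) \int[P]_w ((1 - soft_discount s w) * U s w)%:E)%E.
  rewrite /TT -fubini_triangle//; apply: eq_integral => s.
  rewrite inE/= in_itv/= => /andP[s0 sH]; apply: integral_soft_kill => //; exact: mUs.
have mE : measurable_fun (`[0, H] `*` [set: T]) (fun p : R * T => e / (Z p.1 p.2 + e)).
  apply: measurable_funM => //; apply: measurable_fun_invr; apply: measurable_funD => //.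
  exact: (measurable_process HZ).
have mdj := @measurable_soft_discount H.
have mEU : measurable_fun (`[0, H] `*` [set: T])
    (fun p : R * T => soft_discount p.1 p.2 * (e / (Z p.1 p.2 + e) * U p.1 p.2)).
  by apply: measurable_funM => //; exact: measurable_funM.
have LB : L = (B + (X + Y + TT))%E.
  have h := @hexp_dynkin _ _ _ _ _ _ _ _ _ del0 n0 n1 v0 HZ H 0 1 (cst 1)
    (introT andP (conj (lexx 0) H0)) (measurable_cst _) (fun w => introT andP (conj ler01 (lexx 1))).
  have -> : L = (B + \int[mu]_(s in `[0%R, H]) \int[P]_w (U s w)%:E)%E.
    have one f : (\int[P]_w ((cst 1 w : R)%:E * (f w)%:E) = \int[P]_w (f w)%:E)%E.
      by apply: eq_integral => w _; rewrite mul1e.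
    have -> : L = (\int[P]_w ((cst 1 w : R)%:E * (hexp 0 (Z H w))%:E))%E by rewrite one.
    rewrite h one; congr (_ + _)%E; apply: eq_integral => s _; exact: one.
  congr (_ + _)%E; rewrite TTE.
  have mX : measurable_fun (`[0, H] : set R) (fun r => \int[P]_w (soft_kill r w * D r w)%:E)%E.
    apply: mint; last by move=> r w /andP[r0 _]; rewrite mulr_ge0 ?kill0.
    by apply: measurable_funM => //; exact: measurable_soft_kill.
  have mY : measurable_fun (`[0, H] : set R)
      (fun s => \int[P]_w (soft_discount s w * (e / (Z s w + e) * U s w))%:E)%E.
    by apply: mint => // r w /andP[r0 _]; rewrite mulr_ge0// mulr_ge0// Ze.
  have X0' r : `[0, H]%classic r -> (0 <= \int[P]_w (soft_kill r w * D r w)%:E)%E.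
    rewrite /= in_itv/= => /andP[r0 _]; apply: integral_ge0 => w _.
    by rewrite lee_fin mulr_ge0 ?kill0.
  have Y0' s : `[0, H]%classic s ->
      (0 <= \int[P]_w (soft_discount s w * (e / (Z s w + e) * U s w))%:E)%E.
    rewrite /= in_itv/= => /andP[r0 _]; apply: integral_ge0 => w _.
    by rewrite lee_fin mulr_ge0// mulr_ge0// Ze.
  have -> : (X + Y = \int[mu]_(s in `[0%R, H]) (\int[P]_w (soft_kill s w * D s w)%:E +
      \int[P]_w (soft_discount s w * (e / (Z s w + e) * U s w))%:E))%E.
    rewrite /X /Y; apply: ge0_integralD_in; [exact: measurable_itv|exact: mX|exact: mY|
      exact: X0'|exact: Y0'|by []].
  apply/esym; apply: ge0_integralD_in.
  - exact: measurable_itv.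
  - exact: emeasurable_funD.
  - apply: mint; last by move=> r w /andP[r0 _]; rewrite mulr_ge0// d1.
    by apply: measurable_funM => //; exact: measurable_funB.
  - by move=> r rH; rewrite adde_ge0 ?X0' ?Y0'.
  - move=> r; rewrite /= in_itv/= => /andP[r0 _]; apply: integral_ge0 => w _.
    by rewrite lee_fin mulr_ge0// d1.
  move=> s; rewrite /= in_itv/= => /andP[s0 sH].
  have mqD : measurable_fun [set: T] (fun w => (soft_kill s w * D s w)%:E).
    by apply/measurable_EFinP; apply: measurable_funM; [exact: mqs|exact: mDs].
  have meU : measurable_fun [set: T]
      (fun w => (soft_discount s w * (e / (Z s w + e) * U s w))%:E).
    apply/measurable_EFinP; apply: measurable_funM; first exact: mds.
    apply: measurable_funM; last exact: mUs.
    apply: measurable_funM => //; apply: measurable_fun_invr.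
    by apply: measurable_funD => //; exact: mZ.
  have qD0 w : [set: T] w -> (0 <= (soft_kill s w * D s w)%:E)%E.
    by move=> _; rewrite lee_fin mulr_ge0 ?kill0.
  have eU0 w : [set: T] w -> (0 <= (soft_discount s w * (e / (Z s w + e) * U s w))%:E)%E.
    by move=> _; rewrite lee_fin mulr_ge0// mulr_ge0// Ze.
  have -> : (\int[P]_w (soft_kill s w * D s w)%:E +
      \int[P]_w (soft_discount s w * (e / (Z s w + e) * U s w))%:E =
      \int[P]_w ((soft_kill s w * D s w)%:E + (soft_discount s w * (e / (Z s w + e) * U s w))%:E))%E.
    by apply: ge0_integralD_in; [exact: measurableT|exact: mqD|exact: meU|exact: qD0|exact: eU0|].
  apply: ge0_integralD_in.
  - exact: measurableT.
  - exact: emeasurable_funD.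
  - apply/measurable_EFinP; apply: measurable_funM; last exact: mUs.
    by apply: measurable_funB => //; exact: mds.
  - by move=> w _; rewrite adde_ge0 ?qD0 ?eU0.
  - by move=> w _; rewrite lee_fin mulr_ge0// d1.
  move=> w _; rewrite -!EFinD; congr _%:E.
  rewrite /soft_kill; move: (soft_rate_split w s0).
  move: (soft_rate _) (soft_discount s w) (e / _) (U s w) (D s w) => a b c u q uE.
  by transitivity (u + b * (a * q + c * u - u)); [ring|rewrite -uE subrr mulr0 addr0].
(* All terms are nonnegative, so finiteness of [L] bounds [X + TT], which may then be subtracted. *)
have Lfin : L \is a fin_num.
  have [C C0 hC] := hexp_bounded del0 n0 v0 H0'.
  rewrite ge0_fin_numE; last by apply: integral_ge0 => w _; rewrite lee_fin.
  apply: (@le_lt_trans _ _ (\int[P]_w (cst C%:E w))%E).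
    apply: ge0_le_integral => //; first by move=> w _; rewrite lee_fin.
    - exact/measurable_EFinP.
    - by move=> w _; rewrite lee_fin hC// ?lexx ?Z_ge0// H0'.
  by rewrite integral_cst//= [P _]probability_setT mule1 ltry.
have <- : B = (\int[P]_w (hexp H (Z 0 w))%:E)%E.
  by apply: eq_integral => w _; rewrite /D subr0.
rewrite -/A -/B -/Y.
clear TTE; clearbody A B X Y TT L.
have XT0 : (0 <= X + TT)%E by exact: adde_ge0.
have XT : (X + TT)%E \is a fin_num.
  rewrite (ge0_fin_numE XT0).
  have XTL : (X + TT <= L)%E by rewrite LA leeDr.
  by apply: (le_lt_trans XTL); rewrite -ge0_fin_numE// LA adde_ge0.
have : (A + (X + TT) = B + Y + (X + TT))%E by rewrite -LA LB (addeC X Y) -!addeA.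
by move=> /(congr1 (fun z => z - (X + TT))%E); rewrite /= (addeK _ XT) (addeK _ XT).
Qed.

End discounted.

(** * Removing the truncation *)

(** The limit [l] may be [+oo]; then [expeR (- l)] is [0], in accordance with the convention
    [exp (- oo) = 0]. *)
Lemma cvg_expeRN (R : realType) (u : R ^nat) (l : \bar R) : (forall m, 0 <= u m) ->
  (u m)%:E @[m --> \oo] --> l -> (expR (- u m))%:E @[m --> \oo] --> expeR (- l)%E.
Proof.
move=> u0; case: l => [l| |].
- move=> /fine_cvgP[_ ul]; apply: cvg_EFin; first by near=> m.
  have uN : - u m @[m --> \oo] --> - l by apply: cvgN; exact: ul.
  exact: (@cvg_comp _ _ _ (fun m => - u m) expR _ _ _ uN (@continuous_expR R _)).
- move=> /cvgeryP uy; rewrite /= -/(0%E).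
  have h : expR (- u m) @[m --> \oo] --> 0.
    exact: (@cvg_comp _ _ _ u (fun x => expR (- x)) _ _ _ uy (@cvgr_expR R)).
  by apply: cvg_EFin; [near=> m|exact: h].
- move=> uNy; have : (0 <= (-oo : \bar R))%E.
    apply: (cvge_to_ge uNy); near=> m; rewrite lee_fin; exact: u0.
  by rewrite leNgt ltNye.
Unshelve. all: by end_near. Qed.

Lemma cvg_inve_shift (R : realType) (y : R) : 0 <= y ->
  ((y + m.+1%:R^-1)^-1)%:E @[m --> \oo] --> (y%:E)^-1%E.
Proof.
move=> y0; rewrite inver; case: eqP => [->|/eqP yN0].
  apply/cvgeryP; apply: (@cvg_trans _ (m.+1%:R @[m --> \oo] : set_system R)).
    by apply: near_eq_cvg; near=> m; rewrite add0r invrK.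
  have h := @cvgr_idn R; rewrite -cvg_shiftS in h; exact: h.
apply: cvg_EFin; first by near=> m.
apply: cvgV => //; rewrite -[X in _ --> X]addr0; apply: cvgD; first exact: cvg_cst.
exact: cvg_harmonic.
Unshelve. all: by end_near. Qed.

Section hard_discount.
Variables (R : realType) (f : R -> R) (k H : R).
Hypotheses (k0 : 0 <= k) (H0 : 0 <= H).
Hypothesis cf : {within `[0, +oo[, continuous f}.
Hypothesis f0 : forall s, 0 <= s -> 0 <= f s.

Local Notation mu := (@lebesgue_measure R).

Let cfe (c e : R) : 0 < e -> {within `[0, +oo[, continuous (fun s => c / (f s + e))}.
Proof.
move=> e0; apply/subspace_continuousP => s; rewrite /= in_itv/= andbT => s0.
have fe : f s + e != 0 by rewrite gt_eqF// ltr_wpDl// f0.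
have h : f t @[t --> within `[0, +oo[ (nbhs s)] --> f s.
  by move/subspace_continuousP : cf => /(_ s); rewrite /= in_itv/= andbT; apply.
apply: (@cvg_comp _ _ _ f (fun y => c / (y + e)) _ _ _ h).
apply: cvgMl_tmp; apply: cvgV; first exact: fe.
by apply: cvgD; [exact: cvg_id|exact: cvg_cst].
Qed.

Let mfe (c e : R) : 0 < e -> measurable_fun `[0, H] (fun s => c / (f s + e)).
Proof.
move=> e0; have h : {within `[0, H], continuous (fun s => c / (f s + e))}.
  by apply: continuous_subspaceW (@cfe c e e0) => x; rewrite /= !in_itv/= andbT => /andP[].
exact: (subspace_continuous_measurable_fun (measurable_itv _) h).
Qed.

Let integral_rate (e : R) : 0 < e ->
  ((\int[mu]_(s in `[0, H]) (k / (f s + e)))%:E =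
   k%:E * \int[mu]_(s in `[0%R, H]) ((f s + e)^-1)%:E)%E.
Proof.
move=> e0; have /integrable_fin_num fin := within_integrable (@cfe k e e0) H.
rewrite /Rintegral fineK; last exact: fin.
rewrite -ge0_integralZl_real//.
  by have := @mfe 1 e e0; apply: eq_measurable_fun => s _; rewrite div1r.
by move=> s; rewrite /= in_itv/= => /andP[s0 _]; rewrite invr_ge0 addr_ge0 ?f0// ltW.
Qed.

(** The rates increase as the truncation [1 / (m + 1)] decreases, so monotone convergence applies
    even when the limiting integral is infinite; at zeros of [f] the rate [1 / 0] is [+oo]. *)
Lemma cvg_discount :
  (discount (fun s => k / (f s + m.+1%:R^-1)) H)%:E @[m --> \oo] -->
  expeR (- (k%:E * \int[mu]_(s in `[0%R, H]) ((f s)%:E)^-1))%E.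
Proof.
apply: cvg_expeRN => [m|].
  apply: Rintegral_ge0 => s; rewrite /= in_itv/= => /andP[s0 _].
  by rewrite divr_ge0// addr_ge0 ?f0.
rewrite (_ : (fun m => _) = fun m : nat =>
    (k%:E * \int[mu]_(s in `[0%R, H]) ((f s + m.+1%:R^-1)^-1)%:E)%E); last first.
  by apply/funext => m; rewrite integral_rate.
apply: cvgeZl => //.
rewrite (_ : (\int[mu]_(s in _) _)%E =
    (\int[mu]_(s in `[0%R, H]) limn (fun m => ((f s + m.+1%:R^-1)^-1)%:E))%E); last first.
  apply: eq_integral => s; rewrite inE/= in_itv/= => /andP[s0 _].
  by apply/esym/cvg_lim => //; apply: cvg_inve_shift; exact: f0.
apply: cvg_monotone_convergence => //.
- move=> m; apply/measurable_EFinP; have := @mfe 1 (m.+1%:R^-1).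
  by rewrite invr_gt0 => /(_ (ltr0Sn _ _)); apply: eq_measurable_fun => s _; rewrite div1r.
- move=> m s; rewrite /= in_itv/= => /andP[s0 _].
  by rewrite lee_fin invr_ge0 addr_ge0 ?f0.
- move=> s; rewrite /= in_itv/= => /andP[s0 _] i j ij.
  have pos (m : nat) : 0 < f s + m.+1%:R^-1 by rewrite ltr_wpDl ?f0// invr_gt0.
  rewrite lee_fin lef_pV2 ?posrE//; apply: lerD => //.
  by rewrite lef_pV2 ?posrE// ler_nat.
Qed.

End hard_discount.

Lemma dominated_cvg_ae (d : measure_display) (T : measurableType d) (R : realType)
    (m : {measure set T -> \bar R}) (D : set T) : measurable D ->
  forall (f_ : (T -> \bar R)^nat) (f g : T -> \bar R),
  (forall i, measurable_fun D (f_ i)) -> measurable_fun D f ->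
  {ae m, forall x, D x -> f_ ^~ x @ \oo --> f x} -> m.-integrable D g ->
  {ae m, forall x i, D x -> (`|f_ i x| <= g x)%E} ->
  (\int[m]_(x in D) f_ i x)%E @[i --> \oo] --> (\int[m]_(x in D) f x)%E.
Proof. by move=> mD f_ f g mf_ mf ff ig fg; have [] := dominated_convergence mD mf_ mf ff ig fg. Qed.

Section killed.
Variable R : realType.
Context (d : measure_display) (T : measurableType d) (P : probability T R).
Variables (Z : R -> T -> R) (del z0 n : R).
Hypotheses (del0 : 0 < del) (n0 : 0 < n) (n1 : 0 < n + del / 2 - 1).
Hypothesis HZ : is_squared_bessel P del z0 Z.

Local Notation mu := (@lebesgue_measure R).
Local Notation k := (2 * n * (n + del / 2 - 1)).
Local Notation eps m := (m.+1%:R^-1 : R).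

Let mZ t : 0 <= t -> measurable_fun [set: T] (Z t). Proof. by case: HZ => + _ _ _ _; apply. Qed.
Let Z_ge0 t w : 0 <= t -> 0 <= Z t w. Proof. by case: HZ => _ + _ _ _; apply. Qed.
Let cZ w : {within `[0, +oo[, continuous (fun t => Z t w)}. Proof. by case: HZ. Qed.

Let k0 : 0 <= k. Proof. exact: hexp_rate_coef_ge0. Qed.

Let eps0 (m : nat) : 0 < eps m. Proof. by rewrite invr_gt0. Qed.

Definition killed (H : R) (w : T) : \bar R :=
  expeR (- (k%:E * \int[mu]_(s in `[0%R, H]) ((Z s w)%:E)^-1))%E.

Lemma cvg_soft_discount H w : 0 <= H ->
  (soft_discount Z del n (eps m) H w)%:E @[m --> \oo] --> killed H w.
Proof. by move=> H0; apply: cvg_discount => // s; exact: Z_ge0. Qed.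

Lemma killed_ge0 H w : (0 <= killed H w)%E. Proof. exact: expeR_ge0. Qed.

Let mdisc m H : 0 <= H -> measurable_fun [set: T] (fun w => (soft_discount Z del n (eps m) H w)%:E).
Proof.
move=> H0; apply/measurable_EFinP; apply: (past_measurable_fun HZ).
exact: (past_measurable_soft_discount n0 n1 (eps0 m) HZ H0).
Qed.

Lemma measurable_killed H : 0 <= H -> measurable_fun [set: T] (killed H).
Proof.
move=> H0; apply: (@emeasurable_fun_cvg _ _ _ _
  (fun m w => (soft_discount Z del n (eps m) H w)%:E)) => [m|w _]; first exact: mdisc.
exact: cvg_soft_discount.
Qed.

(** [besq_transition] only charges []0, +oo[], so [[set 0]] has mass [0] at each fixed positive
    time, even when the paths do visit [0]. *)
Lemma squared_bessel_neq0 s : 0 < s -> {ae P, forall w, Z s w != 0}.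
Proof.
move=> s0; exists (Z s @^-1` [set 0]); split.
- rewrite -[X in measurable X]setTI; apply: (mZ (ltW s0)) => //.
- have ss : 0 <= (0 : R) < s by rewrite lexx.
  have [_ _ _ _ /(_ 0 s setT [set 0] ss)] := HZ; rewrite setTI => -> //.
    rewrite integral0_eq// => w _; rewrite /besq_transition.
    rewrite (_ : _ `&` _ = set0) ?integral_set0//.
    by apply/seteqP; split => // y [/= ->]; rewrite /= in_itv/= ltxx.
  exact: (@measurableT _ (g_sigma_algebraType (past_events Z 0))).
- by move=> w /= /negP; rewrite negbK => /eqP.
Qed.

Variables (v H : R).
Hypotheses (v0 : 0 < v) (H0 : 0 < H).

Local Notation hexp := (hexp del n v).
Local Notation hexp_rate := (hexp_rate del n v).

Let U s w := hexp_rate (H - s) (Z s w).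
(** The error integrand of [discounted_hexp] at truncation [1 / (m + 1)]. *)
Let E m s w := soft_discount Z del n (eps m) s w * (eps m / (Z s w + eps m) * U s w).

Let U0 s w : 0 <= U s w. Proof. exact: hexp_rate_ge0. Qed.

Let E0 m s w : 0 <= s -> 0 <= E m s w <= U s w.
Proof.
move=> s0; have d0 := ltW (soft_discount_gt0 Z del n (eps m) s w).
have d1 := soft_discount_le1 n0 n1 (eps0 m) HZ w s0.
have ze : 0 < Z s w + eps m by rewrite ltr_wpDl ?Z_ge0.
have e0 : 0 <= eps m / (Z s w + eps m) by rewrite divr_ge0// ltW.
have e1 : eps m / (Z s w + eps m) <= 1 by rewrite ler_pdivrMr// mul1r lerDr Z_ge0.
have eU0 : 0 <= eps m / (Z s w + eps m) * U s w by exact: mulr_ge0.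
apply/andP; split; first exact: mulr_ge0.
apply: (le_trans (ler_piMl eU0 d1)); exact: ler_piMl.
Qed.

Let cvgE s w : 0 <= s -> Z s w != 0 -> E m s w @[m --> \oo] --> 0.
Proof.
move=> s0 zn0; have zp : 0 < Z s w by rewrite lt_neqAle eq_sym zn0 Z_ge0.
apply: (@squeeze_cvgr _ _ _ _ (cst 0) (fun m => eps m * (U s w / Z s w))).
- near=> m; have /andP[-> _] /= := E0 m w s0.
  have ze : 0 < Z s w + eps m by rewrite ltr_wpDl ?Z_ge0.
  have eU0 : 0 <= eps m / (Z s w + eps m) * U s w.
    by apply: mulr_ge0 => //; rewrite divr_ge0// ltW.
  apply: (le_trans (ler_piMl eU0 (soft_discount_le1 n0 n1 (eps0 m) HZ w s0))).
  rewrite -mulrA; apply: ler_wpM2l; first exact: ltW.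
  rewrite mulrC; apply: ler_wpM2l; first exact: U0.
  by rewrite lef_pV2 ?posrE// lerDl ltW.
- exact: cvg_cst.
- rewrite -[X in _ --> X](mul0r (U s w / Z s w)); apply: cvgMr_tmp.
  exact: cvg_harmonic.
Unshelve. all: by end_near. Qed.

Let mU : measurable_fun (`[0, H] `*` [set: T]) (fun p : R * T => U p.1 p.2).
Proof.
apply: measurable_fun_hexp_rate; last exact: (measurable_process HZ).
by apply: measurable_funTS; apply: measurable_funB => //; exact: measurable_fst.
Qed.

Let mE m : measurable_fun (`[0, H] `*` [set: T]) (fun p : R * T => E m p.1 p.2).
Proof.
apply: measurable_funM; first exact: (measurable_soft_discount n0 n1 (eps0 m) HZ).
apply: measurable_funM => //; apply: measurable_funM => //.
apply: measurable_fun_invr; apply: measurable_funD => //.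
exact: (measurable_process HZ).
Qed.

Let mint (f : R -> T -> R) : measurable_fun (`[0, H] `*` [set: T]) (fun p : R * T => f p.1 p.2) ->
  (forall s w, 0 <= s <= H -> 0 <= f s w) ->
  measurable_fun (`[0, H] : set R) (fun s => \int[P]_w (f s w)%:E)%E.
Proof.
move=> mf f0; apply: (@measurable_fun_integral_in _ _ R T R P `[0, H] setT
  (fun s w => (f s w)%:E)) => //; first exact/measurable_EFinP.
by move=> s w; rewrite /= in_itv/= => sH _; rewrite lee_fin f0.
Qed.

Let section (f : R -> T -> R) s : 0 <= s <= H ->
  measurable_fun (`[0, H] `*` [set: T]) (fun p : R * T => f p.1 p.2) ->
  measurable_fun [set: T] (f s).
Proof.
move=> sH mf; apply: (measurable_comp _ _ mf (g := fun w => (s, w))).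
- exact: measurableX.
- by move=> _ [w _ <-]; split => //=; rewrite in_itv.
- exact: pair1_measurable.
Qed.

Let cvg_inner s : 0 < s <= H -> (\int[P]_w (U s w)%:E < +oo)%E ->
  (\int[P]_w (E m s w)%:E)%E @[m --> \oo] --> 0%E.
Proof.
move=> /andP[s0 sH] Uy; have s0' := ltW s0.
have sH' : 0 <= s <= H by rewrite s0'.
rewrite -(@integral0 _ _ _ P setT).
have mUs := section sH' mU.
apply: (@dominated_cvg_ae _ _ _ P setT measurableT (fun m w => (E m s w)%:E) _
  (fun w => (U s w)%:E)) => //.
- by move=> m; apply/measurable_EFinP; exact: (section sH' (mE m)).
- apply: filterS (squared_bessel_neq0 s0) => w zn0 _.
  by apply: cvg_EFin; [near=> m|exact: cvgE].
- apply/integrableP; split; first exact/measurable_EFinP.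
  by under eq_integral do rewrite gee0_abs ?lee_fin//.
- apply: aeW => w m _; have /andP[a b] := E0 m w s0'.
  by rewrite gee0_abs lee_fin.
Unshelve. all: by end_near. Qed.

Let L := (\int[P]_w (hexp 0 (Z H w))%:E)%E.

Let Lfin : (L < +oo)%E.
Proof.
have H0' := ltW H0.
have [C C0 hC] := hexp_bounded del0 n0 v0 H0'.
apply: (@le_lt_trans _ _ (\int[P]_w (cst C%:E w))%E).
  apply: ge0_le_integral => //; first by move=> w _; rewrite lee_fin hexp_ge0.
  - apply/measurable_EFinP.
    exact: (measurableT_comp (@measurable_hexp R del n v _ setT) (mZ H0')).
  - by move=> w _; rewrite lee_fin hC// ?lexx ?Z_ge0// H0'.
by rewrite integral_cst//= [P _]probability_setT mule1 ltry.
Qed.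

(** The Dynkin formula from time [0] with weight [1] bounds this integral by [L]. It supplies the
    dominating function for the error term. *)
Let integrable_rate : mu.-integrable `[0, H] (fun s => \int[P]_w (U s w)%:E)%E.
Proof.
apply/integrableP; split; first by apply: mint.
have I0 s : (0 <= \int[P]_w (U s w)%:E)%E by apply: integral_ge0 => w _; rewrite lee_fin.
under eq_integral do rewrite gee0_abs//.
have h := @hexp_dynkin _ _ _ _ _ _ _ _ _ del0 n0 n1 v0 HZ H 0 1 (cst 1)
  (introT andP (conj (lexx 0) H0)) (measurable_cst _) (fun w => introT andP (conj ler01 (lexx 1))).
have one f : (\int[P]_w ((cst 1 w : R)%:E * (f w)%:E) = \int[P]_w (f w)%:E)%E.
  by apply: eq_integral => w _; rewrite mul1e.
rewrite !one in h; apply: le_lt_trans Lfin; rewrite /L h.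
have -> : (\int[mu]_(s in `[0%R, H]) \int[P]_w ((cst 1 w : R)%:E * (hexp_rate (H - s) (Z s w))%:E) =
    \int[mu]_(s in `[0%R, H]) \int[P]_w (U s w)%:E)%E by apply: eq_integral => s _; exact: one.
by apply: leeDr; apply: integral_ge0 => w _; rewrite lee_fin hexp_ge0.
Qed.

(** Dominated convergence in the path, then in time, both against the untruncated [U]. Time [0] is
    discarded as a null set, since the process may start at [0], and integrability makes the inner
    expectation of [U] finite for almost every [s]. *)
Let cvg_error :
  (\int[mu]_(s in `[0%R, H]) \int[P]_w (E m s w)%:E)%E @[m --> \oo] --> 0%E.
Proof.
rewrite -(@integral0 _ _ _ mu `[0, H]%classic).
apply: (@dominated_cvg_ae _ _ _ mu `[0, H]%classic (measurable_itv _)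
  (fun m s => \int[P]_w (E m s w)%:E)%E _ (fun s => \int[P]_w (U s w)%:E)%E) => //.
- move=> m; apply: (mint (mE m)).
  by move=> s w /andP[s0 _]; have /andP[] := E0 m w s0.
- have mH : measurable (`[0, H]%classic : set (measurableTypeR R)) by exact: measurable_itv.
  have h1 := integrable_ae mH integrable_rate.
  have h2 : {ae mu, forall s : R, s != 0}.
    exists [set 0]; split; [exact: measurable_set1|exact: lebesgue_measure_set1|].
    by move=> s /= /negP; rewrite negbK => /eqP.
  apply: filterS2 h1 h2 => s h1 h2 sH; have fs := h1 sH.
  move: sH; rewrite /= in_itv/= => /andP[s0 sH]; apply: cvg_inner.
    by rewrite lt_neqAle eq_sym h2 s0.
  by rewrite -ge0_fin_numE//; apply: integral_ge0 => w _; rewrite lee_fin.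
- apply: aeW => s m; rewrite /= in_itv/= => /andP[s0 sH].
  have sH' : 0 <= s <= H by rewrite s0.
  rewrite gee0_abs; last first.
    by apply: integral_ge0 => w _; rewrite lee_fin; have /andP[] := E0 m w s0.
  apply: ge0_le_integral => //.
  + by move=> w _; rewrite lee_fin; have /andP[] := E0 m w s0.
  + apply/measurable_EFinP; exact: (section sH' (mE m)).
  + by apply/measurable_EFinP; exact: section.
  + by move=> w _; rewrite lee_fin; have /andP[] := E0 m w s0.
Qed.

(** The limit of [discounted_hexp]: the discounts are at most [1], so the left side converges under
    the integrable bound [hexp 0 (Z H w)], and the error term disappears. *)
Lemma killed_hexp :
  (\int[P]_w (killed H w * (hexp 0 (Z H w))%:E) = (hexp H z0)%:E)%E.
Proof.
have H0' := ltW H0.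
have mDH : measurable_fun [set: T] (fun w => hexp 0 (Z H w)).
  exact: (measurableT_comp (@measurable_hexp R del n v _ setT) (mZ H0')).
have DH0 w : 0 <= hexp 0 (Z H w) by exact: hexp_ge0.
have mdh m : measurable_fun [set: T]
    (fun w => ((soft_discount Z del n (eps m) H w)%:E * (hexp 0 (Z H w))%:E)%E).
  by apply: emeasurable_funM; [exact: mdisc|exact/measurable_EFinP].
have l1 : (\int[P]_w ((soft_discount Z del n (eps m) H w)%:E * (hexp 0 (Z H w))%:E))%E
    @[m --> \oo] --> (\int[P]_w (killed H w * (hexp 0 (Z H w))%:E))%E.
  apply: (@dominated_cvg_ae _ _ _ P setT measurableT
    (fun m w => (soft_discount Z del n (eps m) H w)%:E * (hexp 0 (Z H w))%:E)%E _
    (fun w => (hexp 0 (Z H w))%:E)) => //.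
  - by apply: emeasurable_funM; [exact: measurable_killed|exact/measurable_EFinP].
  - by apply: aeW => w _; apply: cvgeZr => //; exact: cvg_soft_discount.
  - apply/integrableP; split; first exact/measurable_EFinP.
    under eq_integral do rewrite gee0_abs ?lee_fin//.
    exact: Lfin.
  - apply: aeW => w m _; have d0 := ltW (soft_discount_gt0 Z del n (eps m) H w).
    rewrite -EFinM gee0_abs ?lee_fin ?(mulr_ge0 d0 (DH0 w))//.
    by apply: ler_piMl => //; exact: (soft_discount_le1 n0 n1 (eps0 m) HZ w H0').
have l2 : (\int[P]_w ((soft_discount Z del n (eps m) H w)%:E * (hexp 0 (Z H w))%:E))%E
    @[m --> \oo] --> ((hexp H z0)%:E + 0)%E.
  have start : (\int[P]_w (hexp H (Z 0 w))%:E = (hexp H z0)%:E)%E.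
    transitivity (\int[P]_w (cst (hexp H z0)%:E w))%E.
      apply: ae_eq_integral => //.
        apply/measurable_EFinP.
        exact: (measurableT_comp (@measurable_hexp R del n v _ setT) (mZ (lexx 0))).
      by have [_ _ _ Z0 _] := HZ; apply: filterS Z0 => w -> _.
    by rewrite integral_cst//= [P _]probability_setT mule1.
  have -> : (fun m : nat => \int[P]_w ((soft_discount Z del n (eps m) H w)%:E *
      (hexp 0 (Z H w))%:E))%E = (fun m => (hexp H z0)%:E +
      \int[mu]_(s in `[0%R, H]) \int[P]_w (E m s w)%:E)%E.
    apply/funext => m; under eq_integral do rewrite -EFinM.
    by rewrite (discounted_hexp del0 n0 n1 v0 (eps0 m) H0 HZ) start.
  by apply: cvgeD; [|exact: cvg_cst|exact: cvg_error].
by rewrite -[RHS]adde0; apply: (cvg_unique _ l1 l2).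
Qed.

End killed.

(** * The Laplace integral of the harmonic exponentials and the decay rate *)

(** [Gamma b * (1 + v c) ^ (- b)] is the integral over [u] of [u ^ (b - 1) * exp (- (1 + v c) u)].
    After the exchange, the [v] integral is a Gamma integral of rate [c u], and a Gamma integral of
    exponent [b - n] remains in [u]. *)
Lemma integral_beta_prime (R : realType) (n b c : R) : 0 < n -> n < b -> 0 < c ->
  (\int[lebesgue_measure]_(v in `]0%R, +oo[) (v `^ (n - 1) * (1 + v * c) `^ (- b))%:E =
   (Gamma n * c `^ (- n) * Gamma (b - n) / Gamma b)%:E)%E.
Proof.
move=> n0 nb c0; have b0 : 0 < b := lt_trans n0 nb.
have bn : 0 < b - n by rewrite subr_gt0.
set mu := lebesgue_measure; have Gb := Gamma_gt0 b0; have Gb' := ltW Gb.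
set J := (X in X = _).
suff : ((Gamma b)%:E * J = (Gamma n * c `^ (- n) * Gamma (b - n))%:E)%E.
  move=> /(congr1 (fun x => (Gamma b)^-1%:E * x)%E).
  rewrite muleA -!EFinM mulVf ?(gt_eqF Gb)// mul1e => ->.
  by congr _%:E; rewrite mulrC.
pose K (p : R * R) : R := p.1 `^ (n - 1) * (p.2 `^ (b - 1) * expR (- ((1 + p.1 * c) * p.2))).
have mK : measurable_fun setT K.
  have m1 : measurable_fun setT (fun p : R * R => (1 + p.1 * c) * p.2).
    apply: measurable_funM => //; apply: measurable_funD => //.
    exact: measurable_funM.
  apply: measurable_funM; first by apply: measurable_fun_powR.
  apply: measurable_funM; first by apply: measurable_fun_powR.
  by apply: measurable_fun_expR; exact: measurable_funN.
have K0 v u : 0 <= K (v, u) by rewrite /K !mulr_ge0 ?powR_ge0 ?expR_ge0.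
transitivity (\int[mu]_(v in `]0%R, +oo[) \int[mu]_(u in `]0%R, +oo[) (K (v, u))%:E)%E.
  rewrite /J -ge0_integralZl_real//; last first.
  - by move=> v _; rewrite mulr_ge0 ?powR_ge0.
  - apply: measurable_funM; apply: measurable_fun_powR => //.
    by apply: measurable_funD => //; exact: measurable_funM.
  apply: eq_integral => v; rewrite inE/= in_itv/= andbT => v0.
  have vc : 0 < 1 + v * c by rewrite addr_gt0// mulr_gt0.
  rewrite /K/= ge0_integralZl_real//; last 3 first.
  - exact: measurable_powR_expR.
  - by move=> u _; exact: powR_expR_ge0.
  - exact: powR_ge0.
  rewrite [X in (_ * X)%E](gamma_integralE b0 vc) -EFinM; congr _%:E.
  by rewrite mulrCA.
transitivity (\int[mu]_(u in `]0%R, +oo[) \int[mu]_(v in `]0%R, +oo[) (K (v, u))%:E)%E.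
  apply: (@ge0_fubini_in _ _ _ _ _ mu mu `]0%R, +oo[%classic `]0%R, +oo[%classic
    (fun p => (K p)%:E)) => //.
  - by apply: measurable_funTS; exact/measurable_EFinP.
  - by move=> v u _ _; rewrite lee_fin.
transitivity (\int[mu]_(u in `]0%R, +oo[)
    (Gamma n * c `^ (- n) * (u `^ (b - n - 1) * expR (- (1 * u))))%:E)%E.
  apply: eq_integral => u; rewrite inE/= in_itv/= andbT => u0.
  have cu : 0 < c * u by exact: mulr_gt0.
  transitivity (\int[mu]_(v in `]0%R, +oo[)
      (u `^ (b - 1) * expR (- u) * (v `^ (n - 1) * expR (- (c * u * v))))%:E)%E.
    apply: eq_integral => v _; congr _%:E; rewrite /K/=.
    rewrite (_ : - ((1 + v * c) * u) = - u + - (c * u * v)); last by ring.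
    by rewrite expRD; ring.
  rewrite ge0_integralZl_real//; last 3 first.
  - exact: measurable_powR_expR.
  - by move=> v _; exact: powR_expR_ge0.
  - by rewrite mulr_ge0 ?powR_ge0 ?expR_ge0.
  rewrite [X in (_ * X)%E](gamma_integralE n0 cu) -EFinM; congr _%:E.
  rewrite mul1r powRM ?(ltW c0) ?(ltW u0)//.
  rewrite (_ : b - n - 1 = (b - 1) + (- n)); last by ring.
  rewrite [u `^ (b - 1 + - n)]powRD; last by rewrite (gt_eqF u0) implybT.
  by move: (Gamma n) (u `^ _) (u `^ _) (c `^ _) (expR _) => *; ring.
rewrite ge0_integralZl_real//; last 3 first.
- exact: measurable_powR_expR.
- by move=> v _; exact: powR_expR_ge0.
- by rewrite !mulr_ge0 ?powR_ge0 ?ltW ?Gamma_gt0.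
have G1 : Gamma (b - n) * 1 `^ (- (b - n)) = Gamma (b - n) by rewrite powR1 mulr1.
have := gamma_integralE bn ltr01; rewrite /gamma_integral G1 => ->.
by rewrite -EFinM.
Qed.

Section decay.
Variable R : realType.
Context (d : measure_display) (T : measurableType d) (P : probability T R).
Variables (Z : R -> T -> R) (del z0 n : R).
Hypotheses (del0 : 0 < del) (n0 : 0 < n) (n1 : 0 < n + del / 2 - 1) (z0_ge0 : 0 <= z0).
Hypothesis HZ : is_squared_bessel P del z0 Z.

Local Notation mu := (@lebesgue_measure R).
Local Notation killed := (killed Z del n).

Let mZ t : 0 <= t -> measurable_fun [set: T] (Z t). Proof. by case: HZ => + _ _ _ _; apply. Qed.
Let Z_ge0 t w : 0 <= t -> 0 <= Z t w. Proof. by case: HZ => _ + _ _ _; apply. Qed.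

Let hexp0E v y : hexp del n v 0 y = y `^ n * expR (- (y * v)).
Proof. by rewrite /hexp mulr0 addr0 powR1 mul1r divr1 [v * y]mulrC. Qed.

(** Rescaling [v] by [y] cancels [y ^ n]. At [y = 0] the integrand vanishes instead, so the formula
    is used only off the null event [Z H = 0]. *)
Lemma integral_hexp0 y : 0 < y ->
  (\int[mu]_(v in `]0%R, +oo[) (v `^ (n - 1) * hexp del n v 0 y)%:E = (Gamma n)%:E)%E.
Proof.
move=> y0.
transitivity (\int[mu]_(v in `]0%R, +oo[) (y `^ n * (v `^ (n - 1) * expR (- (y * v))))%:E)%E.
  by apply: eq_integral => v _; rewrite hexp0E mulrCA.
rewrite ge0_integralZl_real//; last 3 first.
- exact: measurable_powR_expR.
- by move=> v _; exact: powR_expR_ge0.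
- exact: powR_ge0.
have := gamma_integralE n0 y0; rewrite /gamma_integral => ->.
by rewrite -EFinM mulrCA -powRD ?subrr ?powRr0 ?mulr1//; rewrite (gt_eqF y0) implybT.
Qed.

Lemma integral_killed H : 0 < H ->
  ((Gamma n)%:E * \int[P]_w killed H w =
   \int[mu]_(v in `]0%R, +oo[) (v `^ (n - 1) * hexp del n v H z0)%:E)%E.
Proof.
move=> H0; have H0' := ltW H0.
pose G v w := (v `^ (n - 1) * hexp del n v 0 (Z H w))%R.
have G0 v w : 0 <= G v w by rewrite /G; apply: mulr_ge0; [exact: powR_ge0|exact: hexp_ge0].
have mG : measurable_fun [set: T * R] (fun p => (G p.2 p.1)%:E).
  apply/measurable_EFinP; rewrite (_ : (fun p => _) = fun p : T * R =>
    p.2 `^ (n - 1) * (Z H p.1 `^ n * expR (- (Z H p.1 * p.2)))); last first.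
    by apply/funext => p; rewrite /G hexp0E.
  have mZ1 : measurable_fun [set: T * R] (fun p : T * R => Z H p.1).
    exact: (measurableT_comp (mZ H0') measurable_fst).
  apply: measurable_funM; first by apply: measurable_fun_powR; exact: measurable_snd.
  apply: measurable_funM; first exact: measurable_fun_powR.
  by apply: measurable_fun_expR; apply: measurable_funN; exact: measurable_funM.
have mk : measurable_fun [set: T] (killed H) by exact: (measurable_killed n0 n1 HZ H0').
have k0 w : (0 <= killed H w)%E by exact: killed_ge0.
have mkG : measurable_fun [set: T * R] (fun p => killed H p.1 * (G p.2 p.1)%:E)%E.
  by apply: emeasurable_funM => //; exact: (measurableT_comp mk measurable_fst).
transitivity (\int[P]_w \int[mu]_(v in `]0%R, +oo[) (killed H w * (G v w)%:E))%E.
  rewrite -ge0_integralZl//; last by rewrite lee_fin ltW// Gamma_gt0.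
  apply: ae_eq_integral.
  - exact: measurableT.
  - by apply: emeasurable_funM; [exact: measurable_cst|exact: mk].
  - apply: (@measurable_fun_integral_in _ _ T (measurableTypeR R) R mu setT `]0, +oo[
      (fun w v => (killed H w * (G v w)%:E)%E)) => //.
      exact: measurable_funTS.
    by move=> w v _ _; rewrite mule_ge0// lee_fin.
  - apply: filterS (squared_bessel_neq0 HZ H0) => w zn0 _.
    have zp : 0 < Z H w by rewrite lt_neqAle eq_sym zn0 Z_ge0.
    rewrite ge0_integralZl//; first by rewrite integral_hexp0// muleC.
    + apply: measurable_funTS.
      exact: (measurableT_comp mG (pair1_measurable w)).
    + by move=> v _; rewrite lee_fin.
transitivity (\int[mu]_(v in `]0%R, +oo[) \int[P]_w (killed H w * (G v w)%:E))%E.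
  apply: (@ge0_fubini_in _ _ _ _ _ P mu setT `]0%R, +oo[%classic
    (fun p => killed H p.1 * (G p.2 p.1)%:E)%E) => //.
  - exact: measurable_funTS.
  - by move=> w v _ _; rewrite mule_ge0// lee_fin.
apply: eq_integral => v; rewrite inE/= in_itv/= andbT => v0.
rewrite EFinM -(killed_hexp del0 n0 n1 HZ v0 H0) -ge0_integralZl//.
- by apply: eq_integral => w _; rewrite EFinM muleCA.
- apply: emeasurable_funM => //; apply/measurable_EFinP.
  exact: (measurableT_comp (@measurable_hexp R del n v _ setT) (mZ H0')).
- by move=> w _; rewrite mule_ge0// lee_fin hexp_ge0.
- by rewrite lee_fin powR_ge0.
Qed.

Definition decay_constant : R :=
  z0 `^ n * (1 / 2 `^ n) * (Gamma (n + del / 2) / Gamma (2 * n + del / 2)).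

Local Notation C := decay_constant.

Lemma killed_bounds H : 0 < H ->
  ((expR (- (z0 / (2 * H))) * C)%:E <= (H `^ n)%:E * \int[P]_w killed H w <= C%:E)%E.
Proof.
move=> H0.
pose b := del / 2 + 2 * n.
have a0 : 0 < del / 2 by rewrite divr_gt0.
have nb : n < b by move: n0 a0; rewrite /b; lra.
have H2 : 0 < 2 * H by rewrite mulr_gt0.
pose J := Gamma n * (2 * H) `^ (- n) * Gamma (b - n) / Gamma b.
have JE := integral_beta_prime n0 nb H2; rewrite -/J in JE.
have mB : measurable_fun (`]0, +oo[ : set R) (fun v : R => v `^ (n - 1) * (1 + v * (2 * H)) `^ (- b)).
  apply: measurable_funM; apply: measurable_fun_powR => //.
  by apply: measurable_funD => //; exact: measurable_funM.
have mh : measurable_fun (`]0, +oo[ : set R) (fun v : R => v `^ (n - 1) * hexp del n v H z0).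
  have mden : measurable_fun (`]0, +oo[ : set R) (fun v : R => 1 + 2 * v * H).
    by apply: measurable_funD => //; apply: measurable_funM => //; exact: measurable_funM.
  apply: measurable_funM; first exact: measurable_fun_powR.
  apply: measurable_funM; first exact: measurable_fun_powR.
  apply: measurable_funM => //; apply: measurable_fun_expR; apply: measurable_funN.
  apply: measurable_funM => //; apply: measurable_funM => //.
  exact: measurable_fun_invr.
have B0 (v : R) : 0 <= v `^ (n - 1) * (1 + v * (2 * H)) `^ (- b).
  by rewrite mulr_ge0 ?powR_ge0.
have cmp (v : R) : 0 < v ->
    expR (- (z0 / (2 * H))) * z0 `^ n * (v `^ (n - 1) * (1 + v * (2 * H)) `^ (- b)) <=
    v `^ (n - 1) * hexp del n v H z0 <=
    z0 `^ n * (v `^ (n - 1) * (1 + v * (2 * H)) `^ (- b)).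
  move=> v0; have den : 0 < 1 + 2 * v * H by rewrite addr_gt0// !mulr_gt0.
  (* [v / (1 + 2 v H) <= 1 / (2 H)] uniformly in [v], so the exponential leaves the integral. *)
  have E1 : v / (1 + 2 * v * H) * z0 <= z0 / (2 * H).
    rewrite mulrC; apply: ler_wpM2l => //.
    rewrite ler_pdivrMr// mulrC ler_pdivlMr//; lra.
  have E0 : 0 <= v / (1 + 2 * v * H) * z0 by rewrite mulr_ge0// divr_ge0 ?ltW.
  have -> : v `^ (n - 1) * hexp del n v H z0 =
      expR (- (v / (1 + 2 * v * H) * z0)) *
      (z0 `^ n * (v `^ (n - 1) * (1 + v * (2 * H)) `^ (- b))).
    rewrite /hexp (_ : v * (2 * H) = 2 * v * H); last by ring.
    by rewrite -/b; ring.
  have F0 : 0 <= z0 `^ n * (v `^ (n - 1) * (1 + v * (2 * H)) `^ (- b)).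
    by apply: mulr_ge0 => //; exact: powR_ge0.
  apply/andP; split; last by apply: ler_piMl => //; rewrite expR_le1 oppr_le0.
  by rewrite -mulrA; apply: ler_wpM2r => //; rewrite ler_expR lerN2.
have G0 := Gamma_gt0 n0.
have zn0 : 0 <= z0 `^ n by exact: powR_ge0.
have lo : ((expR (- (z0 / (2 * H))) * z0 `^ n * J)%:E <=
    (Gamma n)%:E * \int[P]_w killed H w)%E.
  rewrite integral_killed// EFinM -JE -ge0_integralZl_real//; last first.
    by rewrite mulr_ge0 ?expR_ge0.
  apply: ge0_le_integral => //.
  - by move=> v _; rewrite lee_fin mulr_ge0// mulr_ge0 ?expR_ge0.
  - by apply/measurable_EFinP; exact: measurable_funM.
  - exact/measurable_EFinP.
  - by move=> v; rewrite /= in_itv/= andbT => v0; rewrite lee_fin; case/andP: (cmp v v0).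
have hi : ((Gamma n)%:E * \int[P]_w killed H w <= (z0 `^ n * J)%:E)%E.
  rewrite integral_killed// EFinM -JE -ge0_integralZl_real//.
  apply: ge0_le_integral => //.
  - by move=> v _; rewrite lee_fin mulr_ge0 ?powR_ge0 ?hexp_ge0.
  - exact/measurable_EFinP.
  - by apply/measurable_EFinP; exact: measurable_funM.
  - by move=> v; rewrite /= in_itv/= andbT => v0; rewrite lee_fin; case/andP: (cmp v v0).
(* [(2 H) ^ (- n)] splits into the [H ^ (- n)] that [H ^ n] compensates and the [2 ^ n] of the
   constant; [Gamma n] is the factor to be cancelled at the end. *)
have JC : z0 `^ n * J = Gamma n * (H `^ (- n) * C).
  rewrite /J /decay_constant powRM ?(ltW H0)// [2 `^ (- n)]powRN div1r.
  rewrite (_ : b - n = n + del / 2); last by rewrite /b; ring.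
  rewrite (_ : b = 2 * n + del / 2); last by rewrite /b; ring.
  by move: (Gamma _) (Gamma _) (Gamma _)^-1 (_ `^ _) => *; ring.
have HC : H `^ n * (H `^ (- n) * C) = C.
  by rewrite mulrA -powRD ?subrr ?powRr0 ?mul1r//; rewrite (gt_eqF H0) implybT.
have Hn : (0 <= (H `^ n)%:E)%E by rewrite lee_fin powR_ge0.
have {}lo := lee_wpmul2l Hn lo; have {}hi := lee_wpmul2l Hn hi.
rewrite muleCA in lo; rewrite muleCA in hi.
have Gfin : (Gamma n)%:E \is a fin_num by [].
have Gpos : (0 < (Gamma n)%:E)%E by rewrite lte_fin.
apply/andP; split; rewrite -(lee_pmul2l Gfin Gpos).
  apply: le_trans lo; rewrite le_eqVlt; apply/orP; left; apply/eqP.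
  rewrite -!EFinM; congr _%:E; rewrite -mulrA JC -[in LHS]HC.
  by move: (Gamma n) C (expR _) (_ `^ _) (_ `^ _) => *; ring.
apply: (le_trans hi); rewrite le_eqVlt; apply/orP; left; apply/eqP.
rewrite -!EFinM; congr _%:E; rewrite JC -[in RHS]HC.
by move: (Gamma n) C (_ `^ _) (_ `^ _) => *; ring.
Qed.

End decay.

(** With [s] the square root, [n = (s - mu) / 2] and [n + mu = (s + mu) / 2], both positive because
    [lambda > 0] makes [s] exceed [|mu|]; their product is [lambda / 4]. *)
Lemma decay_exponentP (R : realType) (mu lambda : R) : 0 < lambda ->
  let n := decay_exponent mu lambda in
  [/\ 0 < n, 0 < n + mu & lambda / 2 = 2 * n * (n + mu)].
Proof.
move=> l0 n; pose s := Num.sqrt (mu ^+ 2 + lambda).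
have s2 : s ^+ 2 = mu ^+ 2 + lambda by rewrite sqr_sqrtr// addr_ge0 ?sqr_ge0// ltW.
have mus : `|mu| < s.
  by rewrite -sqrtr_sqr ltr_sqrt ?ltrDl// ltr_wpDl ?sqr_ge0.
have /andP[lo hi] : - s < mu < s by rewrite -ltr_norml.
have nE : n = (- mu + s) / 2 by [].
split; rewrite nE; [lra|lra|].
have -> : lambda = s ^+ 2 - mu ^+ 2 by rewrite s2 addrC addKr.
by field.
Qed.

Lemma cvg_expR_inv (R : realType) (c : R) : expR (- (c / (2 * t))) @[t --> +oo] --> (1 : R).
Proof.
have h : (2 * t)^-1 @[t --> +oo] --> (0 : R).
  apply/gtr0_cvgV0; first by near=> t; rewrite mulr_gt0.
  apply/cvgryPge => A; near=> t.
  have t0 : A / 2 <= t by [].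
  by rewrite mulrC -ler_pdivrMr.
have h2 : - (c / (2 * t)) @[t --> +oo] --> (0 : R).
  by rewrite -oppr0; apply: cvgN; rewrite -(mulr0 c); exact: (cvgMl_tmp (a := c) h).
have h0 : expR y @[y --> (0 : R)] --> (1 : R).
  by rewrite -[X in _ --> X](@expR0 R); exact: continuous_expR.
exact: (@cvg_comp _ _ _ (fun t => - (c / (2 * t))) expR _ _ _ h2 h0).
Unshelve. all: by end_near. Qed.

Theorem theorem7p1 (R : realType) (mu lambda x : R)
    (d : measure_display) (T : measurableType d) (P : probability T R)
    (X : R -> T -> R) :
  -1 < mu -> 0 < lambda -> 0 <= x ->
  is_bessel P mu x X ->
  let n := decay_exponent mu lambda in
  ((t `^ n)%:E *
     \int[P]_w expeR (- ((lambda / 2)%:E * inv_square_integral X t w)))%E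
    @[t --> +oo] -->
  (x `^ (2 * n) * (1 / 2 `^ n) * (Gamma (mu + n + 1) / Gamma (mu + 2 * n + 1)))%:E.
Proof.
move=> mu1 l0 x0 [_ HZ] n; have [n0 nmu lE] := decay_exponentP mu l0; rewrite -/n in n0 nmu lE.
have del0 : 0 < 2 * (mu + 1) by lra.
have halfE : 2 * (mu + 1) / 2 = mu + 1 by field.
(* In dimension [2 (mu + 1)] this quantity is [n + mu]. *)
have n1 : 0 < n + 2 * (mu + 1) / 2 - 1 by rewrite halfE; lra.
have := killed_bounds del0 n0 n1 (sqr_ge0 x) HZ.
have -> : decay_constant (2 * (mu + 1)) (x ^+ 2) n =
    x `^ (2 * n) * (1 / 2 `^ n) * (Gamma (mu + n + 1) / Gamma (mu + 2 * n + 1)).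
  have E1 : n + 2 * (mu + 1) / 2 = mu + n + 1 by field.
  have E2 : 2 * n + 2 * (mu + 1) / 2 = mu + 2 * n + 1 by field.
  have E3 : (x ^+ 2) `^ n = x `^ (2 * n) by rewrite powRrM powR_mulrn.
  by rewrite /decay_constant E1 E2 E3.
set C := _ * _ => bounds.
have killedE t w : killed (fun t w => X t w ^+ 2) (2 * (mu + 1)) n t w =
    expeR (- ((lambda / 2)%:E * inv_square_integral X t w))%E.
  have kE : 2 * n * (n + 2 * (mu + 1) / 2 - 1) = lambda / 2 by rewrite lE; field.
  by rewrite /killed kE.
(* The two bounds differ by a factor tending to [1]; at [x = 0] both are [0], since [n > 0]. *)
apply: (@squeeze_cvge _ _ _ _ (fun t => (expR (- (x ^+ 2 / (2 * t))) * C)%:E) _ (cst C%:E)).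
- near=> t; have /bounds : 0 < t by [].
  by under eq_integral do rewrite killedE.
- apply: cvg_EFin; first by near=> t.
  rewrite -[X in _ --> X]mul1r; exact: (cvgMr_tmp (b := C) (@cvg_expR_inv R (x ^+ 2))).
- exact: cvg_cst.
Unshelve. all: by end_near. Qed.
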